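(* If $a\in\mathcal H$ is real-valued and $f\in\mathcal F$, then $$\mathcal E^{a_n}_n(f)\to\mathcal E^a(f)\quad\text{as }n\to\infty.$$
   Context: Diamond lattice fractal. Fix $0<s\le 1/8$ and for $j=1,2,3,4$ let $F_j:\mathbb R^2\to\mathbb R^2$, $F_j(x_1,x_2)=\bigl(\tfrac12x_1,\ \tfrac12((-1)^jx_1+4s\,x_2)\bigr)+\tfrac1{\sqrt2}\bigl(\cos((2j-1)\pi/4),\sin((2j-1)\pi/4)\bigr)$. $X\subset\mathbb R^2$ is the unique non-empty compact set with $X=\bigcup_{j=1}^4F_j(X)$. Put $V_0=\{(-1,0),(1,0)\}$, $V_m=\bigcup_jF_j(V_{m-1})$, $V_*=\bigcup_mV_m$. For a word $w=w_1\cdots w_m\in\{1,2,3,4\}^m$ write $|w|=m$, $F_w=F_{w_1}\circ\cdots\circ F_{w_m}$; $F_w(X)$ is an $m$-cell with indicator function $\mathbf 1_w$. Write $x\sim_my$ if $\{x,y\}=F_w(V_0)$ for some $|w|=m$. $\mu$ is Hausdorff measure on $X$ scaled so that $\mu(X)=2$. Dirichlet form. $\mathcal E_m(f)=\frac12\sum_{x\in V_m}\sum_{y\sim_mx}|f(x)-f(y)|^2$ is non-decreasing in $m$; when the limit is finite write $f\in\mathcal F$ and $\mathcal E(f)=\lim_m\mathcal E_m(f)$. It is taken as known that $\mathcal E$ is an irreducible local regular Dirichlet form on $L^2(X,\mu)$ with domain $\mathcal F$, and that functions in $\mathcal F$ can be approximated uniformly by functions $h$ harmonic at some finite scale $m$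 (i.e. $\mathcal E_n(h)=\mathcal E_m(h)$ for all $n\ge m$). $1$-forms. $\mathcal H$ is the Hilbert space of $1$-forms of $\mathcal E$: the completion (modulo null vectors) of the span of $f\otimes g$, $f\in\mathcal F$, $g$ bounded Borel, with $\langle f\otimes g,f'\otimes g'\rangle_{\mathcal H}=\int g\overline{g'}\,d\Gamma(f,f')$, where $\Gamma$ is the energy measure normalized by $\Gamma(f,f)(X)=\mathcal E(f)$. The derivation $\partial:\mathcal F\to\mathcal H$ is $\partial f=f\otimes\mathbf 1$, so $\|\partial f\|_{\mathcal H}^2=\mathcal E(f)$; multiplication is $h(f\otimes g)=f\otimes(hg)$. A $1$-form is real-valued if it lies in the closure of the real span of $f\otimes g$ with $f,g$ real-valued. Projections. $\mathcal H_m\subset\mathcal H$ is the (finite-dimensional) span of the elements $(\partial A)\mathbf 1_w$ with $|w|=m$ and $A$ harmonic at scale $m$; $\bigcup_m\mathcal H_m$ is dense in $\mathcal H$. $a_m$ denotes the orthogonal projection of $a$ onto $\mathcal H_m$. For real $a$, $a_m=\sum_{|w|=m}(\partial A_w)\mathbf 1_w$ with $A_w$ real-valued, harmonic at scale $m$, unique modulo constants on $F_w(X)$. For $n\ge m$ and an edge $x\sim_ny$ contained in the $m$-cell $F_w(X)$, put $a_m(e_{xy})=A_w(y)-A_w(x)$. Magnetic forms. $\mathcal E^a(f)=\|(\partial+ia)f\|_{\mathcal H}^2$ with $(\partial+ia)f=\partial f+i\,fa$, and for $n\ge m$, $\mathcal E^{a_m}_n(f)=\frac12\sum_{x\in V_n}\sum_{y\sim_nx}\bigl|f(x)-f(y)e^{ia_m(e_{xy})}\bigr|^2$.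 *)

(* Defs.v *)
From HB Require Import structures.
From mathcomp Require Import all_boot all_order all_algebra.
From mathcomp Require Import complex.
From mathcomp Require Import all_classical all_reals all_analysis.

Set Implicit Arguments.
Unset Strict Implicit.
Unset Printing Implicit Defensive.

Import Order.TTheory GRing.Theory Num.Theory.
Import numFieldNormedType.Exports.

Local Open Scope classical_set_scope.
Local Open Scope ring_scope.

(* Squared norm of a complex number or of a vector, as an element of R: norms
   over R[i] take their values in R[i]. *)
Definition sqnorm (R : realType) (V : normedZmodType R[i]) (v : V) : R :=
  complex.Re `|v| ^+ 2.

(* The sesquilinear form (linear on the left) of a quadratic form Q on
   complex-valued functions on T. *)
Definition polar (R : realType) (T : Type) (Q : (T -> R[i]) -> R[i])
    (f g : T -> R[i]) : R[i] :=
  4^-1 * \sum_(k < 4) 'i ^+ k * Q (fun z => f z + 'i ^+ k * g z).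

Section Lattice.
Context (R : realType).
Implicit Types (s : R) (X : set (R * R)).

(* Letters and maps are numbered 0, ..., 3 instead of 1, ..., 4. *)
Definition F s (j : 'I_4) (z : R * R) : R * R :=
  (2^-1 * z.1 + (Num.sqrt 2)^-1 * cos ((2 * j.+1 - 1)%N%:R * pi / 4),
   2^-1 * ((-1) ^+ j.+1 * z.1 + 4 * s * z.2)
     + (Num.sqrt 2)^-1 * sin ((2 * j.+1 - 1)%N%:R * pi / 4)).

Definition Fw s (w : seq 'I_4) : R * R -> R * R :=
  foldr (fun j g => F s j \o g) id w.

Record is_lattice s X : Prop := {
  lattice_nonempty : X !=set0 ;
  lattice_compact : compact X ;
  lattice_self_similar : X = \bigcup_j F s j @` X }.

Definition V0 : set (R * R) := [set (-1, 0); (1, 0)].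

Fixpoint V s (m : nat) : set (R * R) :=
  if m is n.+1 then \bigcup_j F s j @` V s n else V0.

Definition adj s (m : nat) (x y : R * R) : Prop :=
  exists w : m.-tuple 'I_4, [set x; y] = Fw s w @` V0.

Definition cell s X (w : seq 'I_4) : set (R * R) := Fw s w @` X.

Definition cell_indic s X (w : seq 'I_4) (z : R * R) : R[i] :=
  (\1_(cell s X w) z)%:C%C.

(* Functions on X are represented by functions on the plane, of which only
   the restriction to X is ever constrained or used. *)

Definition energy_at s (m : nat) (f : R * R -> R[i]) : R :=
  2^-1 * \sum_(x \in V s m) \sum_(y \in [set y | adj s m x y])
    sqnorm (f x - f y).

Definition energy s (f : R * R -> R[i]) : R :=
  limn (fun m => energy_at s m f).

(* The elements of the domain are uniform limits of (continuous) functions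
   that are harmonic at a finite scale, hence continuous. *)
Definition in_domain s X (f : R * R -> R[i]) : Prop :=
  [/\ {within X, continuous (fun z => complex.Re (f z))},
      {within X, continuous (fun z => complex.Im (f z))} &
      cvgn (fun m => energy_at s m f)].

Definition energy_form s : (R * R -> R[i]) -> (R * R -> R[i]) -> R[i] :=
  polar (fun f => (energy s f)%:C%C).

Definition harmonic_at s X (m : nat) (h : R * R -> R[i]) : Prop :=
  in_domain s X h /\
  forall n, (m <= n)%N -> energy_at s n h = energy_at s m h.

Definition bounded_borel X (g : R * R -> R[i]) : Prop :=
  [/\ measurable_fun X (fun z => complex.Re (g z)),
      measurable_fun X (fun z => complex.Im (g z)) &
      exists M : R, forall z, X z -> sqnorm (g z) <= M].

Definition Cintegral X (nu : {finite_measure set (R * R)%type -> \bar R})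
    (g : R * R -> R[i]) : R[i] :=
  (\int[nu]_(z in X) complex.Re (g z) +i* \int[nu]_(z in X) complex.Im (g z))%C.

(* G f is the energy measure Gamma(f,f). On real-valued functions the condition
   is int g dGamma(f,f) = E(gf,f) - E(g,f^2)/2; the case g = 1 is
   Gamma(f,f)(X) = E(f). *)
Definition is_energy_measure s X
    (G : (R * R -> R[i]) -> {finite_measure set (R * R)%type -> \bar R}) : Prop :=
  forall f g, in_domain s X f -> in_domain s X g ->
  Cintegral X (G f) g =
    2^-1 * (energy_form s (fun z => g z * f z) f
            + energy_form s f (fun z => Num.conj (g z) * f z)
            - energy_form s g (fun z => `|f z| ^+ 2)).

(* The integral of g against the complex measure Gamma(f,f'). *)
Definition Gamma_integral X
    (G : (R * R -> R[i]) -> {finite_measure set (R * R)%type -> \bar R})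
    (f f' g : R * R -> R[i]) : R[i] :=
  polar (fun h => Cintegral X (G h) g) f f'.

End Lattice.

(* Linear combinations of elements of S with coefficients in K. *)
Definition lin_span (R : realType) (U : lmodType R[i]) (K : set R[i])
    (S : set U) : set U :=
  [set v | exists (n : nat) (c : 'I_n -> R[i]) (u : 'I_n -> U),
     (forall k, K (c k) /\ S (u k)) /\ v = \sum_k c k *: u k].

Definition is_projection (R : realType) (U : lmodType R[i])
    (ip : {dot U for @Num.conj R[i]}) (S : set U) (u p : U) : Prop :=
  S p /\ forall v, S v -> ip (u - p) v = 0.

Section OneForms.
Context (R : realType) (s : R) (X : set (R * R)).
Context (G : (R * R -> R[i]) -> {finite_measure set (R * R)%type -> \bar R}).
Context (H : completeNormedModType R[i]) (ip : {dot H for @Num.conj R[i]}).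

(* tens f g is the 1-form f (x) g and mul h is the multiplication by h. *)
Context (tens : (R * R -> R[i]) -> (R * R -> R[i]) -> H).
Context (mul : (R * R -> R[i]) -> H -> H).

(* H is a Hilbert space, the completion of the span of the f (x) g modulo null
   vectors; bilinearity of tens follows from tens_ip. These conditions determine
   (H, ip, tens, mul) up to a unitary isomorphism, and mul h is the bounded
   extension of f (x) g |-> f (x) hg. *)
Record is_one_forms : Prop := {
  ip_norm : forall u, ip u u = `|u| ^+ 2 ;
  tens_ip : forall f g f' g',
    in_domain s X f -> bounded_borel X g ->
    in_domain s X f' -> bounded_borel X g' ->
    ip (tens f g) (tens f' g')
      = Gamma_integral X G f f' (fun z => g z * Num.conj (g' z)) ;
  tens_dense : dense (lin_span setT
    [set u | exists f g, [/\ in_domain s X f, bounded_borel X g &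
                             u = tens f g]]) ;
  mul_linear : forall h, bounded_borel X h -> linear (mul h) ;
  mul_continuous : forall h, bounded_borel X h -> continuous (mul h) ;
  mul_tens : forall h f g,
    bounded_borel X h -> in_domain s X f -> bounded_borel X g ->
    mul h (tens f g) = tens f (fun z => h z * g z) }.

Definition derivation (f : R * R -> R[i]) : H := tens f (cst 1).

Definition real_valued (f : R * R -> R[i]) : Prop :=
  forall z, X z -> f z \is Num.real.

Definition real_form : set H :=
  closure (lin_span [set c | c \is Num.real]
    [set u | exists f g,
       [/\ in_domain s X f /\ real_valued f,
           bounded_borel X g /\ real_valued g & u = tens f g]]).

Definition H_ (m : nat) : set H :=
  lin_span setT
    [set u | exists (w : m.-tuple 'I_4) (A : R * R -> R[i]),
       harmonic_at s X m A /\ u = mul (cell_indic s X w) (derivation A)].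

(* The real functions A w, harmonic at scale m, represent the element b of
   H_ m. *)
Definition represents (m : nat) (A : m.-tuple 'I_4 -> R * R -> R) (b : H) :
    Prop :=
  (forall w, harmonic_at s X m (fun z => (A w z)%:C%C)) /\
  b = \sum_(w : m.-tuple 'I_4)
        mul (cell_indic s X w) (derivation (fun z => (A w z)%:C%C)).

(* The value on the edge from x to y of the 1-form represented by A. When
   x and y are adjacent at a scale n >= m, exactly one m-cell contains both. *)
Definition edge_value (m : nat) (A : m.-tuple 'I_4 -> R * R -> R)
    (x y : R * R) : R :=
  if [pick w : m.-tuple 'I_4 | `[< cell s X w x /\ cell s X w y >]] is Some w
  then A w y - A w x else 0.

Definition mag_energy_at (n m : nat) (A : m.-tuple 'I_4 -> R * R -> R)
    (f : R * R -> R[i]) : R :=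
  2^-1 * \sum_(x \in V s n) \sum_(y \in [set y | adj s n x y])
    sqnorm (f x - f y * (cos (edge_value A x y) +i* sin (edge_value A x y))%C).

Definition mag_energy (a : H) (f : R * R -> R[i]) : R :=
  sqnorm (derivation f + 'i *: mul f a).

End OneForms.

(* Main.v *)
(* The first coordinate x_1 is harmonic, with increment 2 * 2^-n along every edge
   of scale n, so its energy measure nu gives mass 4^(1-n) to each n-cell and the
   forms (d x_1) 1_w, |w| = n, are orthogonal with squared norm 4^(1-n). The
   projection of df onto their span has squared norm E_n(f); hence df is the
   limit of these step forms, exactly so for f harmonic at scale n. Then the step
   forms are dense, the span contains H_n, and a_n -> a.

   E_n^{a_n}(f) is the squared norm of the step form with value
   f(y) e^{i a_n(e)} - f(x) on the edge e from x to y. Expanding e^{it} as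
   1 + it + o(t), this form is the sum of the projection of df, of a form
   close to i f a_n, and of a remainder. Since the squares of the a_n(e) add up to
   |a_n|^2 <= |a|^2 and max_e |a_n(e)| -> 0, the remainder vanishes, and the step
   form converges to df + i f a. *)
Require Import Defs.
From HB Require Import structures.
From mathcomp Require Import all_boot all_order all_algebra.
From mathcomp Require Import complex.
From mathcomp Require Import all_classical all_reals all_analysis.
From mathcomp Require Import measurable_realfun.
From mathcomp Require Import ring lra.

Set Implicit Arguments.
Unset Strict Implicit.
Unset Printing Implicit Defensive.

Import Order.TTheory GRing.Theory Num.Theory.
Import numFieldNormedType.Exports.

Local Open Scope classical_set_scope.
Local Open Scope ring_scope.

(** * Geometry of the lattice *)

(** The measures [G f] are known only through integrals over X of functions in the domain, so
    neither the masses of cells nor orthogonality can be read off. Lipschitz functions bridge the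
    gap: edges have slope at most 2, which puts these functions in the domain, and their limits
    include the indicators of closed sets, which determine a finite measure. Cells of one level may
    touch, so their overlaps must be shown to be null. Overlaps lie in vertical lines, because the
    maps act on the first coordinate by itself, and harmonicity of x_1 keeps nu from charging such
    lines. A second obstacle is that df has to be paired with the indicator of a cell, which is not
    assumed to be in the domain. A weighted AM-GM inequality bounds what a tent function picks up
    outside of the cell by a small multiple of E(f) plus a multiple of the excess nu-mass; the
    excess is sent to 0 first. For density, f (x) g is g times df, and df is a limit of step forms;
    multiplication by g then leaves forms h dx_1 with h bounded Borel, so the matter becomes
    approximation of h in L^2(nu) by functions constant on cells. *)

Lemma geometric_small (R : realType) (r C e : R) :
  0 <= r < 1 -> 0 < e -> exists n, C * r ^+ n < e.
Proof.
move=> /andP[r0 r1] e0.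
have [C0|C0] := leP C 0; first by exists 0; rewrite expr0; lra.
have /cvgrPdist_lt/(_ (e / C)) : r ^+ n @[n --> \oo] --> (0 : R).
  by apply: cvg_expr; rewrite ger0_norm.
rewrite divr_gt0// => /(_ isT) [N _ /(_ N (leqnn _))] /=.
rewrite sub0r normrN ger0_norm ?exprn_ge0// => h.
by exists N; rewrite mulrC -ltr_pdivlMr.
Qed.

Lemma le0_geometric (R : realType) (r C x : R) :
  0 <= r < 1 -> (forall n, x <= C * r ^+ n) -> x <= 0.
Proof.
move=> r01 h; rewrite leNgt; apply/negP => x0.
by have [n] := geometric_small C r01 x0; rewrite ltNge h.
Qed.

Lemma cos_piquarter (R : realType) : cos (pi / 4 : R) = (Num.sqrt 2)^-1.
Proof.
have p2 : (pi / 4 : R) *+ 2 = pi / 2 by rewrite mulr2n; lra.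
have c2 : cos (pi / 4 : R) ^+ 2 = 2^-1.
  by have := cos_mulr2n (pi / 4 : R); rewrite p2 cos_pihalf mulr2n; lra.
have c0 : 0 <= cos (pi / 4 : R).
  by apply: cos_ge0_pihalf; have := @pi_gt0 R => ?; apply/andP; split; lra.
by rewrite -sqrtrV// -c2 sqrtr_sqr ger0_norm.
Qed.

Lemma sin_piquarter (R : realType) : sin (pi / 4 : R) = (Num.sqrt 2)^-1.
Proof.
by rewrite -cosBpihalf -cos_piquarter -cosN; congr cos; lra.
Qed.

Section Geometry.
Context {R : realType} {s : R}.

(** The angles are pi/4 plus 0 to 3 quarter turns, and cos(pi/4) / sqrt 2 is 1/2. The rational
    formulas turn later facts about the maps into linear arithmetic. *)
Lemma FE (j : 'I_4) (z : R * R) : F s j z =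
  match val j with
  | 0 => ((z.1 + 1) / 2, (1 - z.1) / 2 + 2 * s * z.2)
  | 1 => ((z.1 - 1) / 2, (1 + z.1) / 2 + 2 * s * z.2)
  | 2 => ((z.1 - 1) / 2, - (1 + z.1) / 2 + 2 * s * z.2)
  | _ => ((z.1 + 1) / 2, - (1 - z.1) / 2 + 2 * s * z.2)
  end.
Proof.
have q2 : (Num.sqrt 2)^-1 * (Num.sqrt 2)^-1 = 2^-1 :> R.
  by rewrite -invfM -expr2 sqr_sqrtr.
case: j => [[|[|[|[|//]]]] lj]; rewrite /F /=.
- rewrite (_ : ((2 * 1 - 1)%N%:R * pi / 4) = pi / 4 :> R); last by rewrite mul1r.
  rewrite cos_piquarter sin_piquarter q2 expr1.
  by congr (_, _); lra.
- rewrite (_ : ((2 * 2 - 1)%N%:R * pi / 4) = pi / 4 + pi / 2 :> R); last by rewrite (_ : (2 * 2 - 1)%N = 3%N)//; lra.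
  rewrite cosDpihalf sinDpihalf cos_piquarter sin_piquarter mulrN q2 sqrrN expr1n.
  by congr (_, _); lra.
- rewrite (_ : ((2 * 3 - 1)%N%:R * pi / 4) = pi / 4 + pi / 2 + pi / 2 :> R); last by rewrite (_ : (2 * 3 - 1)%N = 5%N)//; lra.
  rewrite cosDpihalf !sinDpihalf cosDpihalf cos_piquarter sin_piquarter !mulrN q2.
  by rewrite !exprS expr0; congr (_, _); lra.
- rewrite (_ : ((2 * 4 - 1)%N%:R * pi / 4) = pi / 4 + pi / 2 + pi / 2 + pi / 2 :> R); last by rewrite (_ : (2 * 4 - 1)%N = 7%N)//; lra.
  rewrite !(cosDpihalf, sinDpihalf) cos_piquarter sin_piquarter !mulrN !opprK q2.
  by rewrite !exprS expr0; congr (_, _); lra.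
Qed.

Local Opaque F.

Lemma Fw_cat (w v : seq 'I_4) (z : R * R) : Fw s (w ++ v) z = Fw s w (Fw s v z).
Proof. by elim: w => //= j w ->. Qed.

Lemma Fw_rcons (w : seq 'I_4) j (z : R * R) : Fw s (rcons w j) z = Fw s w (F s j z).
Proof. by rewrite -cats1 Fw_cat. Qed.

(** The first coordinate of [F s j z] depends on [z.1] alone, with the same slope 1/2 for all four
    letters. This is why x_1 has equal increments, of constant sign, along all edges of a scale. *)
Lemma Fw_fst (w : seq 'I_4) : exists c : R,
  forall z, (Fw s w z).1 = 2^-1 ^+ size w * z.1 + c.
Proof.
elim: w => [|j w [c IH]]; first by exists 0 => z /=; rewrite expr0; lra.
have [e he] : exists e : R, forall z, (F s j z).1 = 2^-1 * z.1 + e.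
  by exists ((F s j (0, 0)).1) => z; rewrite !FE /=;
     case: j => [[|[|[|[|//]]]] lj] /=; lra.
exists (2^-1 * c + e) => z /=.
by rewrite he IH exprS; lra.
Qed.

(* A weighted l1 distance for which every F s j is a 5/8-contraction. *)
Definition wdist (z z' : R * R) : R := 4 * `|z.1 - z'.1| + `|z.2 - z'.2|.

Lemma wdist_ge0 z z' : 0 <= wdist z z'.
Proof. by rewrite /wdist; have := normr_ge0 (z.1 - z'.1); have := normr_ge0 (z.2 - z'.2); lra. Qed.

Hypotheses (s_gt0 : 0 < s) (s_le : s <= 8^-1).

Lemma twos_norm y : `|2 * s * y| <= 4^-1 * `|y|.
Proof.
have s2 : 0 <= 2 * s by move: s_gt0; lra.
by rewrite normrM (ger0_norm s2); apply: ler_wpM2r => //; move: s_le; lra.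
Qed.

(** Increments x, y of the coordinates become |x|/2 and at most |x|/2 + |y|/4, as 2s <= 1/4. With
    weight 4 on the first, the sum is at most 5/2 |x| + 1/4 |y|, whence 5/8. *)
Lemma wdist_F j z z' : wdist (F s j z) (F s j z') <= 5 / 8 * wdist z z'.
Proof.
rewrite /wdist.
have h (a b x y : R) : a = x / 2 \/ a = - x / 2 -> b = a + 2 * s * y \/ b = - a + 2 * s * y ->
   4 * `|a| + `|b| <= 5 / 8 * (4 * `|x| + `|y|).
  move=> ha hb.
  have hb' : `|b| <= `|a| + 4^-1 * `|y|.
    have := twos_norm y.
    have := ler_normD a (2 * s * y); have := ler_normD (- a) (2 * s * y).
    by rewrite normrN; case: hb => ->; lra.
  have ea : `|a| = `|x| / 2.
    by case: ha => ->; rewrite normrM ?normrN; congr (_ * _); rewrite ger0_norm.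
  by have := normr_ge0 y; move: hb'; rewrite ea; lra.
apply: h.
  by left; rewrite !FE; case: j => [[|[|[|[|//]]]] lj] /=; lra.
by rewrite !FE; case: j => [[|[|[|[|//]]]] lj] /=; [right|left|right|left]; lra.
Qed.

Lemma wdist_Fw w z z' : wdist (Fw s w z) (Fw s w z') <= (5 / 8) ^+ size w * wdist z z'.
Proof.
elim: w => [|j w IH] /=; first by rewrite expr0 mul1r.
apply: (le_trans (wdist_F _ _ _)); rewrite exprS -(mulrA (5 / 8)).
by apply: ler_wpM2l => //; lra.
Qed.

(** The vertical scaling is 2s, so s > 0 is essential here. Injectivity lets common prefixes of two
    words be cancelled. *)
Lemma F_inj j : injective (F s j).
Proof.
move=> [x y] [x' y']; rewrite !FE /=.
have h : 2 * s * y = 2 * s * y' -> y = y'.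
  by apply: mulfI; rewrite gt_eqF// mulr_gt0.
by case: j => [[|[|[|[|//]]]] lj] /= [e1 e2];
  have ex : x = x' by [lra|]; rewrite ex in e2 *; congr (_, _); apply: h; lra.
Qed.

Lemma wdist_closed (C : set (R * R)) z : closed C ->
  (forall e, 0 < e -> exists2 z', C z' & wdist z z' < e) -> C z.
Proof.
move=> cC h; rewrite (closure_id C).1//; move=> B /nbhs_ballP [e /= e0 Be].
have [z' Cz' zz'] := h e e0; exists z'; split => //; apply: Be.
move: zz'; rewrite /wdist => zz'.
have := normr_ge0 (z.1 - z'.1); have := normr_ge0 (z.2 - z'.2) => h1 h2.
by split; rewrite /ball /=; lra.
Qed.

(** * Location of the lattice in a rhombus, and overlaps of cells *)

Context (X : set (R * R)).
Hypothesis latticeX : is_lattice s X.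

Lemma lattice_closed : closed X.
Proof.
apply: compact_closed; last exact: lattice_compact latticeX.
exact: norm_hausdorff.
Qed.

Lemma lattice_bounded : exists2 M : R, 0 <= M & forall z, X z -> `|z.1| <= M /\ `|z.2| <= M.
Proof.
have [M [_ hM]] := compact_bounded (lattice_compact latticeX).
exists (`|M| + 1); first by rewrite addr_ge0.
move=> z Xz.
have {hM}: `|z| <= `|M| + 1 by apply: hM => //; rewrite ltr_pwDr// ler_norm.
by case: z Xz => x y _; rewrite prod_normE /= ge_max => /andP[].
Qed.

Lemma lattice_F j z : X z -> X (F s j z).
Proof.
by move=> Xz; rewrite (lattice_self_similar latticeX); exists j => //; exists z.
Qed.

Lemma lattice_Fw w z : X z -> X (Fw s w z).
Proof. by elim: w => //= j w IH Xz; apply: lattice_F; apply: IH. Qed.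

Lemma lattice_inv z : X z -> exists j z', X z' /\ z = F s j z'.
Proof.
rewrite {1}(lattice_self_similar latticeX) => -[j _ [z' Xz' <-]].
by exists j, z'.
Qed.

(** Iterating the contraction [F s j] from any point of X approaches its fixed point, and X is
    closed. The two points of [V0] are the fixed points of letters 0 and 1. *)
Lemma fixpoint_lattice j z : F s j z = z -> X z.
Proof.
move=> zfix; apply: (wdist_closed lattice_closed) => e e0.
have [z0 Xz0] := lattice_nonempty latticeX.
have [n hn] : exists n, wdist z z0 * (5 / 8) ^+ n < e by apply: geometric_small => //; lra.
exists (Fw s (nseq n j) z0); first exact: lattice_Fw.
have <- : Fw s (nseq n j) z = z by elim: (n) => //= k ->.
by apply: (le_lt_trans (wdist_Fw _ _ _)); rewrite size_nseq mulrC.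
Qed.

Lemma lattice_right : X (1, 0).
Proof. by apply: (@fixpoint_lattice ord0); rewrite FE /=; congr (_, _); lra. Qed.

Lemma lattice_left : X (-1, 0).
Proof. by apply: (@fixpoint_lattice (lift ord0 ord0)); rewrite FE /=; congr (_, _); lra. Qed.

(** Unfolding the self-similarity n times improves a crude upper bound C, available by compactness,
    to C / 2^n. *)
Lemma lattice_le0 (q : R * R -> R) (C : R) : (forall z, X z -> q z <= C) ->
  (forall j z, X z -> q (F s j z) <= q z / 2) -> forall z, X z -> q z <= 0.
Proof.
move=> qC qF z Xz; apply: (@le0_geometric _ 2^-1 C); first lra.
move=> n; elim: n z Xz => [|n IH] z Xz; first by rewrite expr0 mulr1 qC.
have [j [z' [Xz' ->]]] := lattice_inv Xz.
by have := qF j z' Xz'; have := IH z' Xz'; rewrite exprS; lra.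
Qed.

Lemma lattice_fst_le z : X z -> `|z.1| <= 1.
Proof.
move=> Xz; have [M M0 hM] := lattice_bounded.
suff : `|z.1| - 1 <= 0 by lra.
apply: (@lattice_le0 (fun z => `|z.1| - 1) M) => // [z' /hM [h _]|j z' Xz' /=]; first lra.
rewrite FE; have := ler_normD z'.1 1; have := ler_normB z'.1 1.
rewrite normr1; have n2 : `|2^-1| = 2^-1 :> R by rewrite ger0_norm.
by case: j => [[|[|[|[|//]]]] lj] /=; rewrite normrM n2; lra.
Qed.

(** A reflection, absorbed in the sign of [p], puts the four maps in one frame; the rhombus
    estimates then need no case analysis on the letter. *)
Lemma F_fold j z : `|z.1| <= 1 -> exists p, [/\ `|p| = `|z.1|,
  1 - `|(F s j z).1| = (1 - p) / 2 & `|(F s j z).2| <= (1 - p) / 2 + 4^-1 * `|z.2|].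
Proof.
move=> /ler_normlP [h1 h2]; have /ler_normlP [e1 e2] := twos_norm z.2.
exists (if (val j == 0) || (val j == 3) then z.1 else - z.1).
split; first by case: ifP; rewrite ?normrN.
  rewrite FE; case: j => [[|[|[|[|//]]]] lj] /=;
  by [rewrite ger0_norm; lra | rewrite ler0_norm; lra].
by rewrite FE; case: j => [[|[|[|[|//]]]] lj] /=; apply/ler_normlP; split; lra.
Qed.

(** X lies in the rhombus with vertices (1, 0), (-1, 0), (0, 2), (0, -2): for q = |z.2| - 2 (1 -
    |z.1|), the value of q at an image point is at most q/4. *)
Lemma lattice_snd_le z : X z -> `|z.2| <= 2 * (1 - `|z.1|).
Proof.
move=> Xz; have [M M0 hM] := lattice_bounded.
suff : Num.max 0 (`|z.2| - 2 * (1 - `|z.1|)) <= 0 by rewrite ge_max => /andP[_]; lra.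
(* The truncation at 0 is needed because q/4 is at most q/2 only where q is nonnegative. *)
apply: (@lattice_le0 (fun z => Num.max 0 (`|z.2| - 2 * (1 - `|z.1|))) (M + 2 * M)) => //.
  by move=> z' /hM [h1 h2]; rewrite ge_max; apply/andP; split; lra.
move=> j z' Xz' /=; rewrite ge_max; apply/andP; split.
  by apply: divr_ge0 => //; rewrite le_max lexx.
have [p [p1 -> p2]] := F_fold j (lattice_fst_le Xz').
have := ler_norm p; rewrite p1 => p3.
set m := Num.max _ _.
have : `|z'.2| - 2 * (1 - `|z'.1|) <= m by rewrite /m le_max lexx orbT.
have : 0 <= m by rewrite /m le_max lexx.
by move: p2 p3; lra.
Qed.

(** A point of X on a side of the rhombus has its preimage on a side too, and 1 - |z.1| at least
    doubles on passing to the preimage while never exceeding 1. Hence it is 0. *)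
Lemma lattice_snd_lt z : X z -> `|z.1| < 1 -> `|z.2| < 2 * (1 - `|z.1|).
Proof.
move=> Xz z1; rewrite ltNge; apply/negP => hz.
suff : 1 - `|z.1| <= 0 by lra.
apply: (@le0_geometric _ 2^-1 1); first lra.
move=> n; elim: n z Xz hz {z1} => [|n IH] z Xz hz.
  by rewrite expr0; have := normr_ge0 z.1; lra.
have [j [z' [Xz' zE]]] := lattice_inv Xz.
have [p [p1 p2 p3]] := F_fold j (lattice_fst_le Xz').
have h2 := lattice_snd_le Xz'; have := ler_norm p; rewrite p1 => p4.
move: hz; rewrite {}zE p2 => hz.
have e2 : 2 * (1 - `|z'.1|) <= `|z'.2| by move: hz h2 p2 p3 p4; lra.
by have := IH z' Xz' e2; rewrite exprS; move: hz h2 p2 p3 p4; lra.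
Qed.

Lemma lattice_extremal z : X z -> z.1 = 1 \/ z.1 = -1 -> z.2 = 0.
Proof.
move=> /lattice_snd_le h hz.
have : `|z.1| = 1 by case: hz => ->; rewrite ?normrN normr1.
move=> e; move: h; rewrite e subrr mulr0 => h.
by apply/eqP; rewrite -normr_le0.
Qed.

(** Letters 0, 1 map X to the upper and 2, 3 to the lower half plane, except at the tips (1, 0) and
    (-1, 0). The strict rhombus bound gives |2 s z.2| < (1 - |z.1|)/2, so the other term decides the
    sign, even at s = 1/8. *)
Lemma F_snd_sign j z : X z ->
  (F s j z).1 = (if (val j == 0) || (val j == 3) then 1 else -1) \/
  (if (val j < 2)%N then 0 < (F s j z).2 else (F s j z).2 < 0).
Proof.
move=> Xz.
have [z1|z1] := ltP `|z.1| 1.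
  right; have := lattice_snd_lt Xz z1.
  have := twos_norm z.2.
  move=> /ler_normlP [e1 e2]; move: z1 => /ltr_normlP [h1 h2].
  rewrite FE; case: j => [[|[|[|[|//]]]] lj] /=; case: (ler0P z.1) => ?; lra.
have {}z1 : z.1 = 1 \/ z.1 = -1.
  have := lattice_fst_le Xz => z1'; have : `|z.1| = 1 by apply/le_anti/andP.
  by case: (ler0P z.1) => ? ?; [right|left]; lra.
have z2 := lattice_extremal Xz z1.
by rewrite FE; case: j => [[|[|[|[|//]]]] lj] /=; rewrite z2;
  case: z1 => ->; first [left; lra|right; lra].
Qed.

Lemma F_fst_sign j z : X z ->
  if (val j == 0) || (val j == 3) then 0 <= (F s j z).1 else (F s j z).1 <= 0.
Proof.
move=> /lattice_fst_le /ler_normlP [h1 h2].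
by rewrite FE; case: j => [[|[|[|[|//]]]] lj] /=; lra.
Qed.

(** Letters with sum 3 are on the same side (right for 0 and 3, left for 1 and 2) but in opposite
    half planes, so they meet only at the tip of that side. Any other pair lies on opposite sides of
    the line z.1 = 0. *)
Lemma F_overlap j j' : j != j' -> exists t : R, forall z z', X z -> X z' ->
  F s j z = F s j' z' -> (F s j z).1 = t.
Proof.
move=> jj'.
exists (if val j + val j' == 3 :> nat then
          if (val j == 0) || (val j == 3) then 1 else -1 else 0) => z z' Xz Xz' e.
have := F_snd_sign j Xz; have := F_snd_sign j' Xz'.
have := F_fst_sign j Xz; have := F_fst_sign j' Xz'.
rewrite -e; case: j j' jj' {e} => [[|[|[|[|//]]]] lj] [[|[|[|[|//]]]] lj'] //= jj' *; lra.
Qed.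

(** The first differing letters decide, and the maps of the common prefix send vertical lines to
    vertical lines. Locating the first coordinate is enough: edges are not vertical, and vertical
    lines will be null. *)
Lemma cell_overlap (w v : seq 'I_4) : size w = size v -> w != v ->
  exists t : R, forall z z', X z -> X z' -> Fw s w z = Fw s v z' -> (Fw s w z).1 = t.
Proof.
elim: w v => [|j w IH] [|i v] //= [/IH {}IH].
have [->|ij _] := eqVneq j i; last first.
  have [t ht] := F_overlap ij; exists t => z z' Xz Xz' e.
  by apply: ht e; exact: lattice_Fw.
rewrite eqseq_cons eqxx /= => /IH [t ht].
exists ((F s i (t, 0)).1) => z z' Xz Xz' /F_inj e.
have := ht z z' Xz Xz' e; rewrite !FE => e1.
by case: i {e} => [[|[|[|[|//]]]] li] /=; rewrite e1.
Qed.

End Geometry.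

Local Opaque F.

(** * Discrete energies *)

Lemma complex_normE (R : realType) (c : R[i]) :
  complex.Re `|c| = Num.sqrt (complex.Re c ^+ 2 + complex.Im c ^+ 2).
Proof. by case: c. Qed.

Lemma sqnormE (R : realType) (c : R[i]) :
  sqnorm c = complex.Re c ^+ 2 + complex.Im c ^+ 2.
Proof. by rewrite /sqnorm complex_normE sqr_sqrtr// addr_ge0 ?sqr_ge0. Qed.

Lemma sqnorm_ge0 (R : realType) (V : normedZmodType R[i]) (v : V) : 0 <= sqnorm v.
Proof. exact: sqr_ge0. Qed.

Lemma sqnormB_sym (R : realType) (a b : R[i]) : sqnorm (a - b) = sqnorm (b - a).
Proof. by rewrite /sqnorm distrC. Qed.

Lemma sqnormM (R : realType) (a b : R[i]) : sqnorm (a * b) = sqnorm a * sqnorm b.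
Proof. by case: a b => [a1 a2] [b1 b2]; rewrite !sqnormE /=; ring. Qed.

Lemma sqnorm_real (R : realType) (a : R) : sqnorm (a%:C%C) = a ^+ 2.
Proof. by rewrite sqnormE /= expr0n addr0. Qed.

Lemma sqnorm_conj (R : realType) (a : R[i]) : sqnorm (Num.conj a) = sqnorm a.
Proof. by case: a => a b; rewrite !sqnormE /= sqrrN. Qed.

Lemma sqnormD_le (R : realType) (a b : R[i]) :
  sqnorm (a + b) <= 2 * (sqnorm a + sqnorm b).
Proof.
case: a b => [a1 a2] [b1 b2]; rewrite !sqnormE /=.
by have := sqr_ge0 (a1 - b1); have := sqr_ge0 (a2 - b2); lra.
Qed.

Lemma sum_rcons (V : nmodType) (T : finType) n (g : seq T -> V) :
  \sum_(v : n.+1.-tuple T) g v = \sum_(w : n.-tuple T) \sum_j g (rcons w j).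
Proof.
pose h (p : n.-tuple T * T) : n.+1.-tuple T := [tuple of rcons p.1 p.2].
have h_inj : injective h.
  move=> [w j] [w' j'] /(congr1 val) /= /rcons_inj [e ->].
  by congr (_, _); apply: val_inj.
have [h' h1 h2] : bijective h.
  by apply: (inj_card_bij h_inj); rewrite card_prod !card_tuple expnSr.
rewrite pair_big /= (reindex h) //=; first by exists h' => x _; rewrite ?h1 ?h2.
Qed.

Section Edges.
Context {R : realType} {s : R}.
Implicit Types (w : seq 'I_4) (z : R * R).

Definition lft w : R * R := Fw s w (-1, 0).
Definition rgt w : R * R := Fw s w (1, 0).

Lemma rgtB_lft w : (rgt w).1 - (lft w).1 = 2 * 2^-1 ^+ size w.
Proof. by have [c hc] := @Fw_fst _ s w; rewrite /rgt /lft !hc /=; lra. Qed.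

Lemma lft_lt_rgt w : (lft w).1 < (rgt w).1.
Proof.
by rewrite -subr_gt0 rgtB_lft mulr_gt0// exprn_gt0.
Qed.

Lemma adjE n x y : adj s n x y <-> exists w : n.-tuple 'I_4,
  (x = lft w /\ y = rgt w) \/ (x = rgt w /\ y = lft w).
Proof.
have im w : Fw s w @` @V0 R = [set lft w; rgt w].
  by rewrite /V0 image_setU !image_set1.
split=> [[w]|[w]].
  rewrite im => e; exists w.
  have lr : lft w <> rgt w by move=> e'; have := lft_lt_rgt w; rewrite e' ltxx.
  have [hx hy] : [set lft w; rgt w] x /\ [set lft w; rgt w] y.
    by rewrite -e; split; [left|right].
  have [hl hr] : [set x; y] (lft w) /\ [set x; y] (rgt w).
    by rewrite e; split; [left|right].
  case: hl hr => /= hl [] /= hr; subst.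
  - by case: hy => /= ->; [left|right].
  - by left.
  - by right.
  - by case: lr.
by case=> [[-> ->]|[-> ->]]; exists w; rewrite im // setUC.
Qed.

Lemma V_Fw w z : @V0 R z -> V s (size w) (Fw s w z).
Proof. by elim: w => //= j w IH Vz; exists j => //; exists (Fw s w z) => //; exact: IH. Qed.

Lemma V_finite n : finite_set (V s n).
Proof.
elim: n => [|n IH] /=; first by rewrite /V0 finite_setU; split; exact: finite_set1.
by apply: bigcup_finite => // j _; exact: finite_image.
Qed.

Context (s_gt0 : 0 < s) (s_le : s <= 8^-1) (X : set (R * R)).
Hypothesis latticeX : is_lattice s X.

Lemma lattice_lft w : X (lft w).
Proof. by apply: (lattice_Fw latticeX); exact: lattice_left latticeX. Qed.

Lemma lattice_rgt w : X (rgt w).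
Proof. by apply: (lattice_Fw latticeX); exact: lattice_right latticeX. Qed.

Lemma cell_lft w : cell s X w (lft w).
Proof. by exists (-1, 0) => //; exact: lattice_left latticeX. Qed.

Lemma cell_rgt w : cell s X w (rgt w).
Proof. by exists (1, 0) => //; exact: lattice_right latticeX. Qed.

Lemma cell_fst (w v : seq 'I_4) : size w = size v -> w != v ->
  exists t : R, cell s X w `&` cell s X v `<=` [set z | z.1 = t].
Proof.
move=> wv /(cell_overlap s_gt0 s_le latticeX wv) [t ht]; exists t.
by move=> z [[x Xx <-] [y Xy /esym e]]; exact: ht e.
Qed.

(* Distinct cells of a level meet in a vertical line, an edge is not vertical. *)
Lemma cell_edge_uniq n (w v : n.-tuple 'I_4) :
  cell s X v (lft w) -> cell s X v (rgt w) -> v = w.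
Proof.
move=> vl vr; apply/eqP/negPn/negP => vw.
have [t ht] : exists t : R, cell s X v `&` cell s X w `<=` [set z | z.1 = t].
  by apply: cell_fst; rewrite // !size_tuple.
have := ht _ (conj vl (cell_lft w)); have := ht _ (conj vr (cell_rgt w)) => /= e1 e2.
by have := lft_lt_rgt w; rewrite e1 e2 ltxx.
Qed.

(** A word and a boolean parametrize the oriented edges. The parametrization is injective because an
    edge lies in a single cell of its level and its left end is strictly to the left of its right
    end. *)
Lemma edge_sum n (phi : R * R -> R * R -> R) :
  2^-1 * \sum_(x \in V s n) \sum_(y \in [set y | adj s n x y]) phi x y =
  \sum_(w : n.-tuple 'I_4) 2^-1 * (phi (lft w) (rgt w) + phi (rgt w) (lft w)).
Proof.
pose e0 (p : n.-tuple 'I_4 * bool) := if p.2 then lft p.1 else rgt p.1.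
pose e1 (p : n.-tuple 'I_4 * bool) := if p.2 then rgt p.1 else lft p.1.
have inner x : \sum_(y \in [set y | adj s n x y]) phi x y =
    \sum_(p | e0 p == x) phi x (e1 p).
  have -> : [set y | adj s n x y] = e1 @` [set p | e0 p = x].
    apply/seteqP; split=> [y /= /adjE [w [[-> ->]|[-> ->]]]|y /= [[w b] /= <- <-]].
    - by exists (w, true).
    - by exists (w, false).
    - by apply/adjE; exists w; case: b; [left|right].
  rewrite fsbig_image; last first.
    move=> [w b] [w' b'] /[!inE] /= <- {x} ee ee'.
    have [h0 h1] : cell s X w (e0 (w', b')) /\ cell s X w (e1 (w', b')).
      by rewrite ee -ee'; case: (b); split; by [exact: cell_lft|exact: cell_rgt].
    have ww : w = w'.
      by apply: cell_edge_uniq; case: (b') h0 h1.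
    move: ee; rewrite ww /e0 /=; have := lft_lt_rgt w'.
    by case: b {h0 h1 ee'}; case: b' => // /[swap] ->; rewrite ltxx.
  rewrite (fsbigE [seq p <- index_enum _ | e0 p == x]) ?filter_uniq ?index_enum_uniq//.
  - by rewrite big_filter_cond; apply: eq_bigl => p; apply/andb_idr => /eqP <-; rewrite inE.
  - by move=> p /=; rewrite mem_filter => /andP[/eqP].
  - by move=> p /= <-; rewrite mem_filter eqxx mem_index_enum.
under eq_fsbigr do rewrite inner.
rewrite (fsbig_finite _ _ (V_finite n)) /=.
under eq_bigr do rewrite big_mkcond.
rewrite exchange_big /=.
transitivity (2^-1 * \sum_(p : n.-tuple 'I_4 * bool) phi (e0 p) (e1 p)).
  congr (_ * _); apply: eq_bigr => p _; rewrite -big_mkcond /=.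
  rewrite (eq_bigl (pred1 (e0 p))); last by move=> z; rewrite /= eq_sym.
  rewrite -big_filter filter_pred1_uniq ?big_seq1 ?finmap.fset_uniq//.
  rewrite in_fset_set; last exact: V_finite.
  rewrite inE; case: p => w b; rewrite /e0 /=.
  have := @V_Fw w; rewrite size_tuple => V_Fw'.
  by case: b; apply: V_Fw'; [left|right].
rewrite mulr_sumr -(pair_bigA _ (fun (w : n.-tuple 'I_4) b => 2^-1 * phi (e0 (w, b)) (e1 (w, b)))) /=.
by apply: eq_bigr => w _; rewrite big_bool /= mulrDr.
Qed.

Lemma energy_atE n (f : R * R -> R[i]) :
  energy_at s n f = \sum_(w : n.-tuple 'I_4) sqnorm (f (rgt w) - f (lft w)).
Proof.
rewrite /energy_at (edge_sum n (fun x y => sqnorm (f x - f y))).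
by apply: eq_bigr => w _; rewrite sqnormB_sym; lra.
Qed.

(** Between the ends of an edge there are two parallel paths of two subedges, through the images of
    (0, 1) and (0, -1). All four maps keep left and right, so no subedge is reversed. *)
Lemma sum_subedges w (V : nmodType) (phi : R * R -> R * R -> V) :
  \sum_(j < 4) phi (lft (rcons w j)) (rgt (rcons w j)) =
  phi (Fw s w (0, 1)) (rgt w) + phi (lft w) (Fw s w (0, 1))
  + phi (lft w) (Fw s w (0, -1)) + phi (Fw s w (0, -1)) (rgt w).
Proof.
rewrite !big_ord_recr big_ord0 /= add0r /lft /rgt !Fw_rcons !FE /=.
by do 4?[congr (_ + _)]; congr phi; congr (Fw s w _); congr (_, _); lra.
Qed.

(** Two parallel paths, each of two unit resistors in series, have unit resistance: along either
    path, half of the squared increment over the edge is at most the sum of the squared increments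
    over the subedges. *)
Lemma energy_at_le n f : energy_at s n f <= energy_at s n.+1 f.
Proof.
rewrite !energy_atE (sum_rcons n (fun w => sqnorm (f (rgt w) - f (lft w)))).
apply: ler_sum => w _.
rewrite (sum_subedges w (fun x y => sqnorm (f y - f x))).
set a := f (rgt w); set b := f (lft w); set c := f (Fw s w (0, 1)).
set d := f (Fw s w (0, -1)).
have := sqnormD_le (a - c) (c - b); have := sqnormD_le (a - d) (d - b).
rewrite !addrA !subrK; lra.
Qed.

Lemma energy_at_nd f : nondecreasing_seq (fun n => energy_at s n f).
Proof. by apply/nondecreasing_seqP => n; exact: energy_at_le. Qed.

Lemma energy_at_ge0 n f : 0 <= energy_at s n f.
Proof. by rewrite energy_atE; apply: sumr_ge0 => w _; exact: sqnorm_ge0. Qed.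

(* The first coordinate is harmonic: its pairing with any function over the
   subedges of an edge does not depend on the scale. *)
Lemma sum_harmonic (V : lmodType R) (f : R * R -> V) w k :
  \sum_(u : k.-tuple 'I_4) (2 * 2^-1 ^+ size (w ++ u)) *: (f (rgt (w ++ u)) - f (lft (w ++ u)))
  = (2 * 2^-1 ^+ size w) *: (f (rgt w) - f (lft w)).
Proof.
elim: k => [|k IH].
  rewrite (big_pred1 [tuple]) ?cats0// => u /=.
  by apply/esym/eqP; exact: tuple0.
rewrite (sum_rcons k (fun u => (2 * 2^-1 ^+ size (w ++ u)) *: (f (rgt (w ++ u)) - f (lft (w ++ u))))).
rewrite -IH; apply: eq_bigr => u _; under eq_bigr do rewrite -rcons_cat size_rcons.
rewrite -scaler_sumr (sum_subedges _ (fun x y => f y - f x)).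
set v := w ++ u; set c := f (Fw s v (0, 1)); set d := f (Fw s v (0, -1)).
rewrite (_ : _ + _ + _ + _ = (f (rgt v) - f (lft v)) *+ 2); last first.
  by rewrite mulr2n subrKA -addrA [d - _ + _]addrC subrKA.
by rewrite -[(_ - _) *+ 2]scaler_nat scalerA exprS; congr (_ *: _); lra.
Qed.

(** Increments dx, dy become dx/2 and at most dx/2 + |dy|/4; the slope 2 is the least bound that
    this recursion preserves. *)
Lemma edge_snd_le w : `|(rgt w).2 - (lft w).2| <= 2 * ((rgt w).1 - (lft w).1).
Proof.
elim: w => [|j w] /=; first by rewrite /rgt /lft /= subrr normr0; lra.
rewrite /rgt /lft /= !FE; set x := Fw s w _; set y := Fw s w _.
move=> /ler_normlP [h1 h2]; have /ler_normlP [h3 h4] := twos_norm s_gt0 s_le (x.2 - y.2).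
have [e1 e2] : `|x.2 - y.2| <= 2 * (x.1 - y.1) /\ 0 <= x.1 - y.1.
  by split; [apply/ler_normlP; split; lra | lra].
apply/ler_normlP; case: j => [[|[|[|[|//]]]] lj] /=; split; lra.
Qed.

End Edges.

(** * Complex numbers and polarization *)

Section ComplexAux.
Context {R : realType}.

Lemma sqr_normCE (c : R[i]) : `|c| ^+ 2 = (sqnorm c)%:C%C.
Proof.
rewrite sqnormE; case: c => a b /=.
by rewrite normc_def /= -rmorphXn /= sqr_sqrtr// addr_ge0 ?sqr_ge0.
Qed.

Lemma conjCE (c : R[i]) : Num.conj c = (complex.Re c -i* complex.Im c)%C.
Proof. by case: c. Qed.

Lemma polar_real (T : Type) (q : (T -> R[i]) -> R) (f g : T -> R[i]) :
  polar (fun h => (q h)%:C%C) f g =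
  (4^-1 * (q (fun z => f z + g z) - q (fun z => f z - g z)) +i*
   (4^-1 * (q (fun z => f z + 'i * g z) - q (fun z => f z - 'i * g z))))%C.
Proof.
rewrite /polar !big_ord_recr big_ord0 /= add0r !exprS expr0 mulr1 mul1r.
rewrite (_ : 'i * 'i = -1 :> R[i]); last by rewrite -expr2 sqrCi.
rewrite mulrN1.
have e (h1 h2 : T -> R[i]) : h1 =1 h2 -> q h1 = q h2 by move=> /funext ->.
rewrite (e (fun z => f z + 1 * g z) (fun z => f z + g z)); last by move=> z; rewrite mul1r.
rewrite (e (fun z => f z + -1 * g z) (fun z => f z - g z)); last by move=> z; rewrite mulN1r.
rewrite (e (fun z => f z + - 'i * g z) (fun z => f z - 'i * g z)); last by move=> z; rewrite mulNr.
have -> : (4^-1 : R[i]) = (4^-1)%:C%C by rewrite fmorphV /= rmorph_nat.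
rewrite -complexiE; move: (q _) (q _) (q _) (q _) => a b c d.
by simpc; congr (_ +i* _)%C; lra.
Qed.

End ComplexAux.

Lemma edge_length_sqr (R : realType) n : (2 * 2^-1 ^+ n) ^+ 2 * (4 ^ n)%:R = 4 :> R.
Proof.
rewrite natrX exprMn -[2^-1 ^+ n ^+ 2]exprM mulnC exprM -mulrA -exprMn.
by rewrite (_ : 2^-1 ^+ 2 * 4 = 1 :> R) ?expr1n; lra.
Qed.

(** * Lipschitz test functions *)

Section Lipschitz.
Context {R : realType}.

(** The l1 distance of the plane is used, and the condition holds on the whole plane. These
    functions belong to the domain and are numerous enough to determine a finite measure. *)
Definition lip (L : R) (g : R * R -> R) : Prop :=
  forall z z', `|g z - g z'| <= L * (`|z.1 - z'.1| + `|z.2 - z'.2|).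

Lemma lip_continuous L g : lip L g -> continuous g.
Proof.
move=> gL z; apply/cvgrPdist_lt => e e0.
have L1 : 0 < `|L| + 1 by have := normr_ge0 L; lra.
have d0 : 0 < e / 2 / (`|L| + 1) by rewrite !divr_gt0.
suff : nbhs_ball z [set t | `|g z - g t| < e] by move/nbhs_ballP.
exists (e / 2 / (`|L| + 1)) => //= z' [/= h1 h2].
rewrite /ball /= in h1 h2; apply: (le_lt_trans (gL z z')).
have [n1 n2] : 0 <= `|z.1 - z'.1| /\ 0 <= `|z.2 - z'.2| by [].
apply: (@le_lt_trans _ _ ((`|L| + 1) * (`|z.1 - z'.1| + `|z.2 - z'.2|))).
  by apply: ler_wpM2r; [rewrite addr_ge0|have := ler_norm L; lra].
have -> : e = (`|L| + 1) * (e / 2 / (`|L| + 1) + e / 2 / (`|L| + 1)).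
  by field; rewrite gt_eqF.
by rewrite ltr_pM2l// ltrD.
Qed.

Lemma lip_fst : lip 1 fst.
Proof. by move=> z z'; rewrite mul1r lerDl. Qed.

Lemma lip_cst (c : R) : lip 0 (fun=> c).
Proof. by move=> z z'; rewrite subrr normr0 mul0r. Qed.

End Lipschitz.

(** * The domain as an algebra, and discrete energy measures *)

Section Domain.
Context {R : realType} {s : R} (s_gt0 : 0 < s) (s_le : s <= 8^-1) (X : set (R * R)).
Hypothesis latticeX : is_lattice s X.
Implicit Types (f g : R * R -> R[i]).

Local Notation lft := (@lft R s).
Local Notation rgt := (@rgt R s).
Local Notation dom := (in_domain s X).
Local Notation Re := complex.Re.
Local Notation Im := complex.Im.
Let E_atE := energy_atE s_gt0 s_le latticeX.

Lemma domain_bound f C :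
  {within X, continuous (fun z => Re (f z))} ->
  {within X, continuous (fun z => Im (f z))} ->
  (forall n, energy_at s n f <= C) -> dom f.
Proof.
move=> cR cI fC; split => //; apply: nondecreasing_is_cvgn.
  exact: (@energy_at_nd _ _ s_gt0 s_le _ latticeX f).
by exists C => _ [n _ <-].
Qed.

Lemma domain_cvg f : dom f -> energy_at s n f @[n --> \oo] --> energy s f.
Proof. by case. Qed.

Lemma energy_at_le_energy n f : dom f -> energy_at s n f <= energy s f.
Proof.
by case=> _ _ cv; exact: (nondecreasing_cvgn_le (@energy_at_nd _ _ s_gt0 s_le _ latticeX f) cv n).
Qed.

Lemma energy_ge0 f : dom f -> 0 <= energy s f.
Proof.
by move=> df; exact: le_trans (energy_at_ge0 s_gt0 s_le latticeX 0 f) (energy_at_le_energy 0 df).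
Qed.

Lemma compact_bound (h : R * R -> R) : {within X, continuous h} ->
  exists2 M, 0 <= M & forall z, X z -> `|h z| <= M.
Proof.
move=> ch; have /compact_bounded [M [_ hM]] :=
  continuous_compact ch (lattice_compact latticeX).
exists (`|M| + 1) => [|z Xz]; first by rewrite addr_ge0.
by apply: hM; [rewrite ltr_pwDr// ler_norm|exists z].
Qed.

Lemma domain_sqnorm_bound f : dom f ->
  exists2 M, 0 <= M & forall z, X z -> sqnorm (f z) <= M.
Proof.
case=> /compact_bound [M M0 hM] /compact_bound [N N0 hN] _.
exists (M ^+ 2 + N ^+ 2) => [|z Xz]; first by rewrite addr_ge0 ?sqr_ge0.
rewrite sqnormE -(real_normK (num_real (Re _))) -(real_normK (num_real (Im _))).
by rewrite lerD// ler_sqr ?nnegrE// ?hM ?hN.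
Qed.

Lemma domainD f g : dom f -> dom g -> dom (fun z => f z + g z).
Proof.
move=> df dg; case: (df) (dg) => cR cI _ [cR' cI' _].
apply: (@domain_bound _ (2 * (energy s f + energy s g))).
- rewrite (_ : (fun z => _) = (fun z => Re (f z)) \+ (fun z => Re (g z))); last first.
    by apply/funext => z; rewrite /= raddfD.
  by move=> z; apply: cvgD; [exact: cR|exact: cR'].
- rewrite (_ : (fun z => _) = (fun z => Im (f z)) \+ (fun z => Im (g z))); last first.
    by apply/funext => z; rewrite /= raddfD.
  by move=> z; apply: cvgD; [exact: cI|exact: cI'].
move=> n; apply: (@le_trans _ _ (2 * (energy_at s n f + energy_at s n g))).
  rewrite !E_atE -big_split mulr_sumr; apply: ler_sum => w _ /=.
  by rewrite opprD addrACA; exact: sqnormD_le.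
by apply: ler_wpM2l => //; rewrite lerD// energy_at_le_energy.
Qed.

Lemma domainM f g : dom f -> dom g -> dom (fun z => f z * g z).
Proof.
move=> df dg; case: (df) (dg) => cR cI _ [cR' cI' _].
have [M M0 hM] := domain_sqnorm_bound df; have [N N0 hN] := domain_sqnorm_bound dg.
apply: (@domain_bound _ (2 * (N * energy s f + M * energy s g))).
- rewrite (_ : (fun z => _) = (fun z => Re (f z)) \* (fun z => Re (g z))
     \- (fun z => Im (f z)) \* (fun z => Im (g z))); last first.
    by apply/funext => z /=; case: (f z) (g z) => [? ?] [? ?].
  by move=> z; apply: cvgB; apply: cvgM; [exact: cR|exact: cR'|exact: cI|exact: cI'].
- rewrite (_ : (fun z => _) = (fun z => Re (f z)) \* (fun z => Im (g z))
     \+ (fun z => Im (f z)) \* (fun z => Re (g z))); last first.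
    by apply/funext => z /=; case: (f z) (g z) => [? ?] [? ?].
  by move=> z; apply: cvgD; apply: cvgM; [exact: cR|exact: cI'|exact: cI|exact: cR'].
move=> n; apply: (@le_trans _ _ (2 * (N * energy_at s n f + M * energy_at s n g))).
  rewrite !E_atE 2!mulr_sumr -big_split mulr_sumr; apply: ler_sum => w _ /=.
  set a := f _; set b := g _; set c := f _; set d := g _.
  rewrite (_ : a * b - c * d = (a - c) * b + c * (b - d)); last by ring.
  apply: (le_trans (sqnormD_le _ _)); rewrite !sqnormM.
  rewrite (mulrC (sqnorm (a - c))).
  apply: ler_wpM2l => //; apply: lerD; apply: ler_wpM2r; rewrite ?sqnorm_ge0//.
    by apply: hN; exact: lattice_rgt latticeX _.
  by apply: hM; exact: lattice_lft latticeX _.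
apply: ler_wpM2l => //; rewrite lerD// ler_wpM2l// energy_at_le_energy//.
Qed.

Lemma domain_conj f : dom f -> dom (fun z => Num.conj (f z)).
Proof.
move=> df; case: (df) => cR cI _.
apply: (@domain_bound _ (energy s f)).
- by rewrite (_ : (fun z => _) = (fun z => Re (f z))) //; apply/funext => z; rewrite conjCE.
- rewrite (_ : (fun z => _) = \- (fun z => Im (f z))); last first.
    by apply/funext => z; rewrite conjCE.
  by move=> z; apply: cvgN; exact: cI.
move=> n; apply: le_trans (energy_at_le_energy n df).
by rewrite !E_atE; apply: ler_sum => w _; rewrite -rmorphB sqnorm_conj.
Qed.

(** Along an edge of slope at most 2, g changes by at most 3L times the width of the edge, and the
    4^n squared widths of scale n add up to 4. *)
Lemma domain_lip L (g : R * R -> R) : lip L g -> dom (fun z => (g z)%:C%C).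
Proof.
move=> gL; apply: (@domain_bound _ ((3 * L) ^+ 2 * 4)).
- by apply: continuous_subspaceT; exact: lip_continuous gL.
- by apply: continuous_subspaceT => z; exact: cvg_cst.
move=> n; rewrite E_atE.
apply: (@le_trans _ _ (\sum_(w : n.-tuple 'I_4) (3 * L) ^+ 2 * (2 * 2^-1 ^+ n) ^+ 2)).
  apply: ler_sum => w _; rewrite -rmorphB sqnorm_real -exprMn.
  have := gL (rgt w) (lft w); have := edge_snd_le s_gt0 s_le w.
  have := @rgtB_lft R s w; rewrite size_tuple => <-.
  rewrite (gtr0_norm (x := (rgt w).1 - _)) ?subr_gt0 ?lft_lt_rgt//.
  set d := (rgt w).1 - _; set e := `|_ - _| => ed h.
  have L0 : 0 <= L.
    have : 0 <= L * (d + e) by apply: le_trans h.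
    have d0 : 0 < d by rewrite subr_gt0 lft_lt_rgt.
    by rewrite pmulr_lge0// ltr_wpDr// normr_ge0.
  rewrite -real_normK ?num_real// ler_sqr ?nnegrE//.
    apply: (le_trans h); rewrite -mulrA mulrCA; apply: ler_wpM2l => //; lra.
  by rewrite !mulr_ge0// ltW// subr_gt0 lft_lt_rgt.
rewrite sumr_const card_tuple card_ord -[_ *+ _]mulr_natr -(mulrA ((3 * L) ^+ 2)) ler_wpM2l ?sqr_ge0//.
by rewrite edge_length_sqr.
Qed.

Lemma domain_cst (c : R[i]) : dom (fun=> c).
Proof.
apply: (@domain_bound _ 0); try by apply: continuous_subspaceT => z; exact: cvg_cst.
move=> n; rewrite E_atE big1// => w _.
by rewrite subrr sqnormE /= expr0n addr0.
Qed.

Lemma domainZ c f : dom f -> dom (fun z => c * f z).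
Proof. by apply: domainM; exact: domain_cst. Qed.

Lemma domainB f g : dom f -> dom g -> dom (fun z => f z - g z).
Proof.
move=> df dg; rewrite (_ : (fun z => _) = (fun z => f z + (-1) * g z)).
  by apply: domainD => //; exact: domainZ.
by apply/funext => z; rewrite mulN1r.
Qed.

Lemma domain_sqr f : dom f -> dom (fun z => `|f z| ^+ 2).
Proof.
move=> df; rewrite (_ : (fun z => _) = (fun z => f z * Num.conj (f z))).
  by apply: domainM => //; exact: domain_conj.
by apply/funext => z; rewrite normCK.
Qed.

Lemma re_energy_form_cvg f g : dom f -> dom g ->
  4^-1 * (energy_at s n (fun z => f z + g z) - energy_at s n (fun z => f z - g z))
    @[n --> \oo] --> Re (energy_form s f g).
Proof.
move=> df dg; rewrite /energy_form polar_real /=.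
apply: cvgM; first exact: cvg_cst.
by apply: cvgB; apply: domain_cvg; [exact: domainD|exact: domainB].
Qed.

(** The discrete integral of g against the energy measure of f. The mean of g over both ends is what
    the product rule yields: for real f, on one edge, the increments of gf and f multiplied, minus
    half the product of those of g and f^2, equal this term. *)
Definition weighted_energy n (g : R * R -> R) f : R :=
  \sum_(w : n.-tuple 'I_4) (g (lft w) + g (rgt w)) / 2 * sqnorm (f (rgt w) - f (lft w)).

Context (G : (R * R -> R[i]) -> {finite_measure set (R * R)%type -> \bar R}).
Hypothesis energyG : is_energy_measure s X G.

(** The formula that defines [G f] combines three polarized energies. Replacing each by its discrete
    version gives [weighted_energy] exactly at every scale, so only the limits remain. *)
Lemma weighted_energy_cvg f (g : R * R -> R) : dom f -> dom (fun z => (g z)%:C%C) ->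
  weighted_energy n g f @[n --> \oo] --> \int[G f]_(z in X) g z.
Proof.
move=> df dg; have := energyG df dg.
set g' := fun z => (g z)%:C%C.
have dgf : dom (fun z => g' z * f z) by apply: domainM.
have dgf' : dom (fun z => Num.conj (g' z) * f z).
  by apply: domainM => //; exact: domain_conj.
move=> /(congr1 (@complex.Re R)).
have half (c : R[i]) : Re (2^-1 * c) = 2^-1 * Re c.
  have -> : (2^-1 : R[i]) = (2^-1)%:C%C by rewrite fmorphV /= rmorph_nat.
  by case: c => a b; simpc.
rewrite half raddfB raddfD /= => ->.
have c1 := re_energy_form_cvg dgf df; have c2 := re_energy_form_cvg df dgf'.
have c3 := re_energy_form_cvg dg (domain_sqr df).
suff -> : (fun n => weighted_energy n g f) = (fun n => 2^-1 *
    (4^-1 * (energy_at s n (fun z => g' z * f z + f z)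
             - energy_at s n (fun z => g' z * f z - f z))
     + 4^-1 * (energy_at s n (fun z => f z + Num.conj (g' z) * f z)
               - energy_at s n (fun z => f z - Num.conj (g' z) * f z))
     - 4^-1 * (energy_at s n (fun z => g' z + `|f z| ^+ 2)
               - energy_at s n (fun z => g' z - `|f z| ^+ 2)))).
  apply: cvgM; first exact: cvg_cst.
  by apply: cvgB; [apply: cvgD|].
apply/funext => n.
rewrite /weighted_energy !E_atE -!sumrB !mulr_sumr -big_split -sumrB mulr_sumr /=.
apply: eq_bigr => w _.
rewrite !sqr_normCE /g' !conjCE.
case: (f (rgt w)) (f (lft w)) => [a b] [c d].
rewrite !sqnormE; simpc; rewrite /=.
by field.
Qed.

End Domain.

(** * Finite measures on the plane *)

Section PlaneMeasure.
Context {R : realType}.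
Implicit Types (U B C : set (R * R)).

(** The plane carries the product sigma-algebra. Balls of its product metric are products of
    intervals, and countably many of them, with rational centres and radii 1/(n + 1), exhaust an
    open set. *)
Lemma plane_open_measurable U : open U -> measurable U.
Proof.
move=> oU.
pose ctr (p : rat * rat * nat) : R * R := (ratr p.1.1, ratr p.1.2).
pose box (p : rat * rat * nat) := [set z | ball (ctr p) (p.2.+1%:R^-1 : R) z /\
   ball (ctr p) (p.2.+1%:R^-1 : R) `<=` U].
have -> : U = \bigcup_p box p.
  apply/seteqP; split=> [z Uz|z [p _ [pz pU]]]; last exact: pU.
  have [e /= e0 eU] : nbhs_ball z U by apply/nbhs_ballP; exact: open_nbhs_nbhs.
  have [n hn] : exists n, n.+1%:R^-1 < e / 2.
    have /cvgrPdist_lt/(_ (e / 2)) := @cvg_harmonic R; rewrite divr_gt0// => /(_ isT).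
    by move=> [n _ /(_ n (leqnn _))] /=; rewrite sub0r normrN ger0_norm// => ?; exists n.
  have n0 : 0 < n.+1%:R^-1 :> R by rewrite invr_gt0.
  move En : (n.+1%:R^-1 : R) => r in hn n0.
  have rq (x : R) : exists q : rat, `|ratr q - x| < r.
    have [|q] := @rat_in_itvoo R (x - r) (x + r); first lra.
    by rewrite in_itv /= => h; exists q; rewrite ltr_distl.
  have [q1 h1] := rq z.1; have [q2 h2] := rq z.2.
  exists (q1, q2, n) => //; rewrite /box /= En; split; first by split.
  move=> y [/= y1 y2]; apply: eU; rewrite /ball /= in y1 y2.
  rewrite distrC in h1; rewrite distrC in h2.
  split; rewrite /ball /=.
    by have := ler_distD (ratr q1) z.1 y.1; lra.
  by have := ler_distD (ratr q2) z.2 y.2; lra.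
apply: countable_bigcupT_measurable => // p.
have [pU|pU] := pselect (ball (ctr p) (p.2.+1%:R^-1 : R) `<=` U); last first.
  by rewrite (_ : box p = set0)//; apply/seteqP; split=> // z [].
rewrite (_ : box p = ball (ctr p).1 (p.2.+1%:R^-1 : R) `*` ball (ctr p).2 (p.2.+1%:R^-1 : R)).
  by apply: measurableX; apply: open_measurable; exact: ball_open.
by apply/seteqP; split=> // z [].
Qed.

Lemma plane_closed_measurable C : closed C -> measurable C.
Proof. by move=> cC; rewrite -[C]setCK; apply: measurableC; apply: plane_open_measurable; exact: closed_openC. Qed.

(** For the converse inclusion, both coordinates are continuous, hence measurable for the
    sigma-algebra generated by the closed sets, which therefore contains the measurable
    rectangles. *)
Lemma plane_measurableE : (@measurable _ (R * R)%type) = <<s [set C : set (R * R) | closed C] >>.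
Proof.
apply/seteqP; split; last first.
  apply: smallest_sub; first exact: sigma_algebra_measurable.
  by move=> C; exact: plane_closed_measurable.
pose T := g_sigma_algebraType [set C : set (R * R) | closed C].
have cont (p : T -> R) : (continuous (p : R * R -> R)) -> measurable_fun setT p.
  move=> cp; apply: (@measurability _ _ _ R _ _ (@RGenOpens.G R)); first exact: RGenOpens.measurableE.
  move=> _ [_ [a [b ->] <-]].
  rewrite setTI -[X in measurable X]setCK; apply: measurableC.
  apply: sub_sigma_algebra => /=.
  by apply: open_closedC; move/continuousP: cp; apply; exact: interval_open.
rewrite measurable_prod_measurableType; apply: smallest_sub; first exact: smallest_sigma_algebra.
move=> _ [A mA [B mB <-]].
have -> : A `*` B = (fst @^-1` A) `&` (snd @^-1` B) by [].
have m1 : measurable_fun setT (fst : T -> R) by apply: cont => z; exact: cvg_fst.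
have m2 : measurable_fun setT (snd : T -> R) by apply: cont => z; exact: cvg_snd.
have := m1 measurableT _ mA; have := m2 measurableT _ mB.
rewrite !setTI => h2 h1.
exact: (@measurableI _ T _ _ h1 h2).
Qed.

Lemma within_continuous_measurable (X : set (R * R)) (g : R * R -> R) :
  measurable X -> {within X, continuous g} -> measurable_fun X g.
Proof.
move=> mX cg; apply: (@measurability _ _ _ R _ _ (@RGenOpens.G R)); first exact: RGenOpens.measurableE.
move=> _ [_ [a [b ->] <-]].
have oab : open (`]a, b[%classic : set R) by exact: interval_open.
move/continuousP: cg => /(_ _ oab) /open_subspaceP [U oU UX].
by rewrite setIC -UX; apply: measurableI => //; exact: plane_open_measurable.
Qed.

(** The tents are 1 - k d(z, C) truncated at 0, with d the l1 distance. Off C the distance is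
    positive because C is closed, so they vanish there for large k. *)
Lemma closed_tents C : closed C -> exists g : nat -> R * R -> R,
  [/\ forall k, lip k%:R (g k),
      forall k z, 0 <= g k z <= 1,
      forall k z, C z -> g k z = 1 &
      forall z, ~ C z -> exists N, forall k, (N <= k)%N -> g k z = 0].
Proof.
(* The distance to an empty set would be the default value of an infimum; the zero functions serve
   instead. *)
move=> cC; have [->|/set0P C0] := eqVneq C set0.
  exists (fun _ _ => 0); split => // [k z z'|k z|z _]; last by exists 0.
  - by rewrite subrr normr0 mulr_ge0// addr_ge0.
  - by rewrite lexx ler01.
pose D z := [set `|z.1 - c.1| + `|z.2 - c.2| | c in C].
have Dl z : has_lbound (D z) by exists 0 => _ [c _ <-]; rewrite addr_ge0.
have D0 z : D z !=set0 by have [c Cc] := C0; exists (`|z.1 - c.1| + `|z.2 - c.2|), c.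
pose d z := inf (D z).
have dlip z z' : d z <= d z' + (`|z.1 - z'.1| + `|z.2 - z'.2|).
  rewrite -lerBlDr; apply: lb_le_inf => // _ [c Cc <-].
  have : d z <= `|z.1 - c.1| + `|z.2 - c.2| by apply: ge_inf => //; exists c.
  by have := ler_distD z'.1 z.1 c.1; have := ler_distD z'.2 z.2 c.2; lra.
have d_ge0 z : 0 <= d z by apply: lb_le_inf => // _ [c _ <-]; rewrite addr_ge0.
have dC z : C z -> d z = 0.
  move=> Cz; apply/le_anti; rewrite d_ge0 andbT.
  by apply: ge_inf => //; exists z => //; rewrite !subrr normr0 addr0.
exists (fun k z => Num.max 0 (1 - k%:R * d z)); split.
- move=> k z z'.
  have h : `|k%:R * d z - k%:R * d z'| <= k%:R * (`|z.1 - z'.1| + `|z.2 - z'.2|).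
    rewrite -mulrBr normrM ger0_norm// ler_wpM2l//.
    have := dlip z z'; have := dlip z' z; rewrite (distrC z'.1) (distrC z'.2) => h1 h2.
    by apply/ler_normlP; split; lra.
  apply: le_trans h; move: (k%:R * _) (k%:R * _) => a b.
  case/ler_normlP: (lexx `|b - a|) => h1 h2.
  by apply/ler_normlP; case: (leP 0 (1 - a)) => ?; case: (leP 0 (1 - b)) => ?; split; lra.
- move=> k z; rewrite le_max lexx /= ge_max ler01 /= gerBl mulr_ge0//.
- by move=> k z Cz; rewrite dC// mulr0 subr0; apply/max_idPr.
move=> z nCz.
have dz0 : 0 < d z.
  rewrite lt_neqAle d_ge0 andbT; apply/eqP => dz; apply: nCz.
  apply: (wdist_closed cC) => e e0.
  (* The 4 is there because [wdist] is at most 4 times the l1 distance. *)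
  have [//|_ [c Cc <-]] := @inf_adherent _ (D z) (e / 4) (divr_gt0 e0 _) (conj (D0 z) (Dl z)).
  rewrite -/(d z) -dz add0r => h; exists c => //.
  by rewrite /wdist; have := normr_ge0 (z.2 - c.2); lra.
exists (Num.truncn (d z)^-1).+1 => k hk; apply/max_idPl; rewrite subr_le0.
rewrite -ler_pdivrMr// div1r; apply: ltW; apply: lt_le_trans (truncnS_gt _) _.
by rewrite ler_nat.
Qed.

Context (X : set (R * R)) (mX : measurable X).
Local Notation fmeasure := {finite_measure set (R * R)%type -> \bar R}.

Lemma bounded_integrable (m : fmeasure) (g : R * R -> R) M : measurable_fun X g ->
  (forall z, X z -> `|g z| <= M) -> m.-integrable X (EFin \o g).
Proof.
move=> mg gM; apply: measurable_bounded_integrable => //.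
  by have := @fin_num_measure _ _ _ m X mX; rewrite ltey_eq => ->.
by exists M; split; [exact: num_real|move=> N MN z Xz; apply: le_trans (gM z Xz) (ltW MN)].
Qed.

Lemma bounded_Rintegral_le (m : fmeasure) (g : R * R -> R) M : measurable_fun X g ->
  (forall z, X z -> `|g z| <= M) -> \int[m]_(z in X) g z <= M * fine (m X).
Proof.
move=> mg gM; rewrite -Rintegral_cst//; apply: le_Rintegral => //.
- exact: bounded_integrable mg gM.
- by apply: (@bounded_integrable _ _ `|M|) => //; exact: measurable_cst.
- by move=> z Xz; apply: le_trans (ler_norm _) (gM z Xz).
Qed.

Lemma lip_measurable L g : lip L g -> measurable_fun X g.
Proof.
move=> gL; apply: within_continuous_measurable => //.
by apply: continuous_subspaceT; exact: lip_continuous gL.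
Qed.

Lemma tents_cvg (m : fmeasure) C (g : nat -> R * R -> R) : closed C ->
  (forall k, lip k%:R (g k)) -> (forall k z, 0 <= g k z <= 1) ->
  (forall k z, C z -> g k z = 1) ->
  (forall z, ~ C z -> exists N, forall k, (N <= k)%N -> g k z = 0) ->
  \int[m]_(z in X) g k z @[k --> \oo] --> fine (m (C `&` X)).
Proof.
move=> cC gl g01 g1 g0; have mC := plane_closed_measurable cC.
rewrite -(integral_indic m mX mC).
have [|||||_ _] := @dominated_convergence _ _ _ m X mX (fun k z => (g k z)%:E)
   (fun z => (\1_C z)%:E) (cst 1%:E).
- by move=> k; apply/measurable_EFinP; exact: lip_measurable (gl k).
- by apply/measurable_EFinP; exact: measurable_indic.
- apply: aeW => z Xz; have [Cz|nCz] := pselect (C z).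
    rewrite indicE mem_set//; under eq_fun do rewrite g1//; exact: cvg_cst.
  have [N hN] := g0 z nCz; rewrite indicE memNset//; apply: cvg_near_cst.
  by exists N => // k /= /hN ->.
- by apply: (@bounded_integrable _ (cst 1) 1) => [|z _]; rewrite /= ?normr1.
- by apply: aeW => z k Xz; have /andP[h1 h2] := g01 k z; rewrite lee_fin ger0_norm.
move=> cv; apply: fine_cvg; rewrite fineK//.
rewrite integral_indic//; apply: fin_num_measure; exact: measurableI.
Qed.

(* Closed sets form a generating pi-system, and their indicator functions are
   limits of Lipschitz functions. *)
Lemma eq_measure_lip (m1 m2 : fmeasure) (c : {nonneg R}) :
  (forall L g, lip L g -> \int[m1]_(z in X) g z = c%:num * \int[m2]_(z in X) g z) ->
  forall B, measurable B -> m1 (B `&` X) = mscale c m2 (B `&` X).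
Proof.
move=> h B mB.
pose m1' : measure _ R := mrestr m1 mX.
pose m2' : measure _ R := mrestr (mscale c m2) mX.
suff : m1' B = m2' B by [].
apply: (@measure_unique _ _ _ [set C : set (R * R) | closed C] (fun=> setT)) => //.
- exact: plane_measurableE.
- by move=> C D cC cD; exact: closedI.
- by apply/seteqP; split => // z _; exists 0.
- move=> C /= cC; have mC := plane_closed_measurable cC.
  have [g [gl g01 g1 g0]] := closed_tents cC.
  have := tents_cvg (m := m1) cC gl g01 g1 g0; have := tents_cvg (m := m2) cC gl g01 g1 g0.
  move=> /(cvgM (cvg_cst (c%:num : R))) c2 c1.
  have e : fine (m1 (C `&` X)) = c%:num * fine (m2 (C `&` X)).
    rewrite -(cvg_lim _ c1)//; apply: cvg_lim => //.
    by under eq_fun do rewrite (h _ _ (gl _)); exact: c2.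
  rewrite /m1' /m2' /mrestr /mscale -[LHS]fineK; last by apply: fin_num_measure; exact: measurableI.
  rewrite e EFinM fineK//; by apply: fin_num_measure; exact: measurableI.
- by move=> _; rewrite -ge0_fin_numE//; apply: (@fin_num_measure _ _ _ m1); exact: measurableI.
Qed.

Lemma eq_Rintegral_lip (m1 m2 : fmeasure) (c : R) : 0 <= c ->
  (forall L g, lip L g -> \int[m1]_(z in X) g z = c * \int[m2]_(z in X) g z) ->
  forall (g : R * R -> R) M, measurable_fun X g -> (forall z, X z -> `|g z| <= M) ->
  \int[m1]_(z in X) g z = c * \int[m2]_(z in X) g z.
Proof.
move=> c0 h g M mg gM; pose k := NngNum c0.
(* Scaling of a measure is applied to nonnegative integrands. Adding the bound M makes g
   nonnegative, and the constant M is itself such an integrand. *)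
have ge0 (g' : R * R -> R) : measurable_fun X g' -> (forall z, X z -> 0 <= g' z) ->
    (forall z, X z -> `|g' z| <= M + M) -> \int[m1]_(z in X) g' z = c * \int[m2]_(z in X) g' z.
  move=> mg' g0 g'M; rewrite /Rintegral (@eq_measure_integral _ _ _ _ (mscale k m2)).
    rewrite ge0_integral_mscale//; last exact/measurable_EFinP.
    rewrite fineM//; apply: integrable_fin_num => //.
    exact: bounded_integrable mg' g'M.
  move=> B mB BX; have := @eq_measure_lip m1 m2 k h B mB.
  by rewrite (setIidl BX).
have iM (m : fmeasure) : m.-integrable X (EFin \o (fun=> M)).
  by apply: (@bounded_integrable m _ `|M|) => //; exact: measurable_cst.
have ig (m : fmeasure) : m.-integrable X (EFin \o g) by exact: bounded_integrable mg gM.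
have D (m : fmeasure) : \int[m]_(z in X) (g z + M) = \int[m]_(z in X) g z + M * fine (m X).
  by rewrite (RintegralD mX (ig m) (iM m)) Rintegral_cst.
have := ge0 (fun z => g z + M); rewrite !D.
have := ge0 (fun=> M); rewrite !Rintegral_cst//.
move=> h1 h2.
have {}h1 : M * fine (m1 X) = c * (M * fine (m2 X)).
  have [->|/set0P [z Xz]] := eqVneq X set0; first by rewrite !measure0 mulr0 mulr0.
  have M0 : 0 <= M by apply: le_trans (gM z Xz).
  by apply: h1 => [|//|? _]; [exact: measurable_cst|rewrite ger0_norm// lerDl].
suff : \int[m1]_(z in X) g z + M * fine (m1 X) =
  c * (\int[m2]_(z in X) g z + M * fine (m2 X)) by rewrite mulrDr h1 => /addIr.
apply: h2 => [|z Xz|z Xz].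
- by apply: measurable_funD => //; exact: measurable_cst.
- by case/ler_normlP: (gM z Xz); lra.
- by case/ler_normlP: (gM z Xz) => ? ?; apply/ler_normlP; split; lra.
Qed.

Lemma ae_eq_Rintegral (m : fmeasure) (h1 h2 : R * R -> R) :
  measurable_fun X h1 -> measurable_fun X h2 ->
  (\forall z \ae m, X z -> h1 z = h2 z) ->
  \int[m]_(z in X) h1 z = \int[m]_(z in X) h2 z.
Proof.
move=> m1 m2 h12; congr fine; apply: ae_eq_integral => //; try exact/measurable_EFinP.
by apply: filterS h12 => z h Xz; rewrite /= h.
Qed.

Lemma indic_integrable (m : fmeasure) B :
  measurable B -> m.-integrable X (EFin \o \1_B).
Proof.
move=> mB; apply: (@bounded_integrable _ _ 1) => [|z _]; first exact: measurable_indic.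
by rewrite indicE; case: (_ \in _); rewrite ?normr0 ?normr1.
Qed.

Lemma Rintegral_indic (m : fmeasure) B : measurable B ->
  \int[m]_(z in X) \1_B z = fine (m (B `&` X)).
Proof. by move=> mB; rewrite /Rintegral integral_indic. Qed.

Lemma Rintegral_sum (I : Type) (r : seq I) (m : fmeasure)
    (h : I -> R * R -> R) : (forall i, m.-integrable X (EFin \o h i)) ->
  m.-integrable X (EFin \o (fun z => \sum_(i <- r) h i z)) /\
  \int[m]_(z in X) (\sum_(i <- r) h i z) = \sum_(i <- r) \int[m]_(z in X) h i z.
Proof.
move=> ih; elim: r => [|i r [IH1 IH2]].
  under eq_fun do rewrite big_nil; split.
    by apply: (@bounded_integrable _ _ 0) => [|z _]; [exact: measurable_cst|rewrite normr0].
  by rewrite big_nil Rintegral_cst// mul0r.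
under eq_fun do rewrite big_cons.
have e : (EFin \o (fun z => h i z + \sum_(j <- r) h j z)) =
   (EFin \o h i) \+ (EFin \o (fun z => \sum_(j <- r) h j z)) by apply/funext.
split; first by rewrite e; exact: integrableD.
by rewrite big_cons -IH2 -RintegralD.
Qed.

End PlaneMeasure.

Lemma sum_cat (V : nmodType) (T : finType) m k (g : seq T -> V) :
  \sum_(v : (m + k).-tuple T) g v =
  \sum_(w : m.-tuple T) \sum_(u : k.-tuple T) g (w ++ u).
Proof.
elim: k g => [|k IH] g.
  rewrite addn0; apply: eq_bigr => w _.
  rewrite (big_pred1 [tuple]) ?cats0// => u /=.
  by apply/esym/eqP; exact: tuple0.
rewrite addnS sum_rcons (IH (fun v => \sum_j g (rcons v j))).
apply: eq_bigr => w _; rewrite (sum_rcons k (fun u => g (w ++ u))).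
by apply: eq_bigr => u _; apply: eq_bigr => j _; rewrite rcons_cat.
Qed.

(** * The energy measure of the first coordinate *)

Section ReferenceMeasure.
Context {R : realType} {s : R} (s_gt0 : 0 < s) (s_le : s <= 8^-1) {X : set (R * R)}.
Hypothesis latticeX : is_lattice s X.
Context {G : (R * R -> R[i]) -> {finite_measure set (R * R)%type -> \bar R}}.
Hypothesis energyG : is_energy_measure s X G.
Implicit Types (f : R * R -> R[i]) (w : seq 'I_4).

Local Notation lft := (@lft R s).
Local Notation rgt := (@rgt R s).
Local Notation dom := (in_domain s X).
Local Notation cell := (cell s X).
Let WE_cvg := weighted_energy_cvg s_gt0 s_le latticeX energyG.

Variant clamp_spec (lo hi x : R) : R -> Prop :=
  | ClampLo of x <= lo : clamp_spec lo hi x lo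
  | ClampIn of lo <= x & x <= hi : clamp_spec lo hi x x
  | ClampHi of hi <= x : clamp_spec lo hi x hi.

Lemma clampP (lo hi x : R) : lo <= hi -> clamp_spec lo hi x (Num.max lo (Num.min x hi)).
Proof.
move=> lh; have [xh|hx] := leP x hi.
  by have [lx|xl] := leP lo x; [exact: ClampIn|apply: ClampLo; exact: ltW].
by rewrite (max_idPr lh); apply: ClampHi; exact: ltW.
Qed.

Definition edge_length n : R := 2 * 2^-1 ^+ n.
Local Notation len := edge_length.

Lemma edge_length_gt0 n : 0 < len n.
Proof. by rewrite mulr_gt0// exprn_gt0. Qed.

Lemma edge_length_small e : 0 < e -> \forall n \near \oo, len n < e.
Proof.
move=> e0; have : len n @[n --> \oo] --> (2 * 0 : R).
  by apply: cvgM; [exact: cvg_cst|apply: cvg_expr; rewrite ger0_norm; lra].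
rewrite mulr0 => /cvgrPdist_lt/(_ e e0); apply: filterS => n.
by rewrite sub0r normrN gtr0_norm// edge_length_gt0.
Qed.

Definition fstC (z : R * R) : R[i] := z.1%:C%C.
Local Notation nu := (G fstC).

Lemma domain_fst : dom fstC.
Proof. exact: (domain_lip s_gt0 s_le latticeX lip_fst). Qed.

Lemma fst_edge w : fstC (rgt w) - fstC (lft w) = (len (size w))%:C%C.
Proof. by rewrite /fstC -rmorphB rgtB_lft. Qed.

Lemma lattice_measurable : measurable X.
Proof. by apply: plane_closed_measurable; exact: lattice_closed latticeX. Qed.
Let mX := lattice_measurable.

Lemma cell_closed w : closed (cell w).
Proof.
apply: compact_closed; first exact: norm_hausdorff.
apply: continuous_compact; last exact: lattice_compact latticeX.
apply: continuous_subspaceT => z.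
have h z1 z2 : wdist (Fw s w z1) (Fw s w z2) <= 4 * (`|z1.1 - z2.1| + `|z1.2 - z2.2|).
  apply: (le_trans (wdist_Fw s_gt0 s_le w z1 z2)).
  apply: (@le_trans _ _ (1 * wdist z1 z2)).
    by apply: ler_wpM2r; [exact: wdist_ge0|apply: exprn_ile1; lra].
  by rewrite /wdist; have := normr_ge0 (z1.2 - z2.2); lra.
have c1 : continuous (fun z => (Fw s w z).1).
  apply: (@lip_continuous _ 4) => z1 z2; apply: le_trans (h z1 z2); rewrite /wdist.
  have := normr_ge0 ((Fw s w z1).1 - (Fw s w z2).1).
  by have := normr_ge0 ((Fw s w z1).2 - (Fw s w z2).2); lra.
have c2 : continuous (fun z => (Fw s w z).2).
  apply: (@lip_continuous _ 4) => z1 z2; apply: le_trans (h z1 z2); rewrite /wdist.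
  have := normr_ge0 ((Fw s w z1).1 - (Fw s w z2).1).
  by have := normr_ge0 ((Fw s w z1).2 - (Fw s w z2).2); lra.
rewrite (_ : Fw s w = (fun z => ((Fw s w z).1, (Fw s w z).2))).
  exact: (cvg_pair (c1 z) (c2 z)).
by apply/funext => z'; case: (Fw s w z').
Qed.

Lemma cell_measurable w : measurable (cell w).
Proof. by apply: plane_closed_measurable; exact: cell_closed. Qed.

Lemma cell_lattice w z : cell w z -> X z.
Proof. by move=> [x Xx <-]; exact: (lattice_Fw latticeX). Qed.

Lemma cell_cat w v z : cell (w ++ v) z -> cell w z.
Proof. by move=> [x Xx <-]; rewrite Fw_cat; exists (Fw s v x) => //; exact: (lattice_Fw latticeX). Qed.

Lemma cell_cover n z : X z -> exists w : n.-tuple 'I_4, cell w z.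
Proof.
elim: n z => [|n IH] z Xz; first by exists [tuple]; exists z.
have [j [z' [Xz' ->]]] := lattice_inv latticeX Xz.
by have [w [x Xx <-]] := IH z' Xz'; exists [tuple of j :: w]; exists x.
Qed.

Lemma weighted_fst n g : weighted_energy (s := s) n g fstC =
  \sum_(w : n.-tuple 'I_4) (g (lft w) + g (rgt w)) / 2 * len n ^+ 2.
Proof. by apply: eq_bigr => w _; rewrite fst_edge sqnorm_real size_tuple. Qed.

Lemma nu_cvg L g : lip L g ->
  (\sum_(w : n.-tuple 'I_4) (g (lft w) + g (rgt w)) / 2 * len n ^+ 2) @[n --> \oo]
  --> \int[nu]_(z in X) g z.
Proof.
move=> gL; under eq_fun do rewrite -weighted_fst.
by apply: WE_cvg; [exact: domain_fst|exact: (domain_lip s_gt0 s_le latticeX gL)].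
Qed.

Lemma sum_len n : \sum_(w : n.-tuple 'I_4) len n ^+ 2 = 4.
Proof. by rewrite sumr_const card_tuple card_ord -[_ *+ _]mulr_natr edge_length_sqr. Qed.

Lemma nu_lattice : fine (nu X) = 4.
Proof.
have := nu_cvg (lip_cst 1); rewrite Rintegral_cst// mul1r => /cvg_lim <-//.
under eq_fun => n do under eq_bigr do rewrite (_ : (1 + 1) / 2 = 1 :> R) ?mul1r ?divff//.
by under eq_fun do rewrite sum_len; exact: lim_cst.
Qed.

Lemma fin_measureE (m : {finite_measure set (R * R)%type -> \bar R}) B : measurable B -> m B = (fine (m B))%:E.
Proof. by move=> mB; rewrite fineK// fin_num_measure. Qed.

(* The test function is dominated by the increments of a clamped first
   coordinate, whose sum telescopes since the first coordinate is harmonic. *)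
Lemma nu_strip_le t r (g : R * R -> R) L : 0 < r -> lip L g ->
  (forall z, 0 <= g z <= 1) -> (forall z, r <= `|z.1 - t| -> g z = 0) ->
  \int[nu]_(z in X) g z <= 8 * r.
Proof.
move=> r0 gL g01 g0; apply: (cvgr_to_le (nu_cvg gL)).
have := edge_length_small r0; apply: filterS => n nr.
have t2 : t - 2 * r <= t + 2 * r by lra.
(* With the margin 2r, an edge of width below r that has an end within r of the line stays in the
   unclamped range, so [phi] grows by its full width. The total growth is at most 4r, and
   [sum_harmonic] multiplies it by the width 2 of the lattice, hence 8r. *)
pose phi (z : R * R) : R := Num.max (t - 2 * r) (Num.min z.1 (t + 2 * r)).
have phiB a b : a.1 <= b.1 -> 0 <= phi b - phi a.
  by move=> ab; rewrite /phi; case: (clampP a.1 t2) => *; case: (clampP b.1 t2) => *; lra.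
apply: (@le_trans _ _ (\sum_(w : n.-tuple 'I_4) len n * (phi (rgt w) - phi (lft w)))).
  apply: ler_sum => w _.
  have /andP[l0 l1] := g01 (lft w); have /andP[r0' r1] := g01 (rgt w).
  have ab := @rgtB_lft R s w; rewrite size_tuple -/(len n) in ab.
  have d0 := edge_length_gt0 n.
  have phir := phiB (lft w) (rgt w) (ltW (lft_lt_rgt w)).
  have dphi : `|(lft w).1 - t| < r \/ `|(rgt w).1 - t| < r -> phi (rgt w) - phi (lft w) = len n.
    rewrite -ab /phi; case=> /ltr_normlP [? ?];
    by case: (clampP (lft w).1 t2) => *; case: (clampP (rgt w).1 t2) => *; lra.
  have le1 : (g (lft w) + g (rgt w)) / 2 * len n ^+ 2 <= len n * len n.
    by rewrite -expr2 ler_piMl ?sqr_ge0//; lra.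
  have [h1|h1] := leP r `|(lft w).1 - t|; last by rewrite dphi; [|left].
  have [h2|h2] := leP r `|(rgt w).1 - t|; last by rewrite dphi; [|right].
  by rewrite !g0// addr0 !mul0r mulr_ge0// ltW.
have h := @sum_harmonic R s R^o phi [::] n; rewrite /= expr0 mulr1 in h.
have -> : \sum_(w : n.-tuple 'I_4) len n * (phi (rgt w) - phi (lft w))
    = 2 * (phi (1, 0) - phi (-1, 0)).
  by apply: etrans h; apply: eq_bigr => w _; rewrite size_tuple.
suff : phi (1, 0) <= t + 2 * r /\ t - 2 * r <= phi (-1, 0) by rewrite /phi; lra.
rewrite /phi le_max lexx ge_max ge_min lexx orbT andbT; split => //; lra.
Qed.

Lemma slice_closed (t : R) : closed [set z : R * R | z.1 = t].
Proof.
move=> z hz; apply/eqP; rewrite -subr_eq0 -normr_le0; apply/ler_addgt0Pr => e e0.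
have [z' [/= <- zz']] := hz _ (nbhsx_ballx z e e0).
by case: zz' => /= + _; rewrite /ball /= add0r => /ltW.
Qed.

(** A tent of half-width e/8 around the line dominates its indicator and has integral at most 8
    (e/8) = e. *)
Lemma nu_slice t : fine (nu ([set z | z.1 = t] `&` X)) = 0.
Proof.
have mS := plane_closed_measurable (@slice_closed t).
apply/le_anti/andP; split; last by rewrite fine_ge0.
apply/ler_addgt0Pr => e e0; rewrite add0r.
have r0 : 0 < e / 8 by rewrite divr_gt0.
pose g (z : R * R) := Num.max 0 (1 - (e / 8)^-1 * `|z.1 - t|).
have gL : lip (e / 8)^-1 g.
  move=> z z'; apply: (@le_trans _ _ ((e / 8)^-1 * `|z.1 - z'.1|)); last first.
    by rewrite ler_wpM2l ?lerDl// invr_ge0 ltW.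
  have h : `|(e / 8)^-1 * `|z'.1 - t| - (e / 8)^-1 * `|z.1 - t| | <= (e / 8)^-1 * `|z.1 - z'.1|.
    rewrite -mulrBr normrM gtr0_norm ?invr_gt0//; apply: ler_wpM2l; first by rewrite invr_ge0 ltW.
    by apply: (le_trans (ler_dist_dist _ _)); rewrite opprB addrA subrK distrC.
  apply: le_trans h; rewrite /g; move: (_ * _) (_ * _) => a b.
  case/ler_normlP: (lexx `|a - b|) => h1 h2.
  by apply/ler_normlP; case: (leP 0 (1 - a)) => ?; case: (leP 0 (1 - b)) => ?; split; lra.
have g01 z : 0 <= g z <= 1.
  by rewrite le_max lexx /= ge_max ler01 gerBl mulr_ge0// invr_ge0 ltW.
have g0 z : e / 8 <= `|z.1 - t| -> g z = 0.
  by move=> h; apply/max_idPl; rewrite subr_le0 mulrC ler_pdivlMr ?mul1r.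
have := nu_strip_le r0 gL g01 g0; rewrite (_ : 8 * (e / 8) = e); last by field.
apply: le_trans.
have -> : fine (nu ([set z | z.1 = t] `&` X)) = \int[nu]_(z in X) \1_[set z : R * R | z.1 = t] z.
  by rewrite /Rintegral integral_indic.
apply: le_Rintegral => //.
- apply: (@bounded_integrable _ _ mX _ _ 1) => [|z _]; first exact: measurable_indic.
  by rewrite indicE; case: (_ \in _); rewrite ?normr0 ?normr1.
- apply: (@bounded_integrable _ _ mX _ _ 1) => [|z _]; first exact: (lip_measurable mX gL).
  by have /andP[h0 h1] := g01 z; rewrite ger0_norm.
move=> z _; rewrite indicE; have /andP[h0 h1] := g01 z.
case: (boolP (z \in _)) => //=; rewrite inE /= => zt.
by rewrite /g zt subrr normr0 mulr0 subr0 le_max lexx orbT.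
Qed.

(** Finitely many pairs of cells, each with overlap in a vertical line. From here on the cells of
    one level act as a partition of X. *)
Lemma nu_disjoint_cells n : \forall z \ae nu, X z ->
  forall w v : n.-tuple 'I_4, w != v -> ~ (cell w z /\ cell v z).
Proof.
suff h (p : n.-tuple 'I_4 * n.-tuple 'I_4) :
    \forall z \ae nu, X z -> p.1 != p.2 -> ~ (cell p.1 z /\ cell p.2 z).
  apply: (filterS _ (filter_forall _ h)) => z hz Xz w v wv.
  exact: (hz (w, v) Xz wv).
case: p => w v /=; have [_|wv] := eqVneq w v; first by apply: aeW => z _.
have [t ht] : exists t : R, cell w `&` cell v `<=` [set z | z.1 = t].
  by apply: (cell_fst s_gt0 s_le latticeX) => //; rewrite !size_tuple.
exists ([set z | z.1 = t] `&` X); split.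
- by apply: measurableI => //; apply: plane_closed_measurable; exact: slice_closed.
- have mS : measurable ([set z | z.1 = t] `&` X).
    by apply: measurableI => //; apply: plane_closed_measurable; exact: slice_closed.
  by rewrite fin_measureE// nu_slice.
move=> z /= /not_implyP[Xz /not_implyP[_ /contrapT wvz]].
by split => //; exact: ht.
Qed.

(** A tent of the cell equals 1 at both ends of its 4^(m - n) edges of scale m, which contribute
    [len m ^+ 2] each and [len n ^+ 2] together. The other edges are dropped, so only a lower bound
    results. *)
Lemma nu_cell_ge n (w : n.-tuple 'I_4) : len n ^+ 2 <= fine (nu (cell w)).
Proof.
have [g [gl g01 g1 g0]] := closed_tents (cell_closed (w := w)).
have := tents_cvg mX (m := nu) (cell_closed (w := w)) gl g01 g1 g0.
rewrite (setIidl (@cell_lattice w)) => /cvgr_to_ge; apply; apply: nearW => k.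
apply: (cvgr_to_ge (nu_cvg (gl k))); exists n => // m /= nm.
rewrite -(subnKC nm) (sum_cat n (m - n) (fun v => (g k (lft v) + g k (rgt v)) / 2 * len (n + (m - n)) ^+ 2)).
rewrite (bigD1 w)//=; apply: (@le_trans _ _ (\sum_(u : (m - n).-tuple 'I_4) len (n + (m - n)) ^+ 2)).
  rewrite sumr_const card_tuple card_ord -[leRHS]mulr_natr /len exprD mulrA [X in _ <= X * _]exprMn.
  have -> : (2^-1 ^+ (m - n)) ^+ 2 = ((4 ^ (m - n))%:R)^-1 :> R.
    by rewrite natrX -exprM mulnC exprM -exprVn; congr (_ ^+ _); lra.
  by rewrite mulfVK// pnatr_eq0 expn_eq0.
rewrite -[leLHS]addr0; apply: lerD.
  apply: ler_sum => u _; rewrite !g1; first by rewrite divff// mul1r.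
    by apply: (@cell_cat _ u); exact: cell_rgt latticeX _.
  by apply: (@cell_cat _ u); exact: cell_lft latticeX _.
apply: sumr_ge0 => v _; apply: sumr_ge0 => u _; rewrite mulr_ge0 ?sqr_ge0//.
have /andP[h1 _] := g01 k (lft (v ++ u)); have /andP[h2 _] := g01 k (rgt (v ++ u)).
by rewrite divr_ge0 ?addr_ge0.
Qed.

Lemma sum_indic_cells n : \forall z \ae nu, X z ->
  \sum_(w : n.-tuple 'I_4) \1_(cell w) z = 1 :> R.
Proof.
have := nu_disjoint_cells n; apply: filterS => z h Xz.
have [w wz] := cell_cover n Xz.
rewrite (bigD1 w)//= indicE mem_set// big1 ?addr0// => v vw.
rewrite indicE memNset// => vz.
by have := h Xz v w vw; apply.
Qed.

(** The lower bounds add up to the total mass 4, and the cells cover X with null overlaps, so none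
    of the bounds is strict. *)
Lemma nu_cell n (w : n.-tuple 'I_4) : fine (nu (cell w)) = len n ^+ 2.
Proof.
have [iS eS] := @Rintegral_sum _ _ mX _ (index_enum _) nu
  (fun w : n.-tuple 'I_4 => \1_(cell w)) (fun w : n.-tuple 'I_4 => indic_integrable mX nu (cell_measurable w)).
have : \sum_(w : n.-tuple 'I_4) (fine (nu (cell w)) - len n ^+ 2) = 0.
  rewrite sumrB sum_len -nu_lattice; apply/eqP; rewrite subr_eq0; apply/eqP.
  transitivity (\sum_(w : n.-tuple 'I_4) \int[nu]_(z in X) \1_(cell w) z).
    apply: eq_bigr => v _; rewrite (Rintegral_indic mX); last exact: cell_measurable.
    by rewrite (setIidl (@cell_lattice v)).
  rewrite -eS -[RHS]mul1r -Rintegral_cst//; apply: (ae_eq_Rintegral mX).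
  - by apply/measurable_EFinP; exact: measurable_int iS.
  - exact: measurable_cst.
  - exact: sum_indic_cells.
move/eqP; rewrite psumr_eq0; last by move=> v _; rewrite subr_ge0 nu_cell_ge.
by move=> /allP /(_ w (mem_index_enum _)) /=; rewrite subr_eq0 => /eqP.
Qed.

End ReferenceMeasure.

(** * The mutual energy of a function and the first coordinate on a cell *)

Section Pairing.
Context {R : realType} {s : R} (s_gt0 : 0 < s) (s_le : s <= 8^-1) {X : set (R * R)}.
Hypothesis latticeX : is_lattice s X.
Context {G : (R * R -> R[i]) -> {finite_measure set (R * R)%type -> \bar R}}.
Hypothesis energyG : is_energy_measure s X G.
Implicit Types (f : R * R -> R[i]) (w : seq 'I_4).

Local Notation lft := (@lft R s).
Local Notation rgt := (@rgt R s).
Local Notation dom := (in_domain s X).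
Local Notation Re := complex.Re.
Local Notation cell := (cell s X).
Local Notation len := (@edge_length R).
Local Notation nu := (G fstC).
Let E_atE := energy_atE s_gt0 s_le latticeX.
Let WE_cvg := weighted_energy_cvg s_gt0 s_le latticeX energyG.
Let mX := lattice_measurable latticeX.
Let dfst := domain_fst s_gt0 s_le latticeX.

Lemma domain_add_fst f k : dom f ->
  dom (fun z => f z + k * fstC z) /\ dom (fun z => f z - k * fstC z).
Proof.
move=> df; have dk : dom (fun z => k * fstC z) by apply: (domainZ s_gt0 s_le latticeX).
by split; [exact: (domainD s_gt0 s_le latticeX)|exact: (domainB s_gt0 s_le latticeX)].
Qed.

(** Polarization on a single edge. The factor [k] will be 1 and ['i], for the real and the imaginary
    part of the pairing. *)
Lemma pairing_edge (D k : R[i]) (l : R) :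
  4^-1 * (sqnorm (D + k * l%:C%C) - sqnorm (D - k * l%:C%C)) = l * Re (D * Num.conj k).
Proof.
rewrite conjCE !sqnormE; by case: D k => [a b] [c d]; simpc; rewrite /=; field.
Qed.

(** With x the real part, |x|^2 is at most [sqnorm D], and e |x|^2 + l^2 / (4e) - l |x| is the
    square (2e |x| - l)^2 over 4e. The parameter e moves the cost between the energy of f and the
    mass of nu. *)
Lemma pairing_edge_le (D k : R[i]) (l e : R) : 0 < e -> sqnorm k = 1 -> 0 <= l ->
  `|l * Re (D * Num.conj k)| <= e * sqnorm D + l ^+ 2 / (4 * e).
Proof.
move=> e0 k1 l0; set x := Re _.
have xD : `|x| ^+ 2 <= sqnorm D.
  rewrite real_normK ?num_real//.
  have : sqnorm (D * Num.conj k) = sqnorm D by rewrite sqnormM sqnorm_conj k1 mulr1.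
  by rewrite sqnormE => <-; rewrite lerDl sqr_ge0.
rewrite normrM (ger0_norm l0).
apply: (@le_trans _ _ (e * `|x| ^+ 2 + l ^+ 2 / (4 * e))); last first.
  by rewrite lerD2r ler_wpM2l// ltW.
rewrite -subr_ge0 (_ : _ - _ = (2 * e * `|x| - l) ^+ 2 / (4 * e)).
  by rewrite divr_ge0 ?sqr_ge0// ltW// mulr_gt0.
by field; rewrite gt_eqF.
Qed.

(* Outside of the cell, the cross terms are split by the weighted AM-GM
   inequality; inside, they telescope because fstC is harmonic. *)
Lemma pairing_at_le f k m (w : m.-tuple 'I_4) (g : R * R -> R) e n : (m <= n)%N ->
  sqnorm k = 1 -> (forall z, 0 <= g z <= 1) -> (forall z, cell w z -> g z = 1) -> 0 < e ->
  `|4^-1 * (weighted_energy (s := s) n g (fun z => f z + k * fstC z)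
            - weighted_energy (s := s) n g (fun z => f z - k * fstC z))
    - len m * Re ((f (rgt w) - f (lft w)) * Num.conj k)|
  <= e * energy_at s n f
     + (weighted_energy (s := s) n g fstC - len m ^+ 2) / (4 * e).
Proof.
move=> mn k1 g01 g1 e0.
rewrite weighted_fst /weighted_energy -sumrB mulr_sumr E_atE mulr_sumr.
pose a v := (g (lft v) + g (rgt v)) / 2.
pose b v := len (size v) * Re ((f (rgt v) - f (lft v)) * Num.conj k).
have a01 v : 0 <= a v <= 1.
  have /andP[h1 h2] := g01 (lft v); have /andP[h3 h4] := g01 (rgt v).
  by apply/andP; split; rewrite /a; lra.
have aw u : a (w ++ u) = 1.
  rewrite /a !g1 ?divff//.
    by apply: (cell_cat latticeX (v := u)); exact: cell_rgt latticeX _.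
  by apply: (cell_cat latticeX (v := u)); exact: cell_lft latticeX _.
have edge (v : seq 'I_4) : 4^-1 *
    ((g (lft v) + g (rgt v)) / 2 *
       sqnorm (f (rgt v) + k * fstC (rgt v) - (f (lft v) + k * fstC (lft v)))
     - (g (lft v) + g (rgt v)) / 2 *
       sqnorm (f (rgt v) - k * fstC (rgt v) - (f (lft v) - k * fstC (lft v)))) = a v * b v.
  rewrite -mulrBr mulrCA -/(a v) /b -pairing_edge -(fst_edge (s := s)).
  by congr (_ * (_ * (_ - _))); apply: (congr1 (@sqnorm R _)); ring.
under eq_bigr => v _ do rewrite edge.
rewrite -(subnKC mn) (sum_cat m (n - m) (fun v => a v * b v)).
rewrite (sum_cat m (n - m) (fun v => e * sqnorm (f (rgt v) - f (lft v)))).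
rewrite (sum_cat m (n - m) (fun v => (g (lft v) + g (rgt v)) / 2 * len (m + (n - m)) ^+ 2)).
rewrite (bigD1 w)//=.
have inside : \sum_(u : (n - m).-tuple 'I_4) a (w ++ u) * b (w ++ u) = b w.
  have := @sum_harmonic R s R^o (fun z => Re (f z * Num.conj k)) w (n - m).
  rewrite -[X in _ = X]/(len (size w) * (Re (f (rgt w) * Num.conj k) - Re (f (lft w) * Num.conj k))).
  rewrite -raddfB -mulrBl => h; rewrite /b -h; apply: eq_bigr => u _.
  by rewrite aw mul1r mulrBl raddfB.
rewrite inside {1}/b size_tuple addrAC subrr add0r.
rewrite [X in _ <= X + _](bigD1 w)//= [X in _ <= _ + (X - _) / _](bigD1 w)//=.
have -> : \sum_(u : (n - m).-tuple 'I_4) (g (lft (w ++ u)) + g (rgt (w ++ u))) / 2 *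
    len (m + (n - m)) ^+ 2 = len m ^+ 2.
  have := @sum_harmonic R s R^o fst w (n - m).
  rewrite -[X in _ = X]/(len (size w) * ((rgt w).1 - (lft w).1)) rgtB_lft -/(len _) -expr2.
  rewrite size_tuple => <-; apply: eq_bigr => u _.
  by rewrite -/(a _) aw mul1r rgtB_lft expr2 size_cat !size_tuple.
rewrite [len m ^+ 2 + _]addrC addrK mulr_suml -addrA -[leLHS]add0r.
apply: lerD; first by apply: sumr_ge0 => u _; rewrite mulr_ge0 ?sqnorm_ge0// ltW.
rewrite -big_split /=; apply: (le_trans (ler_norm_sum _ _ _)); apply: ler_sum => v _.
rewrite mulr_suml -big_split /=; apply: (le_trans (ler_norm_sum _ _ _)); apply: ler_sum => u _.
have /andP[h1 h2] := a01 (v ++ u); rewrite normrM (ger0_norm h1) -/(a _).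
have sz : size (v ++ u) = (m + (n - m))%N by rewrite size_cat !size_tuple.
have := pairing_edge_le (f (rgt (v ++ u)) - f (lft (v ++ u))) e0 k1 (ltW (edge_length_gt0 (size (v ++ u)))).
rewrite -/(b _) sz => h.
apply: (le_trans (ler_wpM2l h1 h)); rewrite mulrDr mulrA; apply: lerD; last by rewrite mulrA.
by rewrite ler_wpM2r ?sqnorm_ge0// ler_piMl// ltW.
Qed.

Lemma pairing_le f k m (w : m.-tuple 'I_4) L (g : R * R -> R) e :
  dom f -> sqnorm k = 1 -> lip L g -> (forall z, 0 <= g z <= 1) ->
  (forall z, cell w z -> g z = 1) -> 0 < e ->
  `|4^-1 * (\int[G (fun z => (f z + k * fstC z)%R)]_(z in X) g z
            - \int[G (fun z => (f z - k * fstC z)%R)]_(z in X) g z)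
    - len m * Re ((f (rgt w) - f (lft w)) * Num.conj k)|
  <= e * energy s f + (\int[nu]_(z in X) g z - len m ^+ 2) / (4 * e).
Proof.
move=> df k1 gL g01 g1 e0; have [d1 d2] := domain_add_fst k df.
have dg := domain_lip s_gt0 s_le latticeX gL.
have c1 := WE_cvg d1 dg; have c2 := WE_cvg d2 dg; have c3 := WE_cvg dfst dg.
have c4 := domain_cvg df.
apply: (@ler_cvg_to _ \oo).
- by apply: cvg_norm; apply: cvgB; [apply: cvgM; [|apply: cvgB; [exact: c1|exact: c2]]|]; exact: cvg_cst.
- by apply: cvgD; [apply: cvgM; [|exact: c4]|apply: cvgM; [apply: cvgB; [exact: c3|]|]]; exact: cvg_cst.
by exists m => // n /= mn; exact: (pairing_at_le f mn k1 g01 g1 e0).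
Qed.

(** The order of limits matters. At fixed e the tents shrink to the cell, and the term over 4e
    disappears because [nu_cell] is an equality; only then does e tend to 0 and remove the energy of
    f. *)
Lemma pairing_cell f k m (w : m.-tuple 'I_4) : dom f -> sqnorm k = 1 ->
  4^-1 * (fine (G (fun z => f z + k * fstC z) (cell w))
          - fine (G (fun z => f z - k * fstC z) (cell w)))
  = len m * Re ((f (rgt w) - f (lft w)) * Num.conj k).
Proof.
move=> df k1.
have [g [gl g01 g1 g0]] := closed_tents (cell_closed s_gt0 s_le latticeX (w := w)).
have cv (mu : {finite_measure set (R * R)%type -> \bar R}) :
    \int[mu]_(z in X) g n z @[n --> \oo] --> fine (mu (cell w)).
  have := tents_cvg mX (m := mu) (cell_closed s_gt0 s_le latticeX (w := w)) gl g01 g1 g0.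
  by rewrite (setIidl (@cell_lattice _ _ _ latticeX w)).
set x := 4^-1 * _; set y := len m * _.
have E0 := energy_ge0 s_gt0 s_le latticeX df.
have h e : 0 < e -> `|x - y| <= e * energy s f.
  move=> e0.
  have -> : e * energy s f = e * energy s f + (fine (nu (cell w)) - len m ^+ 2) / (4 * e).
    by rewrite (nu_cell s_gt0 s_le latticeX energyG) subrr mul0r addr0.
  apply: (@ler_cvg_to _ \oo).
  - by apply: cvg_norm; apply: cvgB; [apply: cvgM; [|apply: cvgB; exact: cv]|]; exact: cvg_cst.
  - by apply: cvgD; [exact: cvg_cst|apply: cvgM; [apply: cvgB; [exact: cv|]|]; exact: cvg_cst].
  by apply: nearW => n; exact: (pairing_le df k1 (gl n) (g01 n) (g1 n) e0).
apply/eqP; rewrite -subr_eq0 -normr_le0; apply/ler_addgt0Pr => e e0; rewrite add0r.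
have E1 : 0 < energy s f + 1 by lra.
apply: (le_trans (h (e / (energy s f + 1)) (divr_gt0 e0 E1))).
by rewrite mulrAC ler_pdivrMr// ler_wpM2l ?ltW// ltrDl.
Qed.

Lemma energyZ c f : dom f -> energy s (fun z => c * f z) = sqnorm c * energy s f.
Proof.
move=> df; apply: cvg_lim => //.
rewrite (_ : (fun n => _) = (fun n => sqnorm c * energy_at s n f)).
  by apply: cvgM; [exact: cvg_cst|exact: domain_cvg df].
apply/funext => n; rewrite !E_atE mulr_sumr; apply: eq_bigr => w _.
by rewrite -mulrBr sqnormM.
Qed.

Lemma total_energy f : dom f -> fine (G f X) = energy s f.
Proof.
move=> df; have := WE_cvg df (domain_cst s_gt0 s_le latticeX (1%:C%C)).
rewrite Rintegral_cst// mul1r => /cvg_lim <-//.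
rewrite (_ : (fun n => _) = (fun n => energy_at s n f)).
  by [].
by apply/funext => n; rewrite E_atE; apply: eq_bigr => w _; rewrite divff// mul1r.
Qed.

(** Homogeneity of the energy measure is visible on the discrete integrals of Lipschitz functions,
    and passes from these to bounded measurable ones. *)
Lemma Rintegral_fstZ c (h : R * R -> R) M : measurable_fun X h ->
  (forall z, X z -> `|h z| <= M) ->
  \int[G (fun z => c * fstC z)]_(z in X) h z = sqnorm c * \int[nu]_(z in X) h z.
Proof.
move=> mh hM; apply: (eq_Rintegral_lip mX (sqnorm_ge0 c) _ mh hM) => L g gL.
have dg := domain_lip s_gt0 s_le latticeX gL.
have dc : dom (fun z => c * fstC z) by apply: (domainZ s_gt0 s_le latticeX).
rewrite -(cvg_lim _ (WE_cvg dc dg))//; apply: cvg_lim => //.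
rewrite (_ : (fun n => _) = (fun n => sqnorm c * weighted_energy (s := s) n g fstC)).
  by apply: cvgM; [exact: cvg_cst|exact: WE_cvg].
apply/funext => n.
rewrite /weighted_energy mulr_sumr; apply: eq_bigr => w _.
by rewrite -mulrBr sqnormM mulrCA.
Qed.

End Pairing.

(** * Bounded Borel functions and their complex integrals *)

Section BoundedBorel.
Context {R : realType} {X : set (R * R)} (mX : measurable X).
Implicit Types (g h : R * R -> R[i]).
Local Notation bb := (bounded_borel X).
Local Notation Re := complex.Re.
Local Notation Im := complex.Im.

Lemma bounded_borel_ReIm g : bb g -> exists M : R,
  [/\ 0 <= M, forall z, X z -> `|Re (g z)| <= M & forall z, X z -> `|Im (g z)| <= M].
Proof.
move=> [_ _ [M hM]]; exists (`|M| + 1); split; first by rewrite addr_ge0.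
- move=> z Xz; have := hM z Xz; rewrite sqnormE => h.
  rewrite -(ler_pXn2r (n := 2))// ?nnegrE ?addr_ge0// real_normK ?num_real//.
  have := ler_norm M; have := sqr_ge0 (Im (g z)); have := normr_ge0 M.
  by move: h; move: `|M| => N *; nra.
- move=> z Xz; have := hM z Xz; rewrite sqnormE => h.
  rewrite -(ler_pXn2r (n := 2))// ?nnegrE ?addr_ge0// real_normK ?num_real//.
  have := ler_norm M; have := sqr_ge0 (Re (g z)); have := normr_ge0 M.
  by move: h; move: `|M| => N *; nra.
Qed.

Lemma bounded_borelM g h : bb g -> bb h -> bb (fun z => g z * h z).
Proof.
move=> [mg1 mg2 [M hM]] [mh1 mh2 [N hN]]; split.
- rewrite (_ : (fun z => _) = (fun z => Re (g z)) \* (fun z => Re (h z))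
     \- (fun z => Im (g z)) \* (fun z => Im (h z))).
    by apply: measurable_funB; apply: measurable_funM.
  by apply/funext => z /=; case: (g z) (h z) => [? ?] [? ?].
- rewrite (_ : (fun z => _) = (fun z => Re (g z)) \* (fun z => Im (h z))
     \+ (fun z => Im (g z)) \* (fun z => Re (h z))).
    by apply: measurable_funD; apply: measurable_funM.
  by apply/funext => z /=; case: (g z) (h z) => [? ?] [? ?].
exists (M * N) => z Xz; rewrite sqnormM.
by apply: ler_pM; rewrite ?sqnorm_ge0 ?hM ?hN.
Qed.

Lemma bounded_borelD g h : bb g -> bb h -> bb (fun z => g z + h z).
Proof.
move=> [mg1 mg2 [M hM]] [mh1 mh2 [N hN]]; split.
- rewrite (_ : (fun z => _) = (fun z => Re (g z)) \+ (fun z => Re (h z))).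
    exact: measurable_funD.
  by apply/funext => z /=; rewrite raddfD.
- rewrite (_ : (fun z => _) = (fun z => Im (g z)) \+ (fun z => Im (h z))).
    exact: measurable_funD.
  by apply/funext => z /=; rewrite raddfD.
exists (2 * (M + N)) => z Xz; apply: (le_trans (sqnormD_le _ _)).
by rewrite ler_wpM2l// lerD ?hM ?hN.
Qed.

Lemma bounded_borel_cst c : bb (fun=> c).
Proof. by split; [exact: measurable_cst|exact: measurable_cst|exists (sqnorm c)]. Qed.

Lemma bounded_borelZ c g : bb g -> bb (fun z => c * g z).
Proof. by apply: bounded_borelM; exact: bounded_borel_cst. Qed.

Lemma bounded_borelB g h : bb g -> bb h -> bb (fun z => g z - h z).
Proof.
move=> bg bh; rewrite (_ : (fun z => _) = (fun z => g z + -1 * h z)).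
  by apply: bounded_borelD => //; exact: bounded_borelZ.
by apply/funext => z; rewrite mulN1r.
Qed.

Lemma bounded_borel_conj g : bb g -> bb (fun z => Num.conj (g z)).
Proof.
move=> [mg1 mg2 [M hM]]; split.
- by rewrite (_ : (fun z => _) = (fun z => Re (g z)))//; apply/funext => z; rewrite conjCE.
- rewrite (_ : (fun z => _) = \- (fun z => Im (g z))); first exact: measurable_funN.
  by apply/funext => z; rewrite conjCE.
by exists M => z Xz; rewrite sqnorm_conj hM.
Qed.

Lemma bounded_borel_real (g : R * R -> R) M : measurable_fun X g ->
  (forall z, X z -> `|g z| <= M) -> bb (fun z => (g z)%:C%C).
Proof.
move=> mg gM; split; [exact: mg|exact: measurable_cst|].
exists (M ^+ 2) => z Xz; rewrite sqnorm_real -real_normK ?num_real//.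
have := gM z Xz; have := normr_ge0 (g z) => h1 h2.
by rewrite ler_pXn2r ?nnegrE//; apply: le_trans h2.
Qed.

Lemma bounded_borel_indic B : measurable B -> bb (fun z => (\1_B z)%:C%C).
Proof.
move=> mB; apply: (bounded_borel_real (M := 1)) => [|z _]; first exact: measurable_indic.
by rewrite indicE; case: (_ \in _); rewrite ?normr0 ?normr1.
Qed.

Context (m : {finite_measure set (R * R)%type -> \bar R}).

Lemma bounded_borel_integrable g : bb g ->
  m.-integrable X (EFin \o (fun z => Re (g z))) /\ m.-integrable X (EFin \o (fun z => Im (g z))).
Proof.
move=> bg; have [M [M0 h1 h2]] := bounded_borel_ReIm bg; case: bg => m1 m2 _.
by split; [exact: (@bounded_integrable _ _ mX m _ M m1 h1)|exact: (@bounded_integrable _ _ mX m _ M m2 h2)].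
Qed.

Lemma CintegralD g h : bb g -> bb h ->
  Cintegral X m (fun z => g z + h z) = Cintegral X m g + Cintegral X m h.
Proof.
move=> /bounded_borel_integrable [i1 i2] /bounded_borel_integrable [j1 j2].
rewrite /Cintegral.
rewrite (_ : (fun z => Re (g z + h z)) = (fun z => Re (g z) + Re (h z))); last first.
  by apply/funext => z; rewrite raddfD.
rewrite (_ : (fun z => Im (g z + h z)) = (fun z => Im (g z) + Im (h z))); last first.
  by apply/funext => z; rewrite raddfD.
by rewrite !RintegralD//; simpc.
Qed.

Lemma CintegralZ c g : bb g -> Cintegral X m (fun z => c * g z) = c * Cintegral X m g.
Proof.
move=> /bounded_borel_integrable [i1 i2]; rewrite /Cintegral.
have iz (r : R) (h : R * R -> R) : m.-integrable X (EFin \o h) ->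
    m.-integrable X (EFin \o (fun z => r * h z)).
  by move=> ih; rewrite (_ : EFin \o _ = fun z => (r%:E * (EFin \o h) z)%E)//; exact: integrableZl.
case: c => a b.
rewrite (_ : (fun z => Re _) = (fun z => a * Re (g z) - b * Im (g z))); last first.
  by apply/funext => z; case: (g z).
rewrite (_ : (fun z => Im _) = (fun z => a * Im (g z) + b * Re (g z))); last first.
  by apply/funext => z; case: (g z).
rewrite (RintegralB mX (iz a _ i1) (iz b _ i2)) (RintegralD mX (iz a _ i2) (iz b _ i1)).
by rewrite !RintegralZl//; simpc.
Qed.

Lemma Cintegral_real (g : R * R -> R) :
  Cintegral X m (fun z => (g z)%:C%C) = (\int[m]_(z in X) g z)%:C%C.
Proof. by rewrite /Cintegral /= Rintegral_cst// mul0r. Qed.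

Lemma ae_eq_Cintegral g h : bb g -> bb h -> (\forall z \ae m, X z -> g z = h z) ->
  Cintegral X m g = Cintegral X m h.
Proof.
move=> [g1 g2 _] [h1 h2 _] gh; rewrite /Cintegral; congr (_ +i* _)%C;
  by apply: (ae_eq_Rintegral mX) => //; apply: filterS gh => z e Xz; rewrite e.
Qed.

End BoundedBorel.

(** * Real-valued norms and inner products in a complex Hilbert space *)

Section HilbertAux.
Context {R : realType} (H : completeNormedModType R[i]) (ip : {dot H for @Num.conj R[i]}).
Hypothesis ip_norm : forall u, ip u u = `|u| ^+ 2.
Implicit Types (u v : H).

Definition nrm v : R := complex.Re `|v|.

Lemma nrmE v : `|v| = (nrm v)%:C%C.
Proof. by rewrite /nrm; have /ger0_Im := normr_ge0 v; case: `|v| => a b /= ->. Qed.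

Lemma nrm_ge0 v : 0 <= nrm v.
Proof. by have := normr_ge0 v; rewrite nrmE -[0]/(0%:C%C) lecR. Qed.

Lemma nrmD u v : nrm (u + v) <= nrm u + nrm v.
Proof. by have := ler_normD u v; rewrite !nrmE -rmorphD lecR. Qed.

Lemma nrmB_sym u v : nrm (u - v) = nrm (v - u).
Proof. by rewrite /nrm distrC. Qed.

Lemma nrmB_le u v w : nrm (u - w) <= nrm (u - v) + nrm (v - w).
Proof. by apply: le_trans (nrmD _ _); rewrite addrA subrK. Qed.

Lemma nrm_sqr v : nrm v ^+ 2 = sqnorm v.
Proof. by []. Qed.

Lemma sqnormZ c v : sqnorm (c *: v) = sqnorm c * sqnorm v.
Proof.
rewrite /sqnorm normrZ nrmE; have := normr_ge0 c; case: `|c| => a b.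
by rewrite lecE /= => /andP[/eqP /= -> _]; simpc; rewrite exprMn.
Qed.

Lemma sqnorm_ip v : sqnorm v = complex.Re (ip v v).
Proof. by rewrite ip_norm nrmE -rmorphXn. Qed.

Lemma ip_sqnorm v : ip v v = (sqnorm v)%:C%C.
Proof. by rewrite ip_norm nrmE -rmorphXn. Qed.

Lemma sqnorm_eq0 v : sqnorm v = 0 -> v = 0.
Proof. by move=> /eqP; rewrite sqrf_eq0 => /eqP h; apply/eqP; rewrite -normr_eq0 nrmE /nrm h. Qed.

Lemma ipDl u v w : ip (u + v) w = ip u w + ip v w.
Proof. by rewrite linearDl. Qed.

Lemma ipDr w u v : ip w (u + v) = ip w u + ip w v.
Proof. by rewrite linearDr. Qed.

Lemma ipBl u v w : ip (u - v) w = ip u w - ip v w.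
Proof. by rewrite linearBl. Qed.

Lemma ipNr w u : ip w (- u) = - ip w u.
Proof. by rewrite linearNr. Qed.

Lemma ipZl c u w : ip (c *: u) w = c * ip u w.
Proof. by rewrite linearZl_LR. Qed.

Lemma ipZr c w u : ip w (c *: u) = Num.conj c * ip w u.
Proof. by rewrite linearZr_LR. Qed.

Lemma ipC u v : ip u v = Num.conj (ip v u).
Proof. by rewrite hermC /= expr0 mul1r. Qed.

Lemma ip_suml (I : finType) (e : I -> H) w : ip (\sum_i e i) w = \sum_i ip (e i) w.
Proof. by rewrite linear_sumlz. Qed.

Lemma ip_sumr (I : finType) (e : I -> H) w : ip w (\sum_i e i) = \sum_i ip w (e i).
Proof. by rewrite linear_sumr. Qed.

Lemma sqnormN v : sqnorm (- v) = sqnorm v.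
Proof. by rewrite /sqnorm normrN. Qed.

Lemma sqnormDE u v : sqnorm (u + v) = sqnorm u + sqnorm v + 2 * complex.Re (ip u v).
Proof.
rewrite !sqnorm_ip ipDl !ipDr (ipC v u) conjCE !raddfD /=.
by lra.
Qed.

Lemma cauchy_schwarz u v : sqnorm (ip u v) <= sqnorm u * sqnorm v.
Proof.
have [v0|v0] := eqVneq (sqnorm v) 0.
  by rewrite (sqnorm_eq0 v0) linear0r /sqnorm !normr0 expr0n mulr0.
have vp : 0 < sqnorm v by rewrite lt_neqAle eq_sym v0 sqnorm_ge0.
have := sqnorm_ge0 ((sqnorm v)%:C%C *: u - ip u v *: v).
rewrite sqnormDE sqnormN !sqnormZ ipNr ipZl ipZr.
have -> : complex.Re (- ((sqnorm v)%:C%C * (Num.conj (ip u v) * ip u v))) = - (sqnorm v * sqnorm (ip u v)).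
  by rewrite conjCE [sqnorm (ip u v)]sqnormE; case: (ip u v) => a b; simpc; rewrite /=; ring.
rewrite sqnorm_real => h.
have : 0 <= sqnorm v * (sqnorm u * sqnorm v - sqnorm (ip u v)) by lra.
by rewrite pmulr_rge0// subr_ge0.
Qed.

Lemma pythagoras (I : finType) (c : I -> R[i]) (e : I -> H) :
  (forall i j, i != j -> ip (e i) (e j) = 0) ->
  sqnorm (\sum_i c i *: e i) = \sum_i sqnorm (c i) * sqnorm (e i).
Proof.
move=> eij; rewrite sqnorm_ip ip_suml raddf_sum; apply: eq_bigr => i _ /=.
rewrite ip_sumr (bigD1 i)//= big1 => [|j ji]; last first.
  by rewrite ipZl ipZr eij ?mulr0// eq_sym.
rewrite addr0 ipZl ipZr ip_sqnorm conjCE [sqnorm (c i)]sqnormE.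
by case: (c i) => a b; simpc; rewrite /=; ring.
Qed.

End HilbertAux.

(** * Step forms *)

Section OneFormTheory.
Context {R : realType} {s : R} (s_gt0 : 0 < s) (s_le : s <= 8^-1) {X : set (R * R)}.
Hypothesis latticeX : is_lattice s X.
Context {G : (R * R -> R[i]) -> {finite_measure set (R * R)%type -> \bar R}}.
Hypothesis energyG : is_energy_measure s X G.
Context {H : completeNormedModType R[i]} {ip : {dot H for @Num.conj R[i]}}.
Context {tens : (R * R -> R[i]) -> (R * R -> R[i]) -> H}.
Context {mul : (R * R -> R[i]) -> H -> H}.
Hypothesis formsH : is_one_forms s X G ip tens mul.
Implicit Types (f g : R * R -> R[i]) (w : seq 'I_4).

Local Notation lft := (@lft R s).
Local Notation rgt := (@rgt R s).
Local Notation dom := (in_domain s X).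
Local Notation bb := (bounded_borel X).
Local Notation Re := complex.Re.
Local Notation Im := complex.Im.
Local Notation cell := (cell s X).
Local Notation len := (@edge_length R).
Local Notation nu := (G fstC).
Local Notation D f w := (f (rgt w) - f (lft w)).
Local Notation ind := (cell_indic s X).
Local Notation T := (tens fstC).
Local Notation deriv := (derivation tens).
Let E_atE := energy_atE s_gt0 s_le latticeX.
Let mX := lattice_measurable latticeX.
Let dfst := domain_fst s_gt0 s_le latticeX.
Let ip_n := ip_norm formsH.

Lemma domain_bounded_borel f : dom f -> bb f.
Proof.
move=> df; have [M M0 hM] := domain_sqnorm_bound latticeX df; case: df => cR cI _.
by split; [exact: within_continuous_measurable|exact: within_continuous_measurable|exists M].
Qed.

Lemma ind_bounded_borel w : bb (ind w).
Proof. by apply: bounded_borel_indic; exact: (cell_measurable s_gt0 s_le latticeX). Qed.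

Lemma CintegralfstZ c g : bb g ->
  Cintegral X (G (fun z => c * fstC z)) g = (sqnorm c)%:C%C * Cintegral X nu g.
Proof.
move=> bg; have [M [M0 h1 h2]] := bounded_borel_ReIm bg; case: bg => m1 m2 _.
rewrite /Cintegral (Rintegral_fstZ s_gt0 s_le latticeX energyG c m1 h1).
by rewrite (Rintegral_fstZ s_gt0 s_le latticeX energyG c m2 h2); simpc.
Qed.

(** The polarized measure of x_1 with itself collapses to nu: the weights i^k |1 + i^k|^2 for k < 4
    are 4, 2i, 0, -2i, with sum 4. Hence g |-> g dx_1, which is [T], is isometric for L^2(nu). *)
Lemma Gamma_fst g : bb g -> Gamma_integral X G fstC fstC g = Cintegral X nu g.
Proof.
move=> bg; rewrite /Gamma_integral /polar.
under eq_bigr => k _.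
  rewrite (_ : (fun z => fstC z + 'i ^+ k * fstC z) = (fun z => (1 + 'i ^+ k) * fstC z)); last first.
    by apply/funext => z; rewrite mulrDl mul1r.
  rewrite CintegralfstZ// mulrA.
  over.
rewrite -mulr_suml mulrA [X in X * _](_ : _ = 1) ?mul1r//.
rewrite !big_ord_recr big_ord0 /= add0r !exprS expr0 !mulr1 mul1r -!complexiE.
rewrite !sqnormE /=.
have -> : (4^-1 : R[i]) = (4^-1)%:C%C by rewrite fmorphV /= rmorph_nat.
by simpc; congr (_ +i* _)%C; field.
Qed.

Lemma ipT g h : bb g -> bb h -> ip (T g) (T h) = Cintegral X nu (fun z => g z * Num.conj (h z)).
Proof.
move=> bg bh; rewrite (tens_ip formsH)// Gamma_fst//.
by apply: bounded_borelM => //; exact: bounded_borel_conj.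
Qed.

Lemma sqnormT g : bb g -> sqnorm (T g) = \int[nu]_(z in X) sqnorm (g z).
Proof.
move=> bg; rewrite (sqnorm_ip ip_n) ipT//.
by rewrite (_ : (fun z => _) = (fun z => (sqnorm (g z))%:C%C)) ?Cintegral_real//;
  apply/funext => z; rewrite -normCK sqr_normCE.
Qed.

(** Linearity comes from the inner products: the defect is orthogonal to every [T k] and is itself a
    combination of such elements, so it has norm 0. *)
Lemma T_linear c g h : bb g -> bb h -> T (fun z => c * g z + h z) = c *: T g + T h.
Proof.
move=> bg bh; have bgh : bb (fun z => c * g z + h z).
  by apply: bounded_borelD => //; exact: bounded_borelZ.
apply/eqP; rewrite -subr_eq0; apply/eqP; apply: sqnorm_eq0; rewrite (sqnorm_ip ip_n).
suff e k : bb k -> ip (T (fun z => c * g z + h z) - (c *: T g + T h)) (T k) = 0.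
  move: e; set d := T _ - _ => e; rewrite {2}/d ipDr ipNr ipDr ipZr !e//.
  by rewrite mulr0 addr0 oppr0 addr0.
move=> bk; have bk' := bounded_borel_conj bk.
rewrite ipBl ipDl ipZl !ipT//.
rewrite (_ : (fun z => (c * g z + h z) * _) = (fun z => c * (g z * Num.conj (k z)) + h z * Num.conj (k z))).
  rewrite CintegralD// ?CintegralZ// ?subrr//.
  - exact: bounded_borelM.
  - by apply: bounded_borelZ; exact: bounded_borelM.
  - exact: bounded_borelM.
by apply/funext => z; rewrite mulrDl mulrA.
Qed.

Lemma T0 : T (fun=> 0) = 0.
Proof.
apply: sqnorm_eq0; rewrite sqnormT; last exact: bounded_borel_cst.
by rewrite Rintegral_cst// sqnormE /= expr0n addr0 mul0r.
Qed.

Lemma T_Z c g : bb g -> T (fun z => c * g z) = c *: T g.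
Proof.
move=> bg; have := T_linear c bg (bounded_borel_cst 0); rewrite T0 addr0 => <-.
by congr T; apply/funext => z; rewrite addr0.
Qed.

Lemma T_D g h : bb g -> bb h -> T (fun z => g z + h z) = T g + T h.
Proof.
move=> bg bh; have := T_linear 1 bg bh; rewrite scale1r => <-.
by congr T; apply/funext => z; rewrite mul1r.
Qed.

Lemma T_B g h : bb g -> bb h -> T (fun z => g z - h z) = T g - T h.
Proof.
move=> bg bh; have := T_linear (-1) bh bg; rewrite scaleN1r addrC => <-.
by congr T; apply/funext => z; rewrite mulN1r addrC.
Qed.

Lemma T_sum (I : Type) (r : seq I) (h : I -> R * R -> R[i]) : (forall i, bb (h i)) ->
  bb (fun z => \sum_(i <- r) h i z) /\ T (fun z => \sum_(i <- r) h i z) = \sum_(i <- r) T (h i).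
Proof.
move=> bh; elim: r => [|i r [IH1 IH2]].
  rewrite (_ : (fun z => _) = fun=> 0); last by apply/funext => z; rewrite big_nil.
  by split; [exact: bounded_borel_cst|rewrite big_nil T0].
rewrite (_ : (fun z => _) = fun z => h i z + \sum_(j <- r) h j z).
  by split; [exact: bounded_borelD|rewrite T_D// IH2 big_cons].
by apply/funext => z; rewrite big_cons.
Qed.

Lemma T_ae g h : bb g -> bb h -> (\forall z \ae nu, X z -> g z = h z) -> T g = T h.
Proof.
move=> bg bh gh; apply/eqP; rewrite -subr_eq0 -T_B//; apply/eqP; apply: sqnorm_eq0.
have bgh := bounded_borelB bg bh.
rewrite (sqnorm_ip ip_n) ipT// (@ae_eq_Cintegral _ _ mX _ _ (fun=> 0)).
- by rewrite /Cintegral /= Rintegral_cst// mul0r.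
- by apply: bounded_borelM => //; exact: bounded_borel_conj.
- exact: bounded_borel_cst.
by apply: filterS gh => z gh Xz; rewrite gh// subrr mul0r.
Qed.

Lemma ind_mul n (w v : n.-tuple 'I_4) : w != v ->
  \forall z \ae nu, X z -> ind w z * ind v z = 0.
Proof.
move=> wv; apply: filterS (nu_disjoint_cells s_gt0 s_le latticeX energyG n) => z h Xz.
rewrite /cell_indic !indicE; have := h Xz _ _ wv.
case: (boolP (z \in cell w)); case: (boolP (z \in cell v)); rewrite ?inE ?(mulr0, mul0r)//.
by move=> cv cw []; split.
Qed.

Lemma ip_ind n (w v : n.-tuple 'I_4) : w != v -> ip (T (ind w)) (T (ind v)) = 0.
Proof.
move=> wv; have bw := ind_bounded_borel w; have bv := bounded_borel_conj (ind_bounded_borel v).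
rewrite ipT//; last exact: ind_bounded_borel.
rewrite (@ae_eq_Cintegral _ _ mX _ _ (fun=> 0)).
- by rewrite /Cintegral /= Rintegral_cst// mul0r.
- exact: bounded_borelM.
- exact: bounded_borel_cst.
apply: filterS (ind_mul wv) => z h Xz.
by rewrite -(h Xz); congr (_ * _); rewrite conjCE /= oppr0.
Qed.

Lemma sqnorm_ind n (w : n.-tuple 'I_4) : sqnorm (T (ind w)) = len n ^+ 2.
Proof.
rewrite sqnormT; last exact: ind_bounded_borel.
rewrite -(nu_cell s_gt0 s_le latticeX energyG w) -[in RHS](setIidl (@cell_lattice _ _ _ latticeX w)).
rewrite -Rintegral_indic//; last exact: (cell_measurable s_gt0 s_le latticeX).
apply: eq_Rintegral => z _; rewrite sqnorm_real indicE.
by case: (_ \in _); rewrite ?expr1n ?expr0n.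
Qed.

Lemma mul_T h g : bb h -> bb g -> mul h (T g) = T (fun z => h z * g z).
Proof. by move=> bh bg; exact: (mul_tens formsH). Qed.

Lemma deriv_mul f g : dom f -> bb g -> mul g (deriv f) = tens f g.
Proof.
move=> df bg; rewrite /derivation (mul_tens formsH)//; last exact: bounded_borel_cst.
by congr tens; apply/funext => z; rewrite mulr1.
Qed.

Lemma mul_ind_deriv w : mul (ind w) (deriv fstC) = T (ind w).
Proof. by apply: deriv_mul => //; exact: ind_bounded_borel. Qed.

Lemma mul_ind_ind n (w v : n.-tuple 'I_4) :
  mul (ind w) (T (ind v)) = if w == v then T (ind w) else 0.
Proof.
rewrite mul_T; [|exact: ind_bounded_borel|exact: ind_bounded_borel].
case: eqVneq => [->|wv].
  congr T; apply/funext => z; rewrite /cell_indic -rmorphM indicE.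
  by case: (_ \in _); rewrite ?mulr1 ?mulr0.
rewrite -T0; apply: T_ae; [|exact: bounded_borel_cst|exact: ind_mul].
by apply: bounded_borelM; exact: ind_bounded_borel.
Qed.

(** The bridge between 1-forms and the graph. The inner product is a polarized mass of the cell,
    whose real and imaginary parts are [pairing_cell] at [k = 1] and [k = 'i]. *)
Lemma ip_deriv_ind n f (w : n.-tuple 'I_4) : dom f ->
  ip (deriv f) (T (ind w)) = (len n)%:C%C * D f w.
Proof.
move=> df; have b1 := @bounded_borel_cst _ X 1; have bw := ind_bounded_borel w.
rewrite /derivation (tens_ip formsH)// /Gamma_integral.
rewrite (_ : (fun h => Cintegral X (G h) _) = (fun h => (fine (G h (cell w)))%:C%C)); last first.
  apply/funext => h.
  rewrite (_ : (fun z => _) = (fun z => (\1_(cell w) z : R)%:C%C)); last first.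
    by apply/funext => z; rewrite mul1r conjCE /= oppr0.
  rewrite Cintegral_real// Rintegral_indic//; last exact: (cell_measurable s_gt0 s_le latticeX).
  by rewrite (setIidl (@cell_lattice _ _ _ latticeX w)).
rewrite polar_real.
have := pairing_cell s_gt0 s_le latticeX energyG w df (k := 'i).
have := pairing_cell s_gt0 s_le latticeX energyG w df (k := 1).
rewrite (_ : (fun z => f z + 1 * fstC z) = (fun z => f z + fstC z)); last first.
  by apply/funext => z; rewrite mul1r.
rewrite (_ : (fun z => f z - 1 * fstC z) = (fun z => f z - fstC z)); last first.
  by apply/funext => z; rewrite mul1r.
rewrite !sqnormE -complexiE /= !(expr0n, expr1n) !(add0r, addr0) => -> // -> //.
by rewrite !conjCE; case: (D f w) => a b; simpc.
Qed.

Lemma sqnorm_deriv f : dom f -> sqnorm (deriv f) = energy s f.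
Proof.
move=> df; have b1 := @bounded_borel_cst _ X 1.
rewrite (sqnorm_ip ip_n) /derivation (tens_ip formsH)// /Gamma_integral.
rewrite (_ : (fun h => Cintegral X (G h) _) = (fun h => (fine (G h X))%:C%C)); last first.
  apply/funext => h.
  rewrite (_ : (fun z => _) = (fun z => (1 : R)%:C%C)); last first.
    by apply/funext => z; rewrite mul1r conjCE /= oppr0.
  by rewrite Cintegral_real// Rintegral_cst// mul1r.
rewrite polar_real /=.
rewrite (_ : (fun z => f z + f z) = (fun z => 2 * f z)); last by apply/funext => z; ring.
rewrite (_ : (fun z => f z - f z) = (fun z => 0 * f z)); last by apply/funext => z; ring.
have dz c := domainZ s_gt0 s_le latticeX c df.
rewrite !(total_energy s_gt0 s_le latticeX energyG)// !(energyZ s_gt0 s_le latticeX)//.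
by rewrite !sqnormE /=; field.
Qed.

(** Each coefficient is the pairing of df with [T (ind w)] divided by the squared norm [len n ^+ 2],
    so the sum is the orthogonal projection of df and its squared norm is E_n(f). *)
Lemma sqnorm_deriv_step n f : dom f ->
  sqnorm (deriv f - \sum_(w : n.-tuple 'I_4) ((len n)^-1%:C%C * D f w) *: T (ind w))
  = energy s f - energy_at s n f.
Proof.
move=> df; rewrite (sqnormDE ip_n) sqnormN sqnorm_deriv//.
rewrite (pythagoras ip_n) => [|w v]; last exact: ip_ind.
have l0 : len n != 0 by rewrite gt_eqF// edge_length_gt0.
have -> : \sum_(w : n.-tuple 'I_4) sqnorm ((len n)^-1%:C%C * D f w) * sqnorm (T (ind w)) = energy_at s n f.
  rewrite E_atE; apply: eq_bigr => w _; rewrite sqnormM sqnorm_real sqnorm_ind.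
  by field.
suff -> : Re (ip (deriv f) (- \sum_(w : n.-tuple 'I_4) ((len n)^-1%:C%C * D f w) *: T (ind w))) = - energy_at s n f by lra.
rewrite ipNr raddfN ip_sumr raddf_sum E_atE; congr (- _); apply: eq_bigr => w _.
rewrite ipZr ip_deriv_ind// conjCE sqnormE; case: (D f w) => a b; simpc; rewrite /=.
by field.
Qed.

Lemma harmonic_deriv n f : harmonic_at s X n f ->
  deriv f = \sum_(w : n.-tuple 'I_4) ((len n)^-1%:C%C * D f w) *: T (ind w).
Proof.
move=> [df hf]; apply/eqP; rewrite -subr_eq0; apply/eqP; apply: sqnorm_eq0.
rewrite sqnorm_deriv_step//; apply/eqP; rewrite subr_eq0; apply/eqP.
by apply: cvg_lim => //; apply: cvg_near_cst; exists n => // m /= /hf ->.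
Qed.

Lemma mul_lin h : bb h -> forall (I : finType) (c : I -> R[i]) (e : I -> H),
  mul h (\sum_i c i *: e i) = \sum_i c i *: mul h (e i).
Proof.
move=> bh I c e; have lin := mul_linear formsH bh.
have m0 : mul h 0 = 0 by have := lin (-1) 0 0; rewrite scaleN1r oppr0 addr0 scaleN1r addNr.
elim/big_ind2 : _ => // [x y x' y' <- <-|i _].
  by have := lin 1 y y'; rewrite !scale1r.
by have := lin (c i) (e i) 0; rewrite m0 !addr0.
Qed.

Lemma mul_ind_harmonic n f (w : n.-tuple 'I_4) : harmonic_at s X n f ->
  mul (ind w) (deriv f) = ((len n)^-1%:C%C * D f w) *: T (ind w).
Proof.
move=> /harmonic_deriv ->; rewrite mul_lin; last exact: ind_bounded_borel.
rewrite (bigD1 w)//= big1 => [|v vw]; first by rewrite mul_ind_ind eqxx addr0.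
by rewrite mul_ind_ind eq_sym (negPf vw) scaler0.
Qed.

(** On each cell f is frozen at the right end, the value that carries the phase in the magnetic
    energy. Errors on distinct cells are orthogonal, so a uniform bound on the oscillation is
    enough. *)
Lemma mul_step_le n f (c : n.-tuple 'I_4 -> R[i]) e : bb f -> 0 <= e ->
  (forall (w : n.-tuple 'I_4) z, cell w z -> sqnorm (f z - f (rgt w)) <= e) ->
  sqnorm (mul f (\sum_w c w *: T (ind w)) - \sum_w (c w * f (rgt w)) *: T (ind w))
  <= e * sqnorm (\sum_w c w *: T (ind w)).
Proof.
move=> bf e0 fe; rewrite mul_lin// -sumrB.
have bh (w : n.-tuple 'I_4) : bb (fun z => (f z - f (rgt w)) * ind w z).
  apply: bounded_borelM; last exact: ind_bounded_borel.
  by apply: bounded_borelB => //; exact: bounded_borel_cst.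
rewrite (eq_bigr (fun w : n.-tuple 'I_4 => c w *: T (fun z => (f z - f (rgt w)) * ind w z))) => [|w _]; last first.
  have bw := ind_bounded_borel w.
  rewrite mul_T// -scalerA -scalerBr -T_Z// -T_B//; last 2 first.
  - exact: bounded_borelM.
  - exact: bounded_borelZ.
  by congr (_ *: T _); apply/funext => z; rewrite mulrBl.
rewrite (@pythagoras _ _ _ ip_n _ c (fun w : n.-tuple 'I_4 => T (fun z => (f z - f (rgt w)) * ind w z))) => [|w v wv]; last first.
  rewrite ipT// (@ae_eq_Cintegral _ _ mX _ _ (fun=> 0)).
  - by rewrite /Cintegral /= Rintegral_cst// mul0r.
  - by apply: bounded_borelM => //; exact: bounded_borel_conj.
  - exact: bounded_borel_cst.
  apply: filterS (ind_mul wv) => z h Xz.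
  rewrite rmorphM /= mulrACA (_ : Num.conj (ind v z) = ind v z) ?h ?mulr0//.
  by rewrite conjCE /= oppr0.
rewrite (pythagoras ip_n) => [|w v]; last exact: ip_ind.
rewrite mulr_sumr; apply: ler_sum => w _; rewrite [leRHS]mulrCA ler_wpM2l ?sqnorm_ge0//.
rewrite !sqnormT//; last exact: ind_bounded_borel.
have i1 : nu.-integrable X (EFin \o (fun z => sqnorm (ind w z))).
  apply: (@bounded_integrable _ _ mX _ _ 1) => [|z _].
    rewrite (_ : (fun z => _) = \1_(cell w)).
      by apply: measurable_indic; exact: (cell_measurable s_gt0 s_le latticeX).
    by apply/funext => z; rewrite sqnorm_real indicE; case: (_ \in _); rewrite ?expr1n ?expr0n.
  by rewrite sqnorm_real indicE; case: (_ \in _); rewrite ?expr1n ?expr0n ?normr0 ?normr1.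
rewrite -RintegralZl//; apply: le_Rintegral => //.
- have [M [M0 h1 h2]] := bounded_borel_ReIm (bh w); case: (bh w) => m1 m2 [N hN].
  apply: (@bounded_integrable _ _ mX _ _ N) => [|z Xz].
    rewrite (_ : (fun z => _) = (fun z => Re ((f z - f (rgt w)) * ind w z)) \* (fun z => Re ((f z - f (rgt w)) * ind w z)) \+ (fun z => Im ((f z - f (rgt w)) * ind w z)) \* (fun z => Im ((f z - f (rgt w)) * ind w z))).
      by apply: measurable_funD; apply: measurable_funM.
    by apply/funext => z; rewrite sqnormE.
  by rewrite ger0_norm ?sqnorm_ge0// hN.
- by rewrite (_ : EFin \o _ = fun z => (e%:E * (EFin \o (fun z => sqnorm (ind w z))) z)%E)//; exact: integrableZl.
move=> z Xz; rewrite sqnormM /cell_indic sqnorm_real indicE.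
case: (boolP (z \in _)) => [|_]; last by rewrite expr0n !mulr0.
by rewrite inE expr1n !mulr1; exact: fe.
Qed.

End OneFormTheory.

(** The sum counts the positive integers up to y: it is the integer part of y. *)
Lemma layer_sum (R : realType) (K : nat) (y : R) : 0 <= y <= K%:R ->
  `|y - \sum_(k < K) (nat_of_bool (k.+1%:R <= y)%R)%:R| <= 1.
Proof.
elim: K => [|K IH] /andP[y0 yK].
  by rewrite big_ord0 subr0 ger0_norm//; apply: le_trans yK _.
rewrite big_ord_recr /=; have [yK'|yK'] := leP y K%:R.
  rewrite (_ : K.+1%:R <= y = false) ?addr0; first by apply: IH; rewrite y0.
  by apply/negbTE; rewrite -ltNge; apply: le_lt_trans yK' _; rewrite ltr_nat.
rewrite (eq_bigr (fun=> 1)) => [|k _]; last first.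
  by rewrite (_ : k.+1%:R <= y)//; apply: le_trans (ltW yK'); rewrite ler_nat.
rewrite sumr_const card_ord; move: yK; rewrite -natr1 => yK.
by apply/ler_normlP; case: (_ <= y); split; rewrite /=; lra.
Qed.

(** * Density of the step forms *)

Section Density.
Context {R : realType} {s : R} (s_gt0 : 0 < s) (s_le : s <= 8^-1) {X : set (R * R)}.
Hypothesis latticeX : is_lattice s X.
Context {G : (R * R -> R[i]) -> {finite_measure set (R * R)%type -> \bar R}}.
Hypothesis energyG : is_energy_measure s X G.
Context {H : completeNormedModType R[i]} {ip : {dot H for @Num.conj R[i]}}.
Context {tens : (R * R -> R[i]) -> (R * R -> R[i]) -> H}.
Context {mul : (R * R -> R[i]) -> H -> H}.
Hypothesis formsH : is_one_forms s X G ip tens mul.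
Implicit Types (f g : R * R -> R[i]) (w : seq 'I_4).

Local Notation lft := (@lft R s).
Local Notation rgt := (@rgt R s).
Local Notation dom := (in_domain s X).
Local Notation bb := (bounded_borel X).
Local Notation Re := complex.Re.
Local Notation Im := complex.Im.
Local Notation cell := (cell s X).
Local Notation len := (@edge_length R).
Local Notation nu := (G fstC).
Local Notation D f w := (f (rgt w) - f (lft w)).
Local Notation ind := (cell_indic s X).
Local Notation T := (tens fstC).
Local Notation deriv := (derivation tens).
Let mX := lattice_measurable latticeX.
Let sqT := sqnormT s_gt0 s_le latticeX energyG formsH.
Let TB := T_B s_gt0 s_le latticeX energyG formsH.
Let TD := T_D s_gt0 s_le latticeX energyG formsH.
Let TZ := T_Z s_gt0 s_le latticeX energyG formsH.
Let Tae := T_ae s_gt0 s_le latticeX energyG formsH.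
Let Tsum := T_sum s_gt0 s_le latticeX energyG formsH.
Let bind w : bb (ind w) := ind_bounded_borel s_gt0 s_le latticeX w.

(** Uniform continuity on the compact X: n-cells have diameter of order (5/8)^n, so a point of a
    cell and the right end of the cell are both close to one point of continuity. *)
Lemma domain_oscillation f e : dom f -> 0 < e -> \forall n \near \oo,
  forall (w : n.-tuple 'I_4) z, cell w z -> sqnorm (f z - f (rgt w)) <= e.
Proof.
move=> [cR cI _] e0.
have cov := (compact_near_coveringP X).1 (lattice_compact latticeX) nat \oo
  (fun n z => forall w : n.-tuple 'I_4, cell w z -> sqnorm (f z - f (rgt w)) <= e).
suff near_cell x : X x -> \forall y \near x & n \near \oo,
    forall w : n.-tuple 'I_4, cell w y -> sqnorm (f y - f (rgt w)) <= e.
  apply: filterS (cov _ near_cell) => n h w z wz; apply: (h z) => //.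
  exact: (cell_lattice latticeX wz).
move=> Xx.
(* As d <= 1, d^2 <= e/8. Real and imaginary part together give e/4, and comparing two points
   through x gives 2 (e/4 + e/4) = e. *)
pose d := Num.min 1 (e / 8).
have d0 : 0 < d by rewrite lt_min ltr01 divr_gt0.
have d8 : d ^+ 2 <= e / 8.
  have h1 : d <= 1 by rewrite ge_min lexx.
  have h2 : d <= e / 8 by rewrite ge_min lexx orbT.
  by rewrite expr2; apply: le_trans h2; rewrite ler_piMl// ltW.
have near_x (h : R * R -> R) : {within X, continuous h} -> exists2 r : R, 0 < r &
    forall y, X y -> wdist x y < r -> `|h x - h y| <= d.
  move=> /subspace_continuousP /(_ x Xx) /cvgrPdist_le /(_ d d0).
  rewrite near_withinE => /nbhs_ballP [r /= r0 hr].
  exists r => // y Xy xy; apply: hr => //.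
  move: xy; rewrite /wdist => xy.
  have := normr_ge0 (x.1 - y.1); have := normr_ge0 (x.2 - y.2) => h1 h2.
  by split; rewrite /ball /=; lra.
have [r1 r10 h1] := near_x _ cR; have [r2 r20 h2] := near_x _ cI.
pose r := Num.min r1 r2; have r0 : 0 < r by rewrite lt_min r10 r20.
have fx y : X y -> wdist x y < r -> sqnorm (f x - f y) <= e / 4.
  rewrite lt_min => Xy /andP[y1 y2]; rewrite sqnormE !raddfB /=.
  rewrite -(real_normK (num_real (_ - _))) -[X in _ + X]real_normK ?num_real//.
  have : `|Re (f x) - Re (f y)| ^+ 2 <= d ^+ 2 by rewrite ler_pXn2r ?nnegrE ?h1// ltW.
  have : `|Im (f x) - Im (f y)| ^+ 2 <= d ^+ 2 by rewrite ler_pXn2r ?nnegrE ?h2// ltW.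
  by move: d8; lra.
(* By the rhombus estimate, 12 bounds [wdist] between a point of X and (1, 0). *)
have [N hN] : exists N, 12 * (5 / 8) ^+ N < r / 2.
  by apply: geometric_small; [lra|rewrite divr_gt0].
exists ([set y | wdist x y < r / 2], [set n | (N <= n)%N]) => /=.
  split; last by exists N.
  apply/nbhs_ballP; exists (r / 16) => /=; first by rewrite divr_gt0.
  by move=> y [/= y1 y2]; rewrite /ball /= in y1 y2; rewrite /wdist; lra.
move=> [y n] /= [xy Nn] w [z1 Xz1 zy].
have Xy : X y by rewrite -zy; exact: (lattice_Fw latticeX).
have Xr := lattice_right s_gt0 s_le latticeX.
have yr : wdist y (rgt w) < r / 2.
  apply: le_lt_trans hN; rewrite -zy mulrC.
  apply: (le_trans (wdist_Fw s_gt0 s_le _ _ _)); rewrite size_tuple.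
  apply: ler_pM; [by apply: exprn_ge0; lra|exact: wdist_ge0| |].
    by apply: ler_wiXn2l => //; lra.
  have := lattice_fst_le latticeX Xz1 => a1.
  have := lattice_snd_le s_gt0 s_le latticeX Xz1 => a2.
  have := normr_ge0 z1.1; rewrite /wdist /= subr0 => a3.
  by have := ler_normB z1.1 1; rewrite normr1; lra.
have xr : wdist x (rgt w) < r.
  move: xy yr; rewrite /wdist.
  have := ler_distD y.1 x.1 (rgt w).1; have := ler_distD y.2 x.2 (rgt w).2.
  by lra.
have a1 := fx _ (lattice_rgt s_gt0 s_le latticeX w) xr.
have a2 : sqnorm (f x - f y) <= e / 4 by apply: fx => //; move: xy; lra.
rewrite (_ : f y - f _ = (f y - f x) + (f x - f (rgt w))); last by rewrite addrA subrK.
by apply: (le_trans (sqnormD_le _ _)); rewrite sqnormB_sym; move: a1 a2; lra.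
Qed.

(** The coefficients are defined on words of any length, so that refining the scale only precomposes
    them with [take n]. *)
Definition step n (v : H) : Prop := exists c : seq 'I_4 -> R[i],
  v = \sum_(w : n.-tuple 'I_4) c w *: T (ind w).

Definition approximable (v : H) : Prop :=
  forall e, 0 < e -> exists n v', step n v' /\ nrm (v - v') < e.

(** The four subcells cover the cell and overlap in null sets, which [T] does not see. *)
Lemma ind_split n (w : n.-tuple 'I_4) : T (ind w) = \sum_j T (ind (rcons w j)).
Proof.
have [bs <-] := @Tsum 'I_4 (index_enum _) (fun j => ind (rcons w j)) (fun j => bind _).
apply: Tae => //; apply: filterS (nu_disjoint_cells s_gt0 s_le latticeX energyG n.+1) => z h Xz.
rewrite /cell_indic -rmorph_sum /=; congr (_%:C%C); rewrite indicE.
have sub j : cell (rcons w j) z -> cell w z by rewrite -cats1; exact: (cell_cat latticeX).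
case: (boolP (z \in cell w)) => wz; last first.
  by rewrite big1// => j _; rewrite indicE memNset// => /sub /mem_set; rewrite (negPf wz).
move: wz; rewrite inE => -[y Xy yz].
have [j [y' [Xy' yE]]] := lattice_inv latticeX Xy.
have jz : cell (rcons w j) z by exists y' => //; rewrite Fw_rcons -yE.
rewrite (bigD1 j)//= indicE mem_set// big1 ?addr0// => i ij.
rewrite indicE memNset// => iz.
apply: (h Xz [tuple of rcons w i] [tuple of rcons w j]) => //.
by rewrite -val_eqE /= eqseq_rcons eqxx.
Qed.

Lemma step_refine n m (c : seq 'I_4 -> R[i]) : (n <= m)%N ->
  \sum_(w : n.-tuple 'I_4) c w *: T (ind w)
  = \sum_(v : m.-tuple 'I_4) c (take n v) *: T (ind v).
Proof.
move=> /subnKC <-; elim: (m - n)%N => [|k ->].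
  by rewrite addn0; apply: eq_bigr => w _; rewrite take_oversize// size_tuple.
rewrite addnS (sum_rcons (n + k) (fun v => c (take n v) *: T (ind v))).
apply: eq_bigr => w _; rewrite ind_split scaler_sumr; apply: eq_bigr => j _.
by rewrite -cats1 takel_cat// size_tuple leq_addr.
Qed.

Lemma step_le n m v : (n <= m)%N -> step n v -> step m v.
Proof. by move=> nm [c ->]; rewrite (step_refine c nm); exists (fun v => c (take n v)). Qed.

Lemma step0 n : step n 0.
Proof. by exists (fun=> 0); rewrite big1// => w _; rewrite scale0r. Qed.

Lemma stepD n u v : step n u -> step n v -> step n (u + v).
Proof.
move=> [c ->] [d ->]; exists (fun w => c w + d w).
by rewrite -big_split; apply: eq_bigr => w _; rewrite /= scalerDl.
Qed.

Lemma stepZ n k v : step n v -> step n (k *: v).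
Proof.
move=> [c ->]; exists (fun w => k * c w).
by rewrite scaler_sumr; apply: eq_bigr => w _; rewrite scalerA.
Qed.

Lemma step_approximable n v : step n v -> approximable v.
Proof. by move=> nv e e0; exists n, v; rewrite subrr /nrm normr0. Qed.

Lemma approximable_lim v : (forall e, 0 < e -> exists v', approximable v' /\ nrm (v - v') < e) ->
  approximable v.
Proof.
move=> h e e0; have e2 : 0 < e / 2 by rewrite divr_gt0.
have [u [cu vu]] := h _ e2; have [n [v' [nv' uv']]] := cu _ e2.
exists n, v'; split => //; have := nrmB_le v u v'; lra.
Qed.

Lemma approximableD u v : approximable u -> approximable v -> approximable (u + v).
Proof.
move=> cu cv e e0; have e2 : 0 < e / 2 by rewrite divr_gt0.
have [n [u' [nu' uu']]] := cu _ e2; have [m [v' [mv' vv']]] := cv _ e2.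
exists (maxn n m), (u' + v'); split.
  by apply: stepD; [apply: step_le nu'; exact: leq_maxl|apply: step_le mv'; exact: leq_maxr].
by rewrite opprD addrACA; apply: (le_lt_trans (nrmD _ _)); lra.
Qed.

Lemma nrmZ c (v : H) : nrm (c *: v) = nrm v * Num.sqrt (sqnorm c).
Proof.
rewrite -[LHS]ger0_norm ?nrm_ge0// -sqrtr_sqr nrm_sqr sqnormZ.
by rewrite mulrC sqrtrM ?sqnorm_ge0// -nrm_sqr sqrtr_sqr ger0_norm// nrm_ge0.
Qed.

Lemma approximableZ k v : approximable v -> approximable (k *: v).
Proof.
move=> cv e e0; have q0 : 0 < Num.sqrt (sqnorm k) + 1.
  by rewrite ltr_wpDl// sqrtr_ge0.
have [n [v' [nv' vv']]] := cv _ (divr_gt0 e0 q0).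
exists n, (k *: v'); split; first exact: stepZ.
rewrite -scalerBr nrmZ; apply: (@le_lt_trans _ _ (nrm (v - v') * (Num.sqrt (sqnorm k) + 1))).
  by rewrite ler_wpM2l ?nrm_ge0// lerDl.
by rewrite -ltr_pdivlMr.
Qed.

Lemma approximable_sum (I : Type) (r : seq I) (v : I -> H) :
  (forall i, approximable (v i)) -> approximable (\sum_(i <- r) v i).
Proof.
move=> h; elim/big_rec : _ => [|i u _ cu]; first exact: step_approximable (step0 0).
exact: approximableD.
Qed.

Lemma nrm_lt (v : H) e : 0 < e -> sqnorm v < e ^+ 2 -> nrm v < e.
Proof. by move=> e0; rewrite -nrm_sqr ltr_pXn2r ?nnegrE ?nrm_ge0// ltW. Qed.

Lemma one_sum n : T (fun=> 1) = \sum_(w : n.-tuple 'I_4) T (ind w).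
Proof.
have [bs <-] := @Tsum _ (index_enum _) (fun w : n.-tuple 'I_4 => ind w) (fun w : n.-tuple 'I_4 => bind w).
apply: Tae => //; first exact: bounded_borel_cst.
apply: filterS (sum_indic_cells s_gt0 s_le latticeX energyG n) => z h Xz.
by rewrite /cell_indic -rmorph_sum /= h.
Qed.

Lemma sqnorm_one : sqnorm (T (fun=> 1)) = 4.
Proof.
rewrite sqT; last exact: bounded_borel_cst.
by rewrite Rintegral_cst// (nu_lattice s_gt0 s_le latticeX energyG) sqnormE /=; lra.
Qed.

Lemma approximable_lip L (g : R * R -> R) : lip L g -> approximable (T (fun z => (g z)%:C%C)).
Proof.
move=> gL; pose g' := fun z => (g z)%:C%C; move=> e e0.
have dg : dom g' := domain_lip s_gt0 s_le latticeX gL.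
have bg := domain_bounded_borel latticeX dg.
(* The squared norm of [T (fun=> 1)] is 4, so a squared oscillation of e^2/8 leaves a squared error
   of at most e^2/2. *)
have e8 : 0 < e ^+ 2 / 8 by rewrite divr_gt0 ?exprn_gt0.
have [n _ /(_ n (leqnn _)) hn] := domain_oscillation dg e8.
have := mul_step_le s_gt0 s_le latticeX energyG formsH (fun=> 1) bg (ltW e8) hn.
under eq_bigr do rewrite scale1r; rewrite -one_sum sqnorm_one.
rewrite (mul_T s_gt0 s_le latticeX formsH)//; last exact: bounded_borel_cst.
under [X in T X]eq_fun do rewrite mulr1.
under eq_bigr do rewrite mul1r.
move=> h; eexists n, _; split; last first.
  apply: nrm_lt => //; apply: (le_lt_trans h).
  by have := exprn_gt0 2 e0; lra.
by exists (fun w => g' (rgt w)).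
Qed.

Lemma sqnorm_real_T (g : R * R -> R) M : measurable_fun X g -> (forall z, X z -> `|g z| <= M) ->
  sqnorm (T (fun z => (g z)%:C%C)) = \int[nu]_(z in X) (g z ^+ 2).
Proof.
move=> mg gM; rewrite sqT; last exact: bounded_borel_real mg gM.
by apply: eq_Rintegral => z _; rewrite sqnorm_real.
Qed.

Lemma indic_le1 (B : set (R * R)) z : `|\1_B z| <= 1 :> R.
Proof. by rewrite indicE; case: (_ \in _); rewrite ?normr0 ?normr1. Qed.

(** A tent g has values in [0, 1] and is 1 on C, so (1_C - g)^2 <= g - 1_C: the L^2 error is
    controlled by the gap of the integrals, which [tents_cvg] sends to 0. *)
Lemma approximable_closed C : closed C -> approximable (T (fun z => (\1_C z)%:C%C)).
Proof.
move=> cC; have mC := plane_closed_measurable cC.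
have [g [gl g01 g1 g0]] := closed_tents cC.
have cv := tents_cvg mX (m := nu) cC gl g01 g1 g0.
apply: approximable_lim => e e0.
have e2 : 0 < e ^+ 2 by rewrite exprn_gt0.
have /cvgrPdist_lt /(_ _ e2) [n _ /(_ n (leqnn _)) /= hn] := cv.
exists (T (fun z => (g n z)%:C%C)); split; first exact: approximable_lip (gl n).
have mg := lip_measurable mX (gl n).
have gM z : X z -> `|g n z| <= 1 by have /andP[h1 h2] := g01 n z; rewrite ger0_norm.
have m1 : measurable_fun X (\1_C : R * R -> R) by exact: measurable_indic.
apply: nrm_lt => //; rewrite -TB; last 2 first.
- exact: bounded_borel_indic.
- exact: bounded_borel_real mg gM.
under [X in T X]eq_fun do rewrite -rmorphB.
have b2 z : X z -> `|\1_C z - g n z| <= 2.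
  by move=> Xz; apply: (le_trans (ler_normB _ _)); have := indic_le1 C z; have := gM z Xz; lra.
rewrite (@sqnorm_real_T (fun z => \1_C z - g n z) 2)//; last exact: measurable_funB.
apply: le_lt_trans hn.
rewrite -(Rintegral_indic mX nu mC) -RintegralB//; last 2 first.
- exact: indic_integrable.
- exact: (@bounded_integrable _ _ mX _ _ 1).
apply: (@le_trans _ _ (\int[nu]_(z in X) (g n z - \1_C z))); last first.
  rewrite -[leRHS]normrN -[X in _ <= `|X|]mulN1r -RintegralZl//.
    by apply: (le_trans _ (ler_norm _)); rewrite le_eqVlt; apply/orP; left; apply/eqP;
      apply: eq_Rintegral => z _; rewrite mulN1r opprB.
  apply: (@bounded_integrable _ _ mX _ _ 2) => //; exact: measurable_funB.
apply: le_Rintegral => //.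
- apply: (@bounded_integrable _ _ mX _ _ (2 ^+ 2)) => [|z Xz].
    by apply: measurable_funX; exact: measurable_funB.
  by rewrite normrX ler_pXn2r ?nnegrE ?b2.
- apply: (@bounded_integrable _ _ mX _ _ 2) => [|z Xz]; first exact: measurable_funB.
  by rewrite -normrN opprB b2.
move=> z Xz; rewrite indicE; have /andP[h1 h2] := g01 n z.
case: (boolP (z \in C)) => [|_].
  by rewrite inE => /(g1 n) ->; rewrite subrr expr0n.
by rewrite sub0r sqrrN subr0 expr2 ler_piMl.
Qed.

(** Dynkin's argument: closed sets form a generating pi-system, and the sets with approximable
    indicator a lambda-system. For an increasing union the difference of indicators is its own
    square, so convergence of masses gives convergence in L^2. *)
Lemma approximable_borel B : measurable B -> approximable (T (fun z => (\1_B z)%:C%C)).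
Proof.
move=> mB.
pose good := [set B | measurable B /\ approximable (T (fun z => (\1_B z)%:C%C))].
suff : <<s [set C : set (R * R) | closed C] >> `<=` good.
  by move=> h; apply: (h B _).2; rewrite -plane_measurableE.
apply: lambda_system_subset => //; last first.
- by move=> C /= cC; split; [exact: plane_closed_measurable|exact: approximable_closed].
- split=> //.
  + by split; [exact: measurableT|apply: approximable_closed; exact: closedT].
  + move=> A C CA [mA cA] [mC cC]; split; first exact: measurableD.
    rewrite (_ : (fun z => _) = (fun z => (\1_A z)%:C%C - (\1_C z)%:C%C)); last first.
      apply/funext => z; rewrite -rmorphB; congr (_%:C%C).
      rewrite !indicE in_setD; case: (boolP (z \in C)) => [|_].
        by rewrite inE => /CA /mem_set ->; rewrite subrr.
      by rewrite andbT subr0.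
    rewrite TB; [|exact: bounded_borel_indic..].
    by apply: approximableD => //; rewrite -scaleN1r; exact: approximableZ.
  move=> A ndA hA; have mA i : measurable (A i) by have [] := hA i.
  have mU : measurable (\bigcup_i A i) by exact: bigcupT_measurable.
  split => //; apply: approximable_lim => e e0.
  have e2 : 0 < e ^+ 2 by rewrite exprn_gt0.
  have : fine (nu (A n `&` X)) @[n --> \oo] --> fine (nu ((\bigcup_i A i) `&` X)).
    apply: fine_cvg; rewrite fineK; last by apply: fin_num_measure; exact: measurableI.
    rewrite setI_bigcupl; apply: nondecreasing_cvg_mu.
    - by move=> i; exact: measurableI.
    - by apply: bigcupT_measurable => i; exact: measurableI.
    - by move=> i j ij; apply/subsetPset; apply: setSI; apply/subsetPset; exact: ndA.
  move=> /cvgrPdist_lt /(_ _ e2) [n _ /(_ n (leqnn _)) /= hn].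
  exists (T (fun z => (\1_(A n) z)%:C%C)); split; first by have [] := hA n.
  apply: nrm_lt => //; rewrite -TB; [|exact: bounded_borel_indic..].
  under [X in T X]eq_fun do rewrite -rmorphB.
  have sub z : A n z -> (\bigcup_i A i) z by move=> ?; exists n.
  have e01 z : (\1_(\bigcup_i A i) z - \1_(A n) z) ^+ 2 = \1_(\bigcup_i A i) z - \1_(A n) z :> R.
    rewrite !indicE; case: (boolP (z \in A n)) => [|_].
      by rewrite inE => /sub /mem_set ->; rewrite subrr expr0n.
    by rewrite subr0; case: (_ \in _); rewrite ?expr1n ?expr0n.
  rewrite (@sqnorm_real_T (fun z => \1_(\bigcup_i A i) z - \1_(A n) z) 2); last 2 first.
  - by apply: measurable_funB; exact: measurable_indic.
  - move=> z _; apply: (le_trans (ler_normB _ _)).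
    by have := indic_le1 (A n) z; have := indic_le1 (\bigcup_i A i) z; lra.
  under eq_Rintegral do rewrite e01.
  rewrite RintegralB//; [|exact: indic_integrable..].
  rewrite !(Rintegral_indic mX)//.
  by apply: le_lt_trans hn; exact: ler_norm.
by move=> C D cC cD; exact: closedI.
Qed.

(** Layer cake: once g is shifted to be nonnegative, N times g is within 1 of the number of integer
    levels that it reaches, a finite sum of indicators. Undoing the shift costs a multiple of
    [T (fun=> 1)], a step form of scale 0. *)
Lemma approximable_real_borel (g : R * R -> R) M : measurable_fun X g ->
  (forall z, X z -> `|g z| <= M) -> approximable (T (fun z => (g z)%:C%C)).
Proof.
move=> mg gM.
have aff c : approximable (T (fun z => (g z + c)%:C%C)) -> approximable (T (fun z => (g z)%:C%C)).
  move=> h; rewrite (_ : (fun z => (g z)%:C%C) = fun z => (g z + c)%:C%C + (- c)%:C%C * 1); last first.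
    by apply/funext => z; rewrite mulr1 -rmorphD addrK.
  have b1 : bb (fun=> 1) := bounded_borel_cst 1.
  rewrite TD; [|by apply: (@bounded_borel_real _ _ _ (M + `|c|)) => [|z Xz];
    [apply: measurable_funD => //; exact: measurable_cst
    |apply: (le_trans (ler_normD _ _)); rewrite lerD2r gM]|exact: bounded_borelZ].
  apply: approximableD => //; rewrite TZ//; apply: approximableZ.
  by apply: (@step_approximable 0); rewrite (one_sum 0); exists (fun=> 1); apply: eq_bigr => w _; rewrite scale1r.
apply: (aff M); apply: approximable_lim => e e0.
(* The uniform error is 1/N < e/4 and the mass is 4, so the squared error is below e^2/4. The number
   K of levels exceeds the range, at most 2MN. *)
pose N := (Num.truncn (4 / e)).+1; have N0 : 0 < N%:R :> R by rewrite ltr0n.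
have NE : 4 / e < N%:R by exact: truncnS_gt.
pose K := (Num.truncn (N%:R * (M + M))).+1.
pose B k := X `&` (fun z => N%:R * (g z + M)) @^-1` `[k.+1%:R, +oo[.
have mB k : measurable (B k).
  have : measurable_fun X (fun z => N%:R * (g z + M)).
    by apply: measurable_funM; [exact: measurable_cst|apply: measurable_funD => //; exact: measurable_cst].
  by apply => //; exact: measurable_itv.
pose h z : R := N%:R^-1 * \sum_(k < K) \1_(B k) z.
have bB (k : 'I_K) : bb (fun z => (\1_(B k) z)%:C%C) by exact: bounded_borel_indic.
have [bs Ts] := @Tsum 'I_K (index_enum _) _ bB.
have hE : (fun z => (h z)%:C%C) = (fun z => (N%:R^-1 : R)%:C%C * \sum_(k < K) (\1_(B k) z : R)%:C%C).
  by apply/funext => z; rewrite /h rmorphM rmorph_sum.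
exists (T (fun z => (h z)%:C%C)); split.
  rewrite hE TZ// Ts; apply: approximableZ; apply: approximable_sum => k.
  exact: approximable_borel.
have bgM : bb (fun z => (g z + M)%:C%C).
  apply: (@bounded_borel_real _ _ _ (M + `|M|)) => [|z Xz].
    by apply: measurable_funD => //; exact: measurable_cst.
  by apply: (le_trans (ler_normD _ _)); rewrite lerD2r gM.
have bh : bb (fun z => (h z)%:C%C) by rewrite hE; exact: bounded_borelZ.
have gh z : X z -> `|g z + M - h z| <= N%:R^-1.
  move=> Xz; rewrite (_ : _ - h z = N%:R^-1 * (N%:R * (g z + M) - \sum_(k < K) \1_(B k) z)); last first.
    by rewrite mulrBr mulKf// gt_eqF.
  rewrite normrM gtr0_norm ?invr_gt0//; apply: ler_piMr; first by rewrite invr_ge0 ltW.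
  rewrite (eq_bigr (fun k : 'I_K => (nat_of_bool (k.+1%:R <= N%:R * (g z + M))%R)%:R)) => [|k _].
    apply: layer_sum; have /ler_normlP [g1 g2] := gM z Xz; apply/andP; split.
      by apply: mulr_ge0; [exact: ltW|lra].
    apply: ltW; apply: le_lt_trans (truncnS_gt _).
    by rewrite ler_pM2l//; lra.
  rewrite indicE in_setI mem_set//=; congr (nat_of_bool _)%:R.
  by apply/idP/idP; rewrite inE /= in_itv /= andbT.
apply: nrm_lt => //; rewrite -TB//.
under [X in T X]eq_fun do rewrite -rmorphB.
have bd : bb (fun z => (g z + M - h z)%:C%C).
  rewrite (_ : (fun z => _) = fun z => (g z + M)%:C%C - (h z)%:C%C); first exact: bounded_borelB.
  by apply/funext => z; rewrite rmorphB.
have m1 : measurable_fun X (fun z => g z + M - h z) by case: bd.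
rewrite (sqnorm_real_T m1 gh).
apply: (@le_lt_trans _ _ (N%:R^-1 ^+ 2 * fine (nu X))).
  apply: bounded_Rintegral_le => // [|z Xz]; first exact: measurable_funX.
  by rewrite normrX ler_pXn2r ?nnegrE ?gh// invr_ge0 ltW.
rewrite (nu_lattice s_gt0 s_le latticeX energyG).
have Ne : N%:R^-1 < e / 4 by rewrite -[e / 4]invrK invf_div ltf_pV2 ?posrE// divr_gt0.
have : N%:R^-1 ^+ 2 < (e / 4) ^+ 2 by rewrite ltr_pXn2r ?nnegrE// ?invr_ge0 ltW// divr_gt0.
by have := exprn_gt0 2 e0; rewrite exprMn; lra.
Qed.

Lemma approximable_bounded_borel g : bb g -> approximable (T g).
Proof.
move=> bg; have [M [M0 h1 h2]] := bounded_borel_ReIm bg; case: (bg) => m1 m2 _.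
have b1 := bounded_borel_real m1 h1; have b2 := bounded_borel_real m2 h2.
rewrite (_ : g = fun z => (Re (g z))%:C%C + 'i * (Im (g z))%:C%C).
  rewrite TD//; last exact: bounded_borelZ.
  apply: approximableD; first exact: approximable_real_borel m1 h1.
  by rewrite TZ//; apply: approximableZ; exact: approximable_real_borel m2 h2.
by apply/funext => z; rewrite -complexiE; case: (g z) => a b; simpc.
Qed.

Lemma pos_complexE (d : R[i]) : 0 < d -> d = (Re d)%:C%C /\ 0 < Re d.
Proof. by case: d => a b; rewrite ltcE /= => /andP[/eqP e a0]; rewrite e. Qed.

Lemma mul_continuous_nrm h v e : bb h -> 0 < e ->
  exists2 d, 0 < d & forall v', nrm (v - v') < d -> nrm (mul h v - mul h v') < e.
Proof.
move=> bh e0; have := @Defs.mul_continuous _ _ _ _ _ _ _ _ formsH h bh v.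
have eC : 0 < e%:C%C :> R[i] by rewrite ltcR.
move=> /cvgrPdist_lt /(_ _ eC) /nbhs_ballP [d /= /pos_complexE [-> d0] hd].
exists (Re d) => // v' vv'; have := hd v'; rewrite -ball_normE /ball_ /= !nrmE !ltcR.
exact.
Qed.

Lemma deriv_cvg f : dom f ->
  nrm (deriv f - \sum_(w : n.-tuple 'I_4) ((len n)^-1%:C%C * D f w) *: T (ind w))
  @[n --> \oo] --> 0.
Proof.
move=> df; apply/cvgrPdist_lt => e e0; have e2 : 0 < e ^+ 2 by rewrite exprn_gt0.
have /cvgrPdist_lt /(_ _ e2) := domain_cvg df; apply: filterS => n hn.
rewrite sub0r normrN ger0_norm ?nrm_ge0//; apply: nrm_lt => //.
rewrite (sqnorm_deriv_step s_gt0 s_le latticeX energyG formsH)//.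
by apply: le_lt_trans hn; exact: ler_norm.
Qed.

(** The form f (x) g is g times df. As df is a limit of step forms and multiplication by g is
    continuous, only forms h dx_1 with h bounded Borel remain: x_1 alone generates all 1-forms. *)
Lemma approximable_tens f g : dom f -> bb g -> approximable (tens f g).
Proof.
move=> df bg; rewrite -(deriv_mul formsH df bg).
apply: approximable_lim => e e0; have [d d0 hd] := mul_continuous_nrm (deriv f) bg e0.
have /cvgrPdist_lt /(_ _ d0) [n _ /(_ n (leqnn _))] := deriv_cvg df.
rewrite /= sub0r normrN ger0_norm ?nrm_ge0// => /hd hn.
eexists; split; last exact: hn.
rewrite (mul_lin formsH)//; apply: approximable_sum => w; apply: approximableZ.
rewrite (mul_T s_gt0 s_le latticeX formsH)//; apply: approximable_bounded_borel.
exact: bounded_borelM.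
Qed.

Lemma all_approximable v : approximable v.
Proof.
apply: approximable_lim => e e0.
have eC : 0 < e%:C%C :> R[i] by rewrite ltcR.
have [v' [vv' [n [c [u [hu vE]]]]]] : (ball v e%:C%C `&` lin_span setT
    [set u | exists f g, [/\ dom f, bb g & u = tens f g]]) !=set0.
  by apply: (tens_dense formsH); [exists v; exact: ballxx|exact: ball_open].
exists v'; split; last by move: vv'; rewrite -ball_normE /ball_ /= nrmE ltcR.
rewrite vE; apply: approximable_sum => k; apply: approximableZ.
by have [_ [f [g [df bg ->]]]] := hu k; exact: approximable_tens.
Qed.

End Density.

(** * Convergence of the magnetic energies *)

Lemma derive_small (R : realType) (g : R -> R) (d e : R) : is_derive (0 : R) (1 : R) g d -> 0 < e ->
  exists2 r, 0 < r & forall t, `|t| < r -> `|g t - g 0 - d * t| <= e * `|t|.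
Proof.
move=> gd e0.
have : h^-1 *: ((g \o shift 0) (h *: 1) - g 0) @[h --> 0^'] --> d.
  by rewrite -(@derive_val _ _ _ _ _ _ _ gd); exact: (@ex_derive _ _ _ _ _ _ _ gd).
move=> /cvgrPdist_le /(_ e e0); rewrite near_withinE => /nbhs_ballP [r /= r0 hr].
exists r => // t tr; have [->|t0] := eqVneq t 0.
  by rewrite subrr sub0r mulr0 oppr0 normr0 mulr0.
have := hr t; rewrite /ball /= sub0r normrN => /(_ tr t0).
rewrite addr0 -[t *: 1]/(t * 1) mulr1 -[_ *: _]/(t^-1 * (g t - g 0)) => h.
have -> : g t - g 0 - d * t = - (d - t^-1 * (g t - g 0)) * t by field.
by rewrite normrM normrN ler_wpM2r.
Qed.

Lemma expi_small (R : realType) (e : R) : 0 < e -> exists2 r, 0 < r &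
  forall t, t ^+ 2 <= r -> sqnorm ((cos t +i* sin t)%C - 1 - 'i * (t%:C)%C) <= e * t ^+ 2.
Proof.
(* d^2 <= e/2 is spent twice, on the cosine and on the sine. *)
move=> e0; pose d := Num.min 1 (e / 2).
have d0 : 0 < d by rewrite lt_min ltr01 divr_gt0.
have d2 : d ^+ 2 <= e / 2.
  have h1 : d <= 1 by rewrite ge_min lexx.
  have h2 : d <= e / 2 by rewrite ge_min lexx orbT.
  by rewrite expr2; apply: le_trans h2; rewrite ler_piMl// ltW.
have [r1 r10 h1] := derive_small (is_derive_cos 0) d0.
have [r2 r20 h2] := derive_small (is_derive_sin 0) d0.
pose r := Num.min r1 r2; have r0 : 0 < r by rewrite lt_min r10 r20.
exists ((r / 2) ^+ 2) => [|t]; first by rewrite exprn_gt0// divr_gt0.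
move=> tr2; have tt := real_normK (num_real t).
have tr : `|t| <= r / 2.
  by rewrite -(ler_pXn2r (n := 2)) ?nnegrE ?divr_ge0 ?(ltW r0)// tt.
have [t1 t2] : `|t| < r1 /\ `|t| < r2.
  by split; apply: (le_lt_trans tr); apply: (@lt_le_trans _ _ r); rewrite ?ltr_pdivrMr ?ge_min ?lexx ?orbT//; lra.
have := h1 t t1; have := h2 t t2; rewrite sin0 cos0 oppr0 mul0r !subr0 mul1r addr0 => s2 c2.
rewrite sqnormE -complexiE; simpc; rewrite /=.
rewrite -(real_normK (num_real (cos t - 1))) -(real_normK (num_real (sin t - t))).
have : `|cos t - 1| ^+ 2 <= (d * `|t|) ^+ 2.
  by rewrite ler_pXn2r ?nnegrE ?mulr_ge0// ltW.
have : `|sin t - t| ^+ 2 <= (d * `|t|) ^+ 2.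
  by rewrite ler_pXn2r ?nnegrE ?mulr_ge0// ltW.
by rewrite exprMn -tt; have := ler_wpM2r (sqr_ge0 `|t|) d2; lra.
Qed.

Lemma nrm_cvg_sqnorm (R : realType) (H : completeNormedModType R[i]) (q : nat -> H) (v : H) :
  nrm (q n - v) @[n --> \oo] --> 0 -> sqnorm (q n) @[n --> \oo] --> sqnorm v.
Proof.
move=> h.
have c : nrm (q n) @[n --> \oo] --> nrm v.
  apply/cvgrPdist_lt => e e0; move/cvgrPdist_lt: h => /(_ e e0).
  apply: filterS => n; rewrite sub0r normrN ger0_norm ?nrm_ge0// => h.
  apply: le_lt_trans h; have := nrmD (q n - v) v; have := nrmD (v - q n) (q n).
  by rewrite !subrK (nrmB_sym v) => h1 h2; apply/ler_normlP; split; lra.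
rewrite -[sqnorm v]/(nrm v ^+ 2) expr2.
by under eq_fun do rewrite -[sqnorm _]/(nrm _ ^+ 2) expr2; exact: cvgM.
Qed.

Section Convergence.
Context {R : realType} {s : R} (s_gt0 : 0 < s) (s_le : s <= 8^-1) {X : set (R * R)}.
Hypothesis latticeX : is_lattice s X.
Context {G : (R * R -> R[i]) -> {finite_measure set (R * R)%type -> \bar R}}.
Hypothesis energyG : is_energy_measure s X G.
Context {H : completeNormedModType R[i]} {ip : {dot H for @Num.conj R[i]}}.
Context {tens : (R * R -> R[i]) -> (R * R -> R[i]) -> H}.
Context {mul : (R * R -> R[i]) -> H -> H}.
Hypothesis formsH : is_one_forms s X G ip tens mul.
Context {a : H} {a_ : nat -> H} {A : forall m, m.-tuple 'I_4 -> R * R -> R}.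
Hypothesis a_proj : forall m, is_projection ip (H_ s X tens mul m) a (a_ m).
Hypothesis A_repr : forall m, represents s X tens mul (@A m) (a_ m).
Implicit Types (f g : R * R -> R[i]).

Local Notation lft := (@lft R s).
Local Notation rgt := (@rgt R s).
Local Notation dom := (in_domain s X).
Local Notation len := (@edge_length R).
Local Notation D f w := (f (rgt w) - f (lft w)).
Local Notation ind := (cell_indic s X).
Local Notation T := (tens fstC).
Local Notation deriv := (derivation tens).
Let E_atE := energy_atE s_gt0 s_le latticeX.
Let dfst := domain_fst s_gt0 s_le latticeX.
Let ip_n := ip_norm formsH.

Definition flow n (w : n.-tuple 'I_4) : R := @A n w (rgt w) - @A n w (lft w).

Lemma edge_length_neq0 n : len n != 0.
Proof. by rewrite gt_eqF// edge_length_gt0. Qed.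

Lemma fst_harmonic n : harmonic_at s X n fstC.
Proof.
split=> // m _; suff e k : energy_at s k fstC = 4 by rewrite !e.
rewrite E_atE -[RHS](sum_len k); apply: eq_bigr => w _.
by rewrite fst_edge sqnorm_real size_tuple.
Qed.

(** On an n-cell the form dA of a function harmonic at scale n is a constant times dx_1, the
    constant being the increment of A over that of x_1. *)
Lemma proj_step n : a_ n = \sum_(w : n.-tuple 'I_4) ((len n)^-1 * flow w)%:C%C *: T (ind w).
Proof.
have [hA ->] := A_repr n; apply: eq_bigr => w _.
rewrite (mul_ind_harmonic s_gt0 s_le latticeX energyG formsH w (hA w)).
by rewrite -rmorphB -rmorphM.
Qed.

(** [T (ind w)] is (dx_1) 1_w, a generator of [H_] at scale n because x_1 is harmonic at every
    scale. *)
Lemma proj_orth n (w : n.-tuple 'I_4) : ip (a - a_ n) (T (ind w)) = 0.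
Proof.
have [_] := a_proj n; apply; exists 1%N, (fun=> 1), (fun=> T (ind w)); split.
  move=> _; split => //; exists w, fstC; split; first exact: fst_harmonic.
  by rewrite (mul_ind_deriv s_gt0 s_le latticeX formsH).
by rewrite big_ord1 scale1r.
Qed.

Lemma proj_orth_step n v : step (s := s) (X := X) (tens := tens) n v -> ip (a - a_ n) v = 0.
Proof.
by move=> [c ->]; rewrite ip_sumr big1// => w _; rewrite ipZr proj_orth mulr0.
Qed.

Lemma step_proj n : step (s := s) (X := X) (tens := tens) n (a_ n).
Proof.
rewrite proj_step; exists (fun v => if insub v is Some w then ((len n)^-1 * @flow n w)%:C%C else 0).
by apply: eq_bigr => w _; rewrite valK.
Qed.

Lemma proj_best n v : step (s := s) (X := X) (tens := tens) n v ->
  sqnorm (a - a_ n) <= sqnorm (a - v).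
Proof.
move=> nv; rewrite -[a - v](subrKA (a_ n)) [leRHS](sqnormDE ip_n).
have -> : ip (a - a_ n) (a_ n - v) = 0.
  by apply: proj_orth_step; apply: stepD; [exact: step_proj|rewrite -scaleN1r; exact: stepZ].
by rewrite mulr0 addr0 lerDl sqnorm_ge0.
Qed.

Lemma sqnorm_proj_le n : sqnorm (a_ n) <= sqnorm a.
Proof.
rewrite -[a in leRHS](subrK (a_ n)) [leRHS](sqnormDE ip_n) proj_orth_step; last exact: step_proj.
by rewrite mulr0 addr0 lerDr sqnorm_ge0.
Qed.

Lemma nrm_le (u v : H) : sqnorm u <= sqnorm v -> nrm u <= nrm v.
Proof. by rewrite -!nrm_sqr ler_pXn2r ?nnegrE ?nrm_ge0. Qed.

Lemma proj_cvg : nrm (a - a_ n) @[n --> \oo] --> 0.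
Proof.
apply/cvgrPdist_lt => e e0.
have [m [v [mv av]]] := all_approximable s_gt0 s_le latticeX energyG formsH a e0.
exists m => // n /= mn; rewrite sub0r normrN ger0_norm ?nrm_ge0//.
apply: le_lt_trans av; apply: nrm_le; apply: proj_best.
exact: (step_le s_gt0 s_le latticeX energyG formsH mn mv).
Qed.

Lemma sum_flow n : \sum_(w : n.-tuple 'I_4) flow w ^+ 2 = sqnorm (a_ n).
Proof.
rewrite proj_step (pythagoras ip_n) => [|w v]; last exact: (ip_ind s_gt0 s_le latticeX energyG formsH).
apply: eq_bigr => w _; rewrite (sqnorm_ind s_gt0 s_le latticeX energyG formsH) sqnorm_real.
by field; exact: edge_length_neq0.
Qed.

(** The flow is a pairing with a itself, so a may be replaced by an approximation of another
    scale. *)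
Lemma ip_flow n (w : n.-tuple 'I_4) : ip a (T (ind w)) = (flow w * len n)%:C%C.
Proof.
rewrite -[a](subrK (a_ n)) ipDl proj_orth add0r proj_step ip_suml (bigD1 w)//=.
rewrite big1 => [|v vw]; last by rewrite ipZl (ip_ind s_gt0 s_le latticeX energyG formsH)// mulr0.
rewrite addr0 ipZl (ip_sqnorm ip_n) (sqnorm_ind s_gt0 s_le latticeX energyG formsH) -rmorphM.
by congr (_%:C%C); field; exact: edge_length_neq0.
Qed.

(* Approximate a by a step form of a fixed scale m: on an n-cell, n >= m, its
   flow is proportional to the edge length. *)
Lemma flow_small e : 0 < e -> \forall n \near \oo, forall w : n.-tuple 'I_4, flow w ^+ 2 <= e.
Proof.
move=> e0; pose d := Num.min 1 (e / 4).
have d0 : 0 < d by rewrite lt_min ltr01 divr_gt0.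
have d2 : d ^+ 2 <= e / 4.
  have h1 : d <= 1 by rewrite ge_min lexx.
  have h2 : d <= e / 4 by rewrite ge_min lexx orbT.
  by rewrite expr2; apply: le_trans h2; rewrite ler_piMl// ltW.
have [m [v [[c vE] av]]] := all_approximable s_gt0 s_le latticeX energyG formsH a d0.
pose C := \sum_(u : m.-tuple 'I_4) sqnorm (c u).
have C0 : 0 <= C by apply: sumr_ge0 => u _; exact: sqnorm_ge0.
(* The final bound is 2 (d^2 + C len^2), and each summand has to be at most e/4. Since len < 1, C
   len^2 is at most (C + 1) len. *)
have r0 : 0 < Num.min 1 (e / 4 / (C + 1)).
  by rewrite lt_min ltr01 !divr_gt0// ltr_wpDl.
have := edge_length_small r0; apply: filterS2 (nbhs_infty_ge m) => n /= mn.
rewrite lt_min => /andP[l1 l2] w.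
have l0 := edge_length_gt0 (R := R) n.
have ipv : ip v (T (ind w)) = c (take m w) * (len n ^+ 2)%:C%C.
  rewrite vE (step_refine s_gt0 s_le latticeX energyG formsH c mn) ip_suml (bigD1 w)//=.
  rewrite big1 => [|u uw]; last by rewrite ipZl (ip_ind s_gt0 s_le latticeX energyG formsH)// mulr0.
  by rewrite addr0 ipZl (ip_sqnorm ip_n) (sqnorm_ind s_gt0 s_le latticeX energyG formsH).
have cC : sqnorm (c (take m w)) <= C.
  have st : size (take m w) == m by rewrite size_takel// size_tuple.
  rewrite /C (bigD1 (Tuple st))//= lerDl; apply: sumr_ge0 => u _; exact: sqnorm_ge0.
have cs : sqnorm (ip (a - v) (T (ind w))) <= d ^+ 2 * len n ^+ 2.
  apply: (le_trans (cauchy_schwarz ip_n _ _)).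
  rewrite (sqnorm_ind s_gt0 s_le latticeX energyG formsH) ler_wpM2r ?sqr_ge0//.
  by rewrite -nrm_sqr ler_pXn2r ?nnegrE ?nrm_ge0// ltW.
have : flow w ^+ 2 * len n ^+ 2 <= 2 * (d ^+ 2 * len n ^+ 2 + C * len n ^+ 2 * len n ^+ 2).
  have -> : flow w ^+ 2 * len n ^+ 2 = sqnorm (ip a (T (ind w))).
    by rewrite ip_flow sqnorm_real [RHS]exprMn.
  rewrite -[a](subrK v) ipDl.
  apply: (le_trans (sqnormD_le _ _)); rewrite ler_wpM2l// lerD// ipv sqnormM sqnorm_real.
  by rewrite -mulrA -expr2 ler_wpM2r// sqr_ge0.
have C1 : C * len n ^+ 2 <= e / 4.
  apply: (@le_trans _ _ ((C + 1) * len n)).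
    apply: ler_pM; rewrite ?sqr_ge0// ?lerDl// expr2 ler_piMl// ltW//.
  by rewrite mulrC -ler_pdivlMr ?ltr_wpDl// ltW.
rewrite -mulrDl mulrA ler_pM2r ?exprn_gt0// => h.
apply: (le_trans h); move: d2 C1; lra.
Qed.

(** No other n-cell contains both ends of the edge of w, so the result of [pick] is forced. *)
Lemma edge_valueE n (w : n.-tuple 'I_4) :
  edge_value s X (@A n) (lft w) (rgt w) = flow w /\
  edge_value s X (@A n) (rgt w) (lft w) = - flow w.
Proof.
have cl := cell_lft s_gt0 s_le latticeX w; have cr := cell_rgt s_gt0 s_le latticeX w.
rewrite /edge_value; split; case: pickP => [v /asboolP [c1 c2]|/(_ w)].
- by rewrite (cell_edge_uniq s_gt0 s_le latticeX c1 c2).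
- by move/asboolPn => /(_ (conj cl cr)).
- by rewrite (cell_edge_uniq s_gt0 s_le latticeX c2 c1) opprB.
- by move/asboolPn => /(_ (conj cr cl)).
Qed.

Definition phase (t : R) : R[i] := (cos t +i* sin t)%C.

(** The two orientations of an edge contribute equally: multiplication by the phase, of modulus 1,
    carries one term to the negative of the other. *)
Lemma mag_energy_atE n f : mag_energy_at s X n (@A n) f =
  \sum_(w : n.-tuple 'I_4) sqnorm (f (rgt w) * phase (flow w) - f (lft w)).
Proof.
rewrite /mag_energy_at (edge_sum s_gt0 s_le latticeX n (fun x y => sqnorm (f x - f y * phase (edge_value s X (@A n) x y)))).
apply: eq_bigr => w _; have [-> ->] := edge_valueE w.
rewrite sqnormB_sym.
suff -> : sqnorm (f (rgt w) - f (lft w) * phase (- flow w)) =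
  sqnorm (f (rgt w) * phase (flow w) - f (lft w)) by lra.
have p1 : sqnorm (phase (flow w)) = 1 by rewrite sqnormE /= cos2Dsin2.
rewrite -[LHS]mulr1 -p1 -sqnormM mulrBl -mulrA.
rewrite (_ : phase (- flow w) * phase (flow w) = 1) ?mulr1//.
rewrite /phase cosN sinN; simpc; rewrite -!expr2 cos2Dsin2.
by congr (_ +i* _)%C; ring.
Qed.

Definition mag_step n f : H := \sum_(w : n.-tuple 'I_4)
  ((len n)^-1%:C%C * (f (rgt w) * phase (flow w) - f (lft w))) *: T (ind w).

Lemma sqnorm_mag_step n f : sqnorm (mag_step n f) = mag_energy_at s X n (@A n) f.
Proof.
rewrite /mag_step (pythagoras ip_n) => [|w v]; last exact: (ip_ind s_gt0 s_le latticeX energyG formsH).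
rewrite mag_energy_atE; apply: eq_bigr => w _.
rewrite (sqnorm_ind s_gt0 s_le latticeX energyG formsH) sqnormM sqnorm_real.
by field; exact: edge_length_neq0.
Qed.

(** There are two errors: a_n in place of a, controlled by continuity of [mul f], and f frozen at
    the right ends of cells, controlled by [mul_step_le]. *)
Lemma proj_mul_cvg f : dom f ->
  nrm (\sum_(w : n.-tuple 'I_4) (((len n)^-1 * flow w)%:C%C * f (rgt w)) *: T (ind w) - mul f a)
  @[n --> \oo] --> 0.
Proof.
move=> df; have bf := domain_bounded_borel latticeX df.
apply/cvgrPdist_lt => e e0; have e2 : 0 < e / 2 by rewrite divr_gt0.
have a1 : 0 < sqnorm a + 1 by rewrite ltr_wpDl// sqnorm_ge0.
(* Chosen so that its product with [sqnorm (a_ n)], at most [sqnorm a], stays below (e/2)^2. *)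
have r0 : 0 < (e / 2) ^+ 2 / (sqnorm a + 1) by rewrite divr_gt0// exprn_gt0.
have [d d0 hd] := mul_continuous_nrm formsH a bf e2.
move/cvgrPdist_lt: proj_cvg => /(_ d d0).
apply: filterS2 (domain_oscillation s_gt0 s_le latticeX df r0) => n osc.
rewrite sub0r normrN ger0_norm ?nrm_ge0// => /hd h1.
rewrite sub0r normrN ger0_norm ?nrm_ge0//.
apply: (le_lt_trans (nrmB_le _ (mul f (a_ n)) _)).
rewrite [in X in _ + X]nrmB_sym.
suff h2 : nrm (\sum_(w : n.-tuple 'I_4) (((len n)^-1 * flow w)%:C%C * f (rgt w)) *: T (ind w)
    - mul f (a_ n)) < e / 2 by lra.
rewrite nrmB_sym; apply: nrm_lt => //; rewrite {1}proj_step.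
apply: (le_lt_trans (mul_step_le s_gt0 s_le latticeX energyG formsH _ bf (ltW r0) osc)).
rewrite -proj_step mulrAC ltr_pdivrMr// ltr_pM2l ?exprn_gt0//.
by apply: (le_lt_trans (sqnorm_proj_le n)); rewrite ltrDl.
Qed.

Lemma remainder_cvg f : dom f ->
  nrm (\sum_(w : n.-tuple 'I_4) ((len n)^-1%:C%C *
    (f (rgt w) * (phase (flow w) - 1 - 'i * (flow w)%:C%C))) *: T (ind w))
  @[n --> \oo] --> 0.
Proof.
move=> df; have [M M0 fM] := domain_sqnorm_bound latticeX df.
apply/cvgrPdist_lt => e e0.
(* With k = e^2 over this product, the squared norm of the remainder is at most M k [sqnorm a],
   strictly below e^2. *)
have K0 : 0 < (M + 1) * (sqnorm a + 1).
  by rewrite mulr_gt0// ltr_wpDl// sqnorm_ge0.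
have [r r0 hr] := expi_small (divr_gt0 (exprn_gt0 2 e0) K0).
apply: filterS (flow_small r0) => n hn.
rewrite sub0r normrN ger0_norm ?nrm_ge0//; apply: nrm_lt => //.
rewrite (pythagoras ip_n) => [|w v]; last exact: (ip_ind s_gt0 s_le latticeX energyG formsH).
set k := e ^+ 2 / _ in hr.
have k0 : 0 < k by rewrite divr_gt0// exprn_gt0.
apply: (@le_lt_trans _ _ (\sum_(w : n.-tuple 'I_4) (M * k) * flow w ^+ 2)).
  apply: ler_sum => w _; rewrite (sqnorm_ind s_gt0 s_le latticeX energyG formsH).
  rewrite sqnormM sqnorm_real mulrAC -exprMn mulVf ?edge_length_neq0// expr1n mul1r sqnormM.
  rewrite -(mulrA M); apply: ler_pM; rewrite ?sqnorm_ge0//.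
    by apply: fM; exact: (lattice_rgt s_gt0 s_le latticeX).
  exact: hr.
rewrite -mulr_sumr sum_flow.
apply: (@le_lt_trans _ _ (M * k * sqnorm a)).
  by apply: ler_wpM2l (sqnorm_proj_le n); rewrite mulr_ge0// ltW.
rewrite mulrAC /k mulrA ltr_pdivrMr// mulrC ltr_pM2l ?exprn_gt0//.
by have := sqnorm_ge0 a; nra.
Qed.

(** On an edge from x to y with flow t, f(y) e^{it} - f(x) is the sum of f(y) - f(x), i t f(y) and
    f(y) (e^{it} - 1 - it). The three resulting step forms tend to df, i f a and 0. *)
Lemma mag_step_cvg f : dom f -> nrm (mag_step n f - (deriv f + 'i *: mul f a)) @[n --> \oo] --> 0.
Proof.
move=> df.
have c1 := deriv_cvg s_gt0 s_le latticeX energyG formsH df.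
have c2 := proj_mul_cvg df; have c3 := remainder_cvg df.
have c := cvgD (cvgD c1 c2) c3; rewrite !addr0 in c.
apply: (@squeeze_cvgr _ _ _ _ (fun=> 0)); [|exact: cvg_cst|exact: c].
apply: nearW => n; rewrite nrm_ge0 /=.
pose s1 := \sum_(w : n.-tuple 'I_4) ((len n)^-1%:C%C * D f w) *: T (ind w).
pose s2 := \sum_(w : n.-tuple 'I_4) (((len n)^-1 * flow w)%:C%C * f (rgt w)) *: T (ind w).
pose s3 := \sum_(w : n.-tuple 'I_4) ((len n)^-1%:C%C *
    (f (rgt w) * (phase (flow w) - 1 - 'i * (flow w)%:C%C))) *: T (ind w).
have -> : mag_step n f - (deriv f + 'i *: mul f a)
    = (s1 - deriv f) + 'i *: (s2 - mul f a) + s3.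
  have -> : mag_step n f = s1 + 'i *: s2 + s3.
    rewrite /mag_step /s1 /s2 /s3 scaler_sumr -!big_split; apply: eq_bigr => w _ /=.
    by rewrite scalerA -!scalerDl rmorphM; congr (_ *: _); ring.
  by rewrite scalerBr opprD addrAC addrACA.
apply: (le_trans (nrmD _ _)); rewrite lerD2r; apply: (le_trans (nrmD _ _)).
rewrite nrmB_sym lerD2l nrmZ -complexiE sqnormE /= expr0n expr1n add0r sqrtr1 mulr1.
exact: lexx.
Qed.

End Convergence.

Unset Implicit Arguments.

Theorem theorem3p1 (R : realType) (s : R) (s_gt0 : 0 < s) (s_le : s <= 8^-1)
    (X : set (R * R)) (latticeX : is_lattice s X)
    (G : (R * R -> R[i]) -> {finite_measure set (R * R)%type -> \bar R})
    (energyG : is_energy_measure s X G)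
    (H : completeNormedModType R[i]) (ip : {dot H for @Num.conj R[i]})
    (tens : (R * R -> R[i]) -> (R * R -> R[i]) -> H)
    (mul : (R * R -> R[i]) -> H -> H)
    (formsH : is_one_forms s X G ip tens mul)
    (a : H) (a_real : real_form s X tens a)
    (a_ : nat -> H)
    (a_proj : forall m, is_projection ip (H_ s X tens mul m) a (a_ m))
    (A : forall m, m.-tuple 'I_4 -> R * R -> R)
    (A_repr : forall m, represents s X tens mul (A m) (a_ m))
    (f : R * R -> R[i]) (f_dom : in_domain s X f) :
  mag_energy_at s X n (A n) f @[n --> \oo] --> mag_energy tens mul a f.
Proof.
(* Both energies are squared norms in H, so norm convergence of the forms [mag_step n f]
   suffices. *)
under eq_fun do rewrite -(sqnorm_mag_step s_gt0 s_le latticeX energyG formsH).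
apply: nrm_cvg_sqnorm.
exact: (mag_step_cvg s_gt0 s_le latticeX energyG formsH a_proj A_repr).
Qed.
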